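(* Let $G$ be a homogeneous group with homogeneous dimension $Q$, let $\mathscr{S}_H(G)$ be its algebra of principal Heisenberg symbols of order zero, and let $z\neq0$ be a central element of $G$. Then $$\tau_z:\mathscr{S}_H(G)\to\mathbb{C},\qquad \tau_z(f):=f(z)$$ is a trace on $\mathscr{S}_H(G)$, i.e. $\tau_z$ is linear and $\tau_z(f*g)=\tau_z(g*f)$ for all $f,g\in\mathscr{S}_H(G)$.
   Context: A homogeneous group $G$ is a nilpotent Lie group with underlying manifold $\mathbb{R}^m$ and graded Lie algebra $\mathfrak{g}=\mathfrak{g}^1\oplus\cdots\oplus\mathfrak{g}^r$, where $[\mathfrak{g}^j,\mathfrak{g}^k]\subseteq\mathfrak{g}^{j+k}$ if $j+k\le r$ and $[\mathfrak{g}^j,\mathfrak{g}^k]=0$ if $j+k>r$. $G$ is identified with $\mathfrak{g}$ via the exponential map (so the identity element is $0$). The dilations $\delta_t$, $t>0$, given by $\delta_t(X)=t^jX$ for $X\in\mathfrak{g}^j$, are group automorphisms. The homogeneous dimension is $Q=\sum_{j}j\dim\mathfrak{g}^j$. A distribution $u$ on $G$ is homogeneous of degree $d$ if $\langle u,\varphi\circ\delta_t\rangle=t^{-Q-d}\langle u,\varphi\rangle$ for all test functions $\varphi$ and $t>0$ (functions are identified with distributions via a fixed Haar measure). It is regular if it restricts to a smooth function on $G\setminus\{0\}$; then it can be evaluated at any $z\neq0$. $\Psi^0_H(G)$ is the algebra of operators of (left) convolution with compactly supported regular distributions $k$ having an asymptotic expansion $k\sim k_0+k_1+k_2+\cdots$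 at $0$, with principal term $k_0$ homogeneous of degree $-Q$ and higher terms $k_j$ of degree $-Q+j$ (up to the usual logarithmic terms), in the sense that the remainders become arbitrarily smooth. $\mathscr{S}_H(G)=\Psi^0_H(G)/\Psi^{-1}_H(G)$, where $\Psi_H^{-1}(G)$ consists of those with $k_0=0$. Elements of $\mathscr{S}_H(G)$ are represented by (complex-valued) regular distributions on $G$ homogeneous of degree $-Q$. For $f,g\in\mathscr{S}_H(G)$, the product $f*g$ is by definition the principal part (homogeneous of degree $-Q$) in the asymptotic expansion of the group convolution $\phi f*\phi g$, where $\phi\in C_c^\infty(G)$ equals $1$ in a neighborhood of $0$; it does not depend on $\phi$. In particular, for $z\ne0$, $(f*g)(z)=\lim_{t\downarrow0}t^Q(\phi f*\phi g)(\delta_tz)$. *)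

(* Defs.v *)
From HB Require Import structures.
From mathcomp Require Import all_boot all_order all_algebra.
From mathcomp Require Import complex.
From mathcomp Require Import all_classical all_reals all_analysis.

Set Implicit Arguments.
Unset Strict Implicit.
Unset Printing Implicit Defensive.

Import Order.TTheory GRing.Theory Num.Theory.
Import numFieldNormedType.Exports.

Local Open Scope classical_set_scope.
Local Open Scope complex_scope.
Local Open Scope ring_scope.

(** * Differentiability classes *)

(* [iterD [:: v1; ...; vn] f] is the iterated directional derivative
   D_v1 (... (D_vn f)). *)
Fixpoint iterD (R : realType) (V W : normedModType R) (vs : seq V)
    (f : V -> W) : V -> W :=
  if vs is v :: vs' then fun x => 'D_v (iterD vs' f) x else f.

(* Meant for open U: f is of class C^n on U iff all its directional
   derivatives of order <= n exist and are continuous on U. *)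
Definition Ck_on (R : realType) (V W : normedModType R) (n : nat) (U : set V)
    (f : V -> W) : Prop :=
  forall vs : seq V, (size vs <= n)%N -> forall x, U x ->
    {for x, continuous (iterD vs f)} /\
    ((size vs < n)%N -> forall v, derivable (iterD vs f) x v).

Definition smooth_on (R : realType) (V W : normedModType R) (U : set V)
    (f : V -> W) : Prop := forall n, Ck_on n U f.

Definition cre (R : realType) (T : Type) (f : T -> R[i]) : T -> R :=
  fun x => complex.Re (f x).

Definition cim (R : realType) (T : Type) (f : T -> R[i]) : T -> R :=
  fun x => complex.Im (f x).

Definition cCk_on (R : realType) (V : normedModType R) (n : nat) (U : set V)
    (f : V -> R[i]) : Prop := Ck_on n U (cre f) /\ Ck_on n U (cim f).

Definition csmooth_on (R : realType) (V : normedModType R) (U : set V)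
    (f : V -> R[i]) : Prop := forall n, cCk_on n U f.

(** * Homogeneous groups *)

(* [X, Y] is the derivative at the identity, in the direction X, of
   x |-> Ad x Y.  The group is written in exponential coordinates, so that
   the identity is 0 and the inverse of x is - x. *)
Definition lie_bracket (R : realType) (m : nat)
    (mul : 'rV[R]_m -> 'rV[R]_m -> 'rV[R]_m) (X Y : 'rV[R]_m) : 'rV[R]_m :=
  'D_X (fun x => 'D_Y (fun y => mul (mul x y) (- x)) (0 : 'rV[R]_m))
    (0 : 'rV[R]_m).

(* The layers are g^j = layer j for 1 <= j <= r; the other values of layer are
   irrelevant.  On the direct sum of the g^j, the dilation of parameter t is
   multiplication by t ^+ j on g^j. *)
Definition graded_dilation (R : realType) (m r : nat)
    (layer : nat -> {vspace 'rV[R]_m}) (t : R) (X : 'rV[R]_m) : 'rV[R]_m :=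
  \sum_(i < r) t ^+ i.+1 *: sumv_pi (\sum_(j < r) layer j.+1)%VS i X.

(* The tangent space at 0 of the manifold R^m is R^m, and the Lie algebra of
   the group is R^m with the bracket above.  [hg_exp] says that
   t |-> t *: X is the one-parameter subgroup with velocity X, i.e. that the
   exponential map is the identity. *)
Record homogeneousGroup (R : realType) (m : nat) := HomogeneousGroup {
  hg_mul : 'rV[R]_m -> 'rV[R]_m -> 'rV[R]_m ;
  hg_step : nat ;
  hg_layer : nat -> {vspace 'rV[R]_m} ;
  hg_mulA : associative hg_mul ;
  hg_mul0x : left_id 0 hg_mul ;
  hg_mulNx : left_inverse 0 -%R hg_mul ;
  hg_smooth : smooth_on setT
    (fun p : 'rV[R]_m * 'rV[R]_m => hg_mul p.1 p.2) ;
  hg_exp : forall (s t : R) X, hg_mul (s *: X) (t *: X) = (s + t) *: X ;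
  hg_direct : directv (\sum_(i < hg_step) hg_layer i.+1)%VS ;
  hg_full : (\sum_(i < hg_step) hg_layer i.+1 = fullv)%VS ;
  hg_bracket : forall j k X Y,
    (0 < j <= hg_step)%N -> (0 < k <= hg_step)%N ->
    X \in hg_layer j -> Y \in hg_layer k ->
    lie_bracket hg_mul X Y \in
      (if (j + k <= hg_step)%N then hg_layer (j + k)%N else 0%VS) ;
  hg_dil_mul : forall (t : R) X Y, 0 < t ->
    graded_dilation hg_step hg_layer t (hg_mul X Y) =
    hg_mul (graded_dilation hg_step hg_layer t X)
           (graded_dilation hg_step hg_layer t Y) }.

Definition dil (R : realType) (m : nat) (G : homogeneousGroup R m) (t : R) :
    'rV[R]_m -> 'rV[R]_m := graded_dilation (hg_step G) (hg_layer G) t.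

Definition homdim (R : realType) (m : nat) (G : homogeneousGroup R m) : nat :=
  (\sum_(i < hg_step G) i.+1 * \dim (hg_layer G i.+1))%N.

Definition central (R : realType) (m : nat) (G : homogeneousGroup R m)
    (z : 'rV[R]_m) : Prop := forall x, hg_mul G z x = hg_mul G x z.

Definition borel (R : realType) (m : nat) : measurableType _ :=
  g_sigma_algebraType (@open 'rV[R]_m).

(* Regularity is automatic for Borel measures on R^m that are finite on compact
   sets. *)
Definition is_haar (R : realType) (m : nat) (G : homogeneousGroup R m)
    (mu : {measure set (borel R m) -> \bar R}) : Prop :=
  [/\ forall x (A : set (borel R m)), measurable A ->
        mu (hg_mul G x @` A) = mu A,
      forall K : set 'rV[R]_m, compact K -> (mu K < +oo)%E
    & (0 < mu setT)%E].

(** * Distributions *)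

Definition supp (R : realType) (m : nat) (phi : 'rV[R]_m -> R[i]) :
    set 'rV[R]_m := closure [set x | phi x != 0].

Definition test (R : realType) (m : nat) (phi : 'rV[R]_m -> R[i]) : Prop :=
  csmooth_on setT phi /\ compact (supp phi).

(* Distributions are encoded as functionals on all functions; their values
   outside of the space of test functions are irrelevant and never used. *)
Definition functional (R : realType) (m : nat) := ('rV[R]_m -> R[i]) -> R[i].

Definition coord_iterD (R : realType) (m : nat) (s : seq 'I_m)
    (f : 'rV[R]_m -> R) : 'rV[R]_m -> R :=
  iterD [seq delta_mx 0 i | i <- s] f.

(* Linearity, and continuity in the form of seminorm estimates on every compact
   set. *)
Definition is_distribution (R : realType) (m : nat) (u : functional R m) : Prop :=
  (forall (a : R[i]) phi psi, test phi -> test psi ->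
     u (fun x => a * phi x + psi x) = a * u phi + u psi) /\
  (forall K : set 'rV[R]_m, compact K ->
     exists (n : nat) (M : R), forall phi (B : R),
       test phi -> supp phi `<=` K ->
       (forall (s : seq 'I_m) x, (size s <= n)%N ->
          `|coord_iterD s (cre phi) x| <= B /\
          `|coord_iterD s (cim phi) x| <= B) ->
       `|u phi| <= (M * B)%:C).

Definition cintegral (R : realType) (m : nat)
    (mu : {measure set (borel R m) -> \bar R}) (f : 'rV[R]_m -> R[i]) : R[i] :=
  Complex (Rintegral mu setT (cre f : borel R m -> R))
          (Rintegral mu setT (cim f : borel R m -> R)).

(* On the open set U, the distribution u is the function d. *)
Definition represents (R : realType) (m : nat)
    (mu : {measure set (borel R m) -> \bar R}) (U : set 'rV[R]_m)
    (u : functional R m) (d : 'rV[R]_m -> R[i]) : Prop :=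
  forall phi, test phi -> supp phi `<=` U ->
    u phi = cintegral mu (fun x => d x * phi x).

Definition punctured (R : realType) (m : nat) : set 'rV[R]_m :=
  [set x | x != 0].

Definition smooth_density (R : realType) (m : nat)
    (mu : {measure set (borel R m) -> \bar R}) (u : functional R m)
    (d : 'rV[R]_m -> R[i]) : Prop :=
  csmooth_on (@punctured R m) d /\ represents mu (@punctured R m) u d.

Definition regular (R : realType) (m : nat)
    (mu : {measure set (borel R m) -> \bar R}) (u : functional R m) : Prop :=
  exists d, smooth_density mu u d.

(* Meaningful for u regular and z != 0: the smooth density is unique away
   from 0. *)
Definition eval_at (R : realType) (m : nat)
    (mu : {measure set (borel R m) -> \bar R}) (z : 'rV[R]_m)
    (u : functional R m) : R[i] :=
  xget (fun=> 0) [set d | smooth_density mu u d] z.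

Definition homogeneous (R : realType) (m : nat) (G : homogeneousGroup R m)
    (d : int) (u : functional R m) : Prop :=
  forall (t : R) phi, 0 < t -> test phi ->
    u (phi \o dil G t) = (t ^ (- (homdim G)%:Z - d))%:C * u phi.

(* Homogeneous of degree d up to a term p log|x|, where p is a homogeneous
   polynomial of degree d and |x| a homogeneous norm: such a term satisfies
   (p log|x|) \o dil t = t ^ d * (p log|x| + ln t * p).  The homogeneous
   polynomials of degree d are the functions which are smooth on the whole of
   R^m and homogeneous of degree d; for d < 0 only p = 0 remains. *)
Definition log_homogeneous (R : realType) (m : nat) (G : homogeneousGroup R m)
    (mu : {measure set (borel R m) -> \bar R}) (d : int)
    (u : functional R m) : Prop :=
  exists p : 'rV[R]_m -> R[i],
    [/\ csmooth_on setT p,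
        forall (t : R) x, 0 < t -> p (dil G t x) = (t ^ d)%:C * p x
      & forall (t : R) phi, 0 < t -> test phi ->
          u (phi \o dil G t) = (t ^ (- (homdim G)%:Z - d))%:C *
            (u phi - (ln t)%:C * cintegral mu (fun x => p x * phi x))].

(** * Principal Heisenberg symbols of order zero *)

Definition symbol (R : realType) (m : nat) (G : homogeneousGroup R m)
    (mu : {measure set (borel R m) -> \bar R}) (f : functional R m) : Prop :=
  [/\ is_distribution f, regular mu f & homogeneous G (- (homdim G)%:Z) f].

(* <phi u, psi> = <u, phi psi> *)
Definition fmul (R : realType) (m : nat) (phi : 'rV[R]_m -> R[i])
    (u : functional R m) : functional R m :=
  fun psi => u (fun x => phi x * psi x).

(* Group convolution of compactly supported distributions; for functions and
   the Haar measure, (u * v)(x) is the integral of u(y) v(y^-1 x) dy. *)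
Definition conv (R : realType) (m : nat) (G : homogeneousGroup R m)
    (u v : functional R m) : functional R m :=
  fun phi => u (fun x => v (fun y => phi (hg_mul G x y))).

(* k - (k_ 0 + ... + k_ J.-1) is of class C^N near 0 for J large. *)
Definition expansion (R : realType) (m : nat)
    (mu : {measure set (borel R m) -> \bar R}) (k : functional R m)
    (k_ : nat -> functional R m) : Prop :=
  forall N : nat, exists J0 : nat, forall J : nat, (J0 <= J)%N ->
    exists (U : set 'rV[R]_m) (r : 'rV[R]_m -> R[i]),
      [/\ open U, U 0, cCk_on N U r
        & represents mu U (fun phi => k phi - \sum_(j < J) k_ j phi) r].

Definition principal_part (R : realType) (m : nat) (G : homogeneousGroup R m)
    (mu : {measure set (borel R m) -> \bar R}) (k h : functional R m) : Prop :=
  exists k_ : nat -> functional R m,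
    [/\ k_ 0%N = h,
        symbol G mu h,
        forall j, (0 < j)%N ->
          [/\ is_distribution (k_ j), regular mu (k_ j)
            & log_homogeneous G mu (- (homdim G)%:Z + j%:Z) (k_ j)]
      & expansion mu k k_].

Definition cutoff (R : realType) (m : nat) (phi : 'rV[R]_m -> R[i]) : Prop :=
  test phi /\ \forall x \near (0 : 'rV[R]_m), phi x = 1.

(* h is the product f * g of the symbols f and g.  On test functions, h does
   not depend on phi and is unique, since only the zero distribution is both
   homogeneous of degree - Q and a sum of terms of higher degree and of a
   continuous function near 0. *)
Definition is_symbol_mul (R : realType) (m : nat) (G : homogeneousGroup R m)
    (mu : {measure set (borel R m) -> \bar R}) (f g h : functional R m) :
    Prop :=
  exists phi, cutoff phi /\
    principal_part G mu (conv G (fmul phi f) (fmul phi g)) h.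

(* Main.v *)
From HB Require Import structures.
Require Import Defs.
From mathcomp Require Import all_boot all_order all_algebra.
From mathcomp Require Import complex.
From mathcomp Require Import all_classical all_reals all_analysis.
From mathcomp Require Import ring lra.
(* Makes iterD refer to the directional derivative again, not to the lemma of
   ssrnat. *)
Import Defs.

(** Central elements give traces for the following reason.  Near a point w != 0
    the convolution of two cut-off symbols phi f and phi g is a smooth function:
    splitting phi = (1 - chi) phi + chi phi with chi supported close to 0, at
    least one of the two factors may be replaced by a test function, and
      (phi f * phi g)(w) = f (x |-> phi x * b (- x * w))
                           + g (y |-> (chi phi) y * a (w * - y))
    where a and b are the smooth parts ((1 - chi) phi) f and ((1 - chi) phi) g.
    If w is central, then subtracting the same formula with f and g exchanged
    leaves  int a(x) b(- x w) dx - int b(y) a(- y w) dy, which vanishes by the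
    substitution x = w (- y), Haar measure being invariant under left
    translations and under inversion.  Changing the cutoff only adds a function
    which is smooth near 0.  Hence, on the orbit w = dil t z, the difference of
    the two convolutions stays bounded as t -> 0, whereas its expansion is
    t ^ (- Q) times (fg z - gf z + o(1)).

    The homogeneous dimension is not compared with the scaling of the Haar
    measure: it suffices that the measure of dil t (K) tends to 0 with t, which
    is dominated convergence.  Distributions acting on parameter integrals are
    handled without product measures, by Riemann sums. *)

Set Implicit Arguments.
Unset Strict Implicit.
Unset Printing Implicit Defensive.

Import Order.TTheory GRing.Theory Num.Theory.
Import numFieldNormedType.Exports.

Local Open Scope classical_set_scope.
Local Open Scope complex_scope.
Local Open Scope ring_scope.

(** * Differential calculus *)

Section Calculus.
Variable R : realType.
Implicit Types (V W : normedModType R) (n : nat).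

(** The obstacle is uniformity in w. The cutoff chi that separates the singularities must shrink as
    w approaches 0, so a, b and every smooth function built from them depend on w, and the formula
    for a single convolution gives no bound along the orbit. The commutator does: at a central w all
    contributions that depend on chi cancel exactly, and what remains is the value at w of one
    smooth function E, fixed by the symbols and the two original cutoffs. The cancellation holds at
    w only, since nearby points need not be central; hence the density Q found near w varies with w
    and is compared with E at that single point. Invariance under inversion needs unimodularity,
    which is deduced from the dilations: they are automorphisms that contract G to its identity.
    This and the effect of a dilation on integrals rest on the uniqueness of the left Haar integral,
    proved here for test functions. The definitions provide derivatives along directions only, so
    symmetry of second derivatives, the chain rule and differentiation under a distribution are
    established in that language. *)

Lemma iterD_rcons V W (vs : seq V) (v : V) (f : V -> W) :
  iterD (rcons vs v) f = iterD vs (fun x => 'D_v f x).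
Proof. by elim: vs => //= w vs ->. Qed.

Lemma Ck_on0 V W (U : set V) (f : V -> W) :
  Ck_on 0 U f <-> forall x, U x -> {for x, continuous f}.
Proof.
split=> [H x Ux|H vs]; first by have [] := H [::] isT x Ux.
by rewrite leqn0 size_eq0 => /eqP -> x Ux; split=> //; exact: H.
Qed.

(** The derivative split off is the innermost one, the first to be taken. With f generalized, a rule
    for first derivatives thus extends to every order by induction on n. *)
Lemma Ck_onS V W n (U : set V) (f : V -> W) :
  Ck_on n.+1 U f <->
  [/\ forall x, U x -> {for x, continuous f},
      forall x v, U x -> derivable f x v
    & forall v, Ck_on n U (fun x => 'D_v f x)].
Proof.
split=> [H|[H1 H2 H3] vs].
  split=> [x Ux|x v Ux|v vs svs x Ux].
  - by have [] := H [::] isT x Ux.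
  - by have [_] := H [::] isT x Ux; apply.
  - by have := H (rcons vs v); rewrite size_rcons iterD_rcons; apply.
case/lastP: vs => [_ x Ux|vs v]; last first.
  by rewrite size_rcons iterD_rcons; apply: H3.
by split; [exact: H1|move=> _ v; exact: H2].
Qed.

Lemma Ck_onW V W n k (U : set V) (f : V -> W) :
  (k <= n)%N -> Ck_on n U f -> Ck_on k U f.
Proof.
move=> kn H vs svs x Ux; have [|c d] := H vs _ x Ux; first exact: leq_trans kn.
by split=> // s; apply: d; exact: leq_trans s kn.
Qed.

Lemma Ck_on_sub V W n (U U' : set V) (f : V -> W) :
  U' `<=` U -> Ck_on n U f -> Ck_on n U' f.
Proof. by move=> UU H vs svs x Ux; apply: H => //; exact: UU. Qed.

Lemma near_eq_continuous (S T : topologicalType) (f g : S -> T) (x : S) :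
  (\forall y \near x, f y = g y) -> {for x, continuous f} ->
  {for x, continuous g}.
Proof.
move=> fg cf; suff : g @ x --> g x by [].
by rewrite -(nbhs_singleton fg); apply: cvg_trans cf; exact: near_eq_cvg.
Qed.

Lemma Ck_on_eq V W n (U : set V) (f g : V -> W) : open U ->
  (forall x, U x -> f x = g x) -> Ck_on n U f -> Ck_on n U g.
Proof.
move=> oU; elim: n f g => [|n IH] f g fg.
  move/Ck_on0 => cf; apply/Ck_on0 => x Ux.
  apply: near_eq_continuous (cf _ Ux).
  by near=> y; apply: fg; near: y; exact: open_nbhs_nbhs.
move=> /Ck_onS[c d D]; apply/Ck_onS; split => [x Ux|x v Ux|v].
- apply: near_eq_continuous (c _ Ux).
  by near=> y; apply: fg; near: y; exact: open_nbhs_nbhs.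
- apply: near_eq_derivable (d x v Ux); near=> y; apply: fg.
  by near: y; exact: open_nbhs_nbhs.
- apply: (IH (fun x => 'D_v f x)) => // x Ux; apply: near_eq_derive.
  by near=> y; apply: fg; near: y; exact: open_nbhs_nbhs.
Unshelve. all: by end_near. Qed.

Lemma Ck_on_cover V W n (U : set V) (f : V -> W) :
  (forall x, U x -> exists O, [/\ open O, O x & Ck_on n O f]) -> Ck_on n U f.
Proof.
by move=> H vs svs x Ux; have [N [NO Nx HN]] := H x Ux; apply: HN.
Qed.

Lemma Ck_on_cst V W n (U : set V) (c : W) : Ck_on n U (fun=> c).
Proof.
elim: n c => [|n IH] c; first by apply/Ck_on0 => x _; exact: cst_continuous.
apply/Ck_onS; split=> [x _|x v _|v]; first exact: cst_continuous.
  exact: derivable_cst.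
have -> : (fun x => 'D_v (fun _ : V => c) x) = fun=> 0.
  by apply/funext => x; rewrite derive_cst.
exact: IH.
Qed.

Lemma Ck_onD V W n (U : set V) (f g : V -> W) : open U ->
  Ck_on n U f -> Ck_on n U g -> Ck_on n U (fun x => f x + g x).
Proof.
move=> oU; elim: n f g => [|n IH] f g.
  move=> /Ck_on0 cf /Ck_on0 cg; apply/Ck_on0 => x Ux.
  by apply: cvgD; [exact: cf|exact: cg].
move=> /Ck_onS[cf df Df] /Ck_onS[cg dg Dg]; apply/Ck_onS.
split=> [x Ux|x v Ux|v].
- by apply: cvgD; [exact: cf|exact: cg].
- by apply: derivableD; [exact: df|exact: dg].
- apply: (Ck_on_eq (f := fun x => 'D_v f x + 'D_v g x)) => //; last exact: IH.
  by move=> x Ux; rewrite -deriveD//; [exact: df|exact: dg].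
Qed.

Lemma Ck_onZ V W n (U : set V) (c : R) (f : V -> W) : open U ->
  Ck_on n U f -> Ck_on n U (fun x => c *: f x).
Proof.
move=> oU; elim: n f => [|n IH] f.
  move=> /Ck_on0 cf; apply/Ck_on0 => x Ux.
  by apply: cvgZr; exact: cf.
move=> /Ck_onS[cf df Df]; apply/Ck_onS.
split=> [x Ux|x v Ux|v].
- by apply: cvgZr; exact: cf.
- by apply: derivableZ; exact: df.
- apply: (Ck_on_eq (f := fun x => c *: 'D_v f x)) => //; last exact: IH.
  by move=> x Ux; rewrite -deriveZ//; exact: df.
Qed.

Lemma Ck_onM V n (U : set V) (f g : V -> R) : open U ->
  Ck_on n U f -> Ck_on n U g -> Ck_on n U (fun x => f x * g x).
Proof.
move=> oU; elim: n f g => [|n IH] f g.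
  move=> /Ck_on0 cf /Ck_on0 cg; apply/Ck_on0 => x Ux.
  by apply: cvgM; [exact: cf|exact: cg].
move=> Hf Hg; have /Ck_onS[cf df Df] := Hf; have /Ck_onS[cg dg Dg] := Hg.
apply/Ck_onS; split=> [x Ux|x v Ux|v].
- by apply: cvgM; [exact: cf|exact: cg].
- by apply: derivableM; [exact: df|exact: dg].
- apply: (Ck_on_eq (f := fun x => f x * 'D_v g x + g x * 'D_v f x)) => //.
    by move=> x Ux; rewrite -deriveM//; [exact: df|exact: dg].
  by apply: Ck_onD => //; apply: IH => //; apply: (Ck_onW (leqnSn n)).
Qed.

Lemma Ck_on_linear V W (L : {linear V -> W}) n (U : set V) :
  continuous L -> Ck_on n U L.
Proof.
move=> cL; have dL x v : is_derive x v L (L v).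
  have dL := @linear_differentiable _ _ _ L x cL.
  split; first exact: diff_derivable.
  by rewrite deriveE// diff_lin.
case: n => [|n]; first by apply/Ck_on0 => x _; exact: cL.
apply/Ck_onS; split=> [x _|x v _|v]; first exact: cL.
  by have [] := dL x v.
have -> : (fun x => 'D_v L x) = fun=> L v.
  by apply/funext => x; have [] := dL x v.
exact: Ck_on_cst.
Qed.

(** Along the line through x the two difference quotients are the same function of h, so an affine
    change of variables needs no chain rule. Sections of a product, swaps and coordinate functions
    are handled this way. *)
Lemma growth_affine V W (Z : normedModType R) (A : V -> W) (f : W -> Z)
    (x v : V) (w : W) : (forall h, A (h *: v + x) = h *: w + A x) ->
  (fun h => h^-1 *: (((f \o A) \o shift x) (h *: v) - (f \o A) x)) =
  (fun h => h^-1 *: ((f \o shift (A x)) (h *: w) - f (A x))).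
Proof. by move=> AE; apply/funext => h /=; rewrite AE. Qed.

Lemma derivable_affine V W (Z : normedModType R) (A : V -> W) (f : W -> Z)
    (x v : V) (w : W) : (forall h, A (h *: v + x) = h *: w + A x) ->
  derivable (f \o A) x v <-> derivable f (A x) w.
Proof. by move=> AE; rewrite /derivable (growth_affine _ AE). Qed.

Lemma derive_affine V W (Z : normedModType R) (A : V -> W) (f : W -> Z)
    (x v : V) (w : W) : (forall h, A (h *: v + x) = h *: w + A x) ->
  'D_v (f \o A) x = 'D_w f (A x).
Proof. by move=> AE; rewrite /derive (growth_affine _ AE). Qed.

Lemma Ck_on_affine V W (Z : normedModType R) (A : V -> W) (L : V -> W) n
    (U : set W) (f : W -> Z) :
  (forall x h v, A (h *: v + x) = h *: L v + A x) -> continuous A ->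
  Ck_on n U f -> Ck_on n (A @^-1` U) (f \o A).
Proof.
move=> AL cA; elim: n f => [|n IH] f.
  move=> /Ck_on0 cf; apply/Ck_on0 => x Ux.
  by apply: continuous_comp; [exact: cA|exact: cf].
move=> /Ck_onS[cf df Df]; apply/Ck_onS; split=> [x Ux|x v Ux|v].
- by apply: continuous_comp; [exact: cA|exact: cf].
- by apply/(derivable_affine f (fun h => AL x h v)); exact: df.
- have -> : (fun x => 'D_v (f \o A) x) = (fun y => 'D_(L v) f y) \o A.
    by apply/funext => x; rewrite (derive_affine f (fun h => AL x h v)).
  exact: IH.
Qed.

Lemma iterD_affine V W (Z : normedModType R) (A L : V -> W) (vs : seq V)
    (f : W -> Z) :
  (forall x h v, A (h *: v + x) = h *: L v + A x) ->
  iterD vs (f \o A) = iterD (map L vs) f \o A.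
Proof.
move=> AL; elim: vs => //= v vs ->; apply/funext => x.
by rewrite (derive_affine _ (fun h => AL x h v)).
Qed.

Lemma Ck_on_linear_comp V W (Z : normedModType R) (L : {linear W -> Z}) n
    (U : set V) (G : V -> W) : open U -> continuous L ->
  Ck_on n U G -> Ck_on n U (L \o G).
Proof.
move=> oU cL; elim: n G => [|n IH] G.
  move=> /Ck_on0 cf; apply/Ck_on0 => x Ux.
  by apply: continuous_comp; [exact: cf|exact: cL].
have dL x v : derivable G x v -> is_derive x v (L \o G) (L ('D_v G x)).
  move=> dG; suff H : (fun h => h^-1 *: (((L \o G) \o shift x) (h *: v) -
      (L \o G) x)) @ 0^' --> L ('D_v G x).
    by split; [apply/cvg_ex; eexists; exact: H|exact: cvg_lim H].
  rewrite (_ : (fun h => _) =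
    L \o (fun h => h^-1 *: ((G \o shift x) (h *: v) - G x))).
    by apply: continuous_cvg; [exact: cL|exact: dG].
  apply/funext => h /=.
  by rewrite linearZZ (linearB L).
move=> /Ck_onS[cf df Df]; apply/Ck_onS; split=> [x Ux|x v Ux|v].
- by apply: continuous_comp; [exact: cf|exact: cL].
- by have [] := dL x v (df x v Ux).
- apply: (Ck_on_eq (f := L \o (fun x => 'D_v G x))) => //; last exact: IH.
  by move=> x Ux /=; have [] := dL x v (df x v Ux).
Qed.

Lemma Ck_on_sum V W (I : Type) (r : seq I) n (U : set V) (F : I -> V -> W) :
  open U -> (forall i, Ck_on n U (F i)) ->
  Ck_on n U (fun x => \sum_(i <- r) F i x).
Proof.
move=> oU HF; elim: r => [|i r IH].
  rewrite (_ : (fun x => _) = fun=> 0); first exact: Ck_on_cst.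
  by apply/funext => x; rewrite big_nil.
rewrite (_ : (fun x => _) = fun x => F i x + \sum_(i <- r) F i x).
  exact: Ck_onD.
by apply/funext => x; rewrite big_cons.
Qed.

End Calculus.

(** * Mean values, symmetry of second derivatives and the chain rule *)

Section MeanValue.
Variable R : realType.
Implicit Types (V W : normedModType R) (n : nat).

Lemma continuous_dist V W (f : V -> W) (x : V) (e : R) :
  {for x, continuous f} -> 0 < e ->
  exists2 d : R, 0 < d & forall y, `|y - x| < d -> `|f y - f x| <= e.
Proof.
move=> cf e0.
have := cf; rewrite /continuous_at => /cvgrPdist_le/(_ e e0).
move=> /nbhs_ballP[d /= d0 H]; exists d => // y yx.
by rewrite distrC; apply: H; rewrite -ball_normE /= distrC.
Qed.

Lemma ler_dist_half (a b c e : R) :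
  `|a - b| <= e / 2 -> `|b - c| <= e / 2 -> `|a - c| <= e.
Proof. by move=> ab bc; have := ler_distD b a c; lra. Qed.

Lemma MVT_dir V (f : V -> R) (p v : V) (s : R) :
  (forall y, derivable f y v) ->
  exists2 c, `|c| <= `|s| &
    f (s *: v + p) - f p = s * 'D_v f (c *: v + p).
Proof.
move=> df; pose A (h : R) : V := h *: v + p.
have AE (t h : R) : A (h *: 1 + t) = h *: v + A t.
  by rewrite /A scalerDl addrA -scalerA scale1r.
have dg (t : R) : is_derive t 1 (f \o A) ('D_v f (A t)).
  split; first by apply/(derivable_affine f (AE t)).
  exact: (derive_affine f (AE t)).
have cg : continuous (f \o A).
  move=> t; apply: differentiable_continuous; apply/derivable1_diffP.
  by have [] := dg t.
have A0 : A 0 = p by rewrite /A scale0r add0r.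
have [s0|s0] := leP 0 s.
  have [|c] := MVT_segment s0 (fun x _ => dg x).
    exact: continuous_subspaceT.
  rewrite in_itv /= => /andP[c0 cs]; rewrite /= A0 subr0 mulrC => E.
  by exists c => //; rewrite !ger0_norm.
have [|c] := MVT_segment (ltW s0) (fun x _ => dg x).
  exact: continuous_subspaceT.
rewrite in_itv /= => /andP[c0 cs]; rewrite /= A0 sub0r mulrC => E.
exists c; first by rewrite !ler0_norm ?lerN2 // ltW.
by rewrite -opprB E mulNr opprK.
Qed.

(** Clairaut's theorem. The second difference of f over the parallelogram spanned by s u and s v is,
    by two uses of the mean value theorem, s ^+ 2 times a mixed derivative at a nearby point, in
    either order; continuity of both mixed derivatives at x concludes for s small. *)
Lemma derive_comm V (f : V -> R) (u v x : V) : Ck_on 2 setT f ->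
  'D_u (fun y => 'D_v f y) x = 'D_v (fun y => 'D_u f y) x.
Proof.
move=> /Ck_onS[_ df Df].
have main a b (s : R) : exists2 y, `|y - x| <= `|s| * (`|a| + `|b|) &
    f (s *: b + (s *: a + x)) - f (s *: a + x) - (f (s *: b + x) - f x) =
    s * (s * 'D_b (fun y => 'D_a f y) y).
  pose phi y := f (s *: b + y) - f y.
  have AE y h w : s *: b + (h *: w + y) = h *: w + (s *: b + y).
    by rewrite addrCA.
  have d1 y : is_derive y a phi ('D_a f (s *: b + y) - 'D_a f y).
    apply: is_deriveB; last exact/derivableP/df.
    have AE' h : s *: b + (h *: a + y) = h *: a + (s *: b + y) by exact: AE.
    split; first by apply/(derivable_affine (A := fun y => s *: b + y) f AE')/df.
    exact: (derive_affine (A := fun y => s *: b + y) f AE').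
  have [|c cs E] := @MVT_dir _ phi x a s; first by move=> y; have [] := d1 y.
  have /Ck_onS[_ d2 _] := Df a.
  have [|c' cs' E'] := @MVT_dir _ (fun y => 'D_a f y) (c *: a + x) b s.
    by move=> y; exact: d2.
  exists (c' *: b + (c *: a + x)).
    rewrite addrA addrK (le_trans (ler_normD _ _))// !normrZ.
    by rewrite mulrDr addrC lerD// ler_wpM2r.
  have d1v y : 'D_a phi y = 'D_a f (s *: b + y) - 'D_a f y by have [] := d1 y.
  by rewrite -E' -d1v; exact: E.
have cont a b : {for x, continuous (fun y => 'D_b (fun y => 'D_a f y) y)}.
  by have /Ck_onS[_ _ /(_ b)/Ck_on0] := Df a; apply.
apply/eqP; rewrite -subr_eq0 -normr_le0; apply/ler_addgt0Pl => e e0.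
rewrite addr0.
have e20 : 0 < (e : R) / 2 by rewrite divr_gt0.
have [r1 r10 H1] := continuous_dist (cont v u) e20.
have [r2 r20 H2] := continuous_dist (cont u v) e20.
pose r := Num.min r1 r2; have r0 : 0 < r by rewrite lt_min r10.
have N0 : 0 < `|u| + `|v| + 1 by rewrite ltr_wpDl// addr_ge0.
(* This s keeps both intermediate points within r of x; the added 1 covers u = v = 0. *)
have [s s0 sE] : exists2 s : R, 0 < s & s * (`|u| + `|v| + 1) = r / 2.
  exists (r / 2 / (`|u| + `|v| + 1)); first by rewrite !divr_gt0.
  by rewrite divfK// gt_eqF.
have sr : `|s| * (`|u| + `|v|) < r.
  rewrite gtr0_norm// (@le_lt_trans _ _ (r / 2))//; last by lra.
  by rewrite -sE ler_wpM2l ?ltW// ltrDl.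
have [y1 y1s E1] := main u v s; have [y2 y2s E2] := main v u s.
clear main cont.
have AC : s *: u + (s *: v + x) = s *: v + (s *: u + x) by rewrite addrCA.
have E : 'D_v (fun y => 'D_u f y) y1 = 'D_u (fun y => 'D_v f y) y2.
  apply: (mulfI (lt0r_neq0 s0)); apply: (mulfI (lt0r_neq0 s0)).
  rewrite AC in E2; apply: (etrans (esym E1)); apply: etrans E2.
  have alg (a b c d : R) : a - b - (c - d) = a - c - (b - d) by ring.
  exact: alg.
have y2r : `|y2 - x| < r1.
  apply: le_lt_trans y2s _; rewrite addrC; apply: lt_le_trans sr _.
  by rewrite ge_min lexx.
have y1r : `|y1 - x| < r2.
  apply: le_lt_trans y1s _; apply: lt_le_trans sr _.
  by rewrite ge_min lexx orbT.
apply: ler_dist_half (H2 _ y1r); rewrite E distrC; exact: H1 _ y2r.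
Qed.

(** What the chain rule takes from finite dimension: a vector is rebuilt from finitely many
    continuous linear coordinates. Later sections, the one on Haar measure included, can then stay
    on abstract normed spaces. *)
Definition findim V := exists (k : nat) (e : 'I_k -> V)
  (c : 'I_k -> {linear V -> R}), (forall i, continuous (c i : V -> R)) /\
    forall h : V, h = \sum_i c i h *: e i.

(** Continuous partial derivatives give a first-order expansion: y is moved along one direction at a
    time and the mean value theorem is applied on each segment. The error is measured by the
    coefficients a i, so that it can later be divided by a step h. *)
Lemma sum_increment V (I : Type) (e : I -> V) (f : V -> R) (y : V) (r : seq I)
    (eps : R) : 0 < eps ->
  (forall z i, derivable f z (e i)) ->
  (forall i, {for y, continuous (fun z => 'D_(e i) f z)}) ->
  exists2 d : R, 0 < d & forall a : I -> R, (forall i, `|a i| <= d) ->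
    `|f (\sum_(i <- r) a i *: e i + y) - f y -
      \sum_(i <- r) a i * 'D_(e i) f y| <= eps * \sum_(i <- r) `|a i|.
Proof.
move=> eps0 df cf; elim: r => [|i r [d d0 IH]].
  exists 1 => // a _; rewrite !big_nil add0r !subrr normr0 mulr0//.
have [q q0 H] := continuous_dist (cf i) eps0.
pose S := `|e i| + \sum_(j <- r) `|e j|.
have S0 : 0 <= S by rewrite addr_ge0// sumr_ge0.
(* With coefficients of this size the intermediate point of the mean value theorem stays within q of
   y: the displacement is at most q / 2 / (S + 1) times S. *)
exists (Num.min d (q / 2 / (S + 1))) => [|a ale].
  by rewrite lt_min d0/= !divr_gt0// ltr_wpDl.
have ad j : `|a j| <= d by have := ale j; rewrite le_min => /andP[].
have aq j : `|a j| <= q / 2 / (S + 1).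
  by have := ale j; rewrite le_min => /andP[].
rewrite !big_cons; set t := \sum_(j <- r) a j *: e j.
rewrite -(addrA (a i *: e i)).
have [c cs E] := MVT_dir (t + y) (a i) (fun z => df z i).
have := IH a ad; rewrite -/t.
have D1 : `|'D_(e i) f (c *: e i + (t + y)) - 'D_(e i) f y| <= eps.
  apply: H; rewrite addrA addrK (le_lt_trans (ler_normD _ _))//.
  have ae j : `|a j *: e j| <= q / 2 / (S + 1) * `|e j|.
    by rewrite normrZ ler_wpM2r.
  have tS : `|t| <= q / 2 / (S + 1) * \sum_(j <- r) `|e j|.
    by rewrite mulr_sumr (le_trans (ler_norm_sum _ _ _))// ler_sum.
  have cS : `|c *: e i| <= q / 2 / (S + 1) * `|e i|.
    by rewrite normrZ ler_wpM2r// (le_trans cs).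
  have qS : q / 2 / (S + 1) * (S + 1) = q / 2 by rewrite divfK// gt_eqF// ltr_wpDl.
  have q0' : 0 <= q / 2 / (S + 1).
    apply: divr_ge0; last exact: addr_ge0.
    by apply: divr_ge0 => //; exact: ltW.
  rewrite (le_lt_trans (lerD cS tS))// -mulrDr -/S.
  by have := ltW q0; nra.
move: E D1; set D := derive _ _ _; set D' := derive _ _ _.
move: (f _) (f _) (f _) (\sum_(j <- r) a j * _) (\sum_(j <- r) `|a j|).
move=> F1 F2 F3 S1 S2 E D1 IHa.
have {E} -> : F3 - F1 - (a i * D' + S1) = a i * (D - D') + (F2 - F1 - S1).
  by rewrite mulrBr -E; ring.
rewrite [eps * _]mulrDr (le_trans (ler_normD _ _))// lerD//.
by rewrite normrM mulrC ler_wpM2r.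
Qed.

Lemma cvg_sumr (T I : Type) (F : set_system T) (r : seq I) (f : I -> T -> R)
    (a : I -> R) : Filter F ->
  (forall i, f i x @[x --> F] --> a i) ->
  \sum_(i <- r) f i x @[x --> F] --> \sum_(i <- r) a i.
Proof.
move=> FF H; apply: cvg_big => //.
exact: add_continuous.
Qed.

(** The increment of G enters [sum_increment] through its coordinates. After division by h the error
    is at most eps / 2 / B times the sum of the absolute values of the coordinates of the difference
    quotient, and this sum is at most B near 0 because the quotient converges. *)
Lemma derive_comp_coords (U V : normedModType R) (k : nat) (e : 'I_k -> V)
    (c : 'I_k -> {linear V -> R}) (f : V -> R) (G : U -> V) (x v : U) :
  (forall i, continuous (c i : V -> R)) ->
  (forall h : V, h = \sum_i c i h *: e i) ->
  Ck_on 1 setT f -> derivable G x v ->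
  is_derive x v (f \o G) (\sum_i c i ('D_v G x) * 'D_(e i) f (G x)).
Proof.
move=> cc ce /Ck_onS[_ df Df] dG.
set l := \sum_i _.
suff H : (fun h => h^-1 *: (((f \o G) \o shift x) (h *: v) - (f \o G) x)) @ 0^'
    --> l.
  by split; [apply/cvg_ex; exists l|exact: cvg_lim H].
pose dq h : V := h^-1 *: ((G \o shift x) (h *: v) - G x).
have dqc i : (fun h => c i (dq h)) @ 0^' --> c i ('D_v G x).
  by apply: continuous_cvg; [exact: cc|exact: dG].
have Gc : {for 0, continuous (fun h : R => G (h *: v + x))}.
  apply: differentiable_continuous; apply/derivable1_diffP.
  exact: (derivable1P _ _ _).1 dG.
have Gc' i : (fun h : R => c i (G (h *: v + x) - G x)) @ 0^' --> (0 : R).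
  suff : (fun h : R => c i (G (h *: v + x) - G x)) @ 0^' --> c i (G x - G x).
    by rewrite subrr linear0.
  apply: continuous_cvg; first exact: cc.
  apply: cvgB; last exact: cvg_cst.
  have := (continuous_withinNx _ _).1 Gc.
  by rewrite (_ : G (0 *: v + x) = G x)// scale0r add0r.
pose B : R := \sum_i `|c i ('D_v G x)| + 1.
have B0 : 0 < B by rewrite ltr_wpDl// sumr_ge0.
apply/cvgrPdist_le => /= eps eps0.
have e1 : 0 < eps / 2 / B by rewrite !divr_gt0.
have cD i : {for G x, continuous (fun z => 'D_(e i) f z)}.
  by have /Ck_on0 := Df (e i); apply.
have [d d0 Hd] := sum_increment (index_enum 'I_k) e1
   (fun z i => df z (e i) I) cD.
have Sc : (fun h => \sum_i c i (dq h) * 'D_(e i) f (G x)) @ 0^' --> l.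
  by apply: cvg_sumr => i; apply: cvgMl; exact: dqc.
have Tc : (fun h => \sum_i `|c i (dq h)|) @ 0^' --> \sum_i `|c i ('D_v G x)|.
  by apply: cvg_sumr => i; apply: cvg_norm; exact: dqc.
have F1 : \forall h \near (0 : R)^', forall i, `|c i (G (h *: v + x) - G x)| <= d.
  apply: filter_forall => i.
  apply: filterS ((cvgrPdist_le _ _).1 (Gc' i) d d0) => h.
  by rewrite sub0r normrN.
have F2 : \forall h \near (0 : R)^', \sum_i `|c i (dq h)| <= B.
  apply: filterS ((cvgrPdist_le _ _).1 Tc 1 ltr01) => h.
  rewrite /B distrC; move: (\sum_i _) (\sum_i _) => a b; have := ler_norm (b - a).
  lra.
have e2 : 0 < eps / 2 by rewrite divr_gt0.
apply: filterS3 F1 F2 ((cvgrPdist_le _ _).1 Sc _ e2) => h F1 F2 F3; apply: ler_dist_half F3 _.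
have := Hd _ F1; rewrite -ce subrK.
have EE i : c i (dq h) = h^-1 * c i (G (h *: v + x) - G x).
  by rewrite /dq linearZZ.
have -> : \sum_i c i (dq h) * 'D_(e i) f (G x) =
    h^-1 * \sum_i c i (G (h *: v + x) - G x) * 'D_(e i) f (G x).
  by rewrite mulr_sumr; apply: eq_bigr => i _; rewrite EE mulrA.
have : \sum_i `|c i (dq h)| = `|h^-1| * \sum_i `|c i (G (h *: v + x) - G x)|.
  by rewrite mulr_sumr; apply: eq_bigr => i _; rewrite EE normrM.
move: F2 => /= {F1 Hd EE}; move: (f (G x)) (\sum_i _ * _) => Fx S1.
move: (\sum_i `|c i (dq h)|) (\sum_i _) => T S2 TB TE H1.
have -> : h^-1 * S1 - h^-1 *: (f (G (h *: v + x)) - Fx) =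
  - (h^-1 * (f (G (h *: v + x)) - Fx - S1)) by rewrite -[_ *: _]/(_ * _); ring.
rewrite normrN normrM (le_trans (ler_wpM2l (normr_ge0 _) H1))//.
rewrite mulrCA -TE (le_trans (ler_wpM2l (ltW e1) TB))// divfK// gt_eqF//.

Qed.

Lemma Ck_on_comp (U V : normedModType R) n (S : set U) (f : V -> R)
    (G : U -> V) : findim V -> open S -> smooth_on setT f ->
  Ck_on n S G -> Ck_on n S (f \o G).
Proof.
move=> [k [e [c [cc ce]]]] oS; elim: n f => [|n IH] f sf.
  move=> /Ck_on0 cG; apply/Ck_on0 => x Sx.
  apply: continuous_comp; first exact: cG.
  by have /Ck_on0 := sf 0; apply.
move=> HG; have /Ck_onS[cG dG DG] := HG; apply/Ck_onS.
have D x v : S x ->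
    is_derive x v (f \o G) (\sum_i c i ('D_v G x) * 'D_(e i) f (G x)).
  by move=> Sx; apply: derive_comp_coords => //; exact: dG.
split=> [x Sx|x v Sx|v].
- apply: continuous_comp; first exact: cG.
  by have /Ck_on0 := sf 0; apply.
- by have [] := D x v Sx.
- apply: (Ck_on_eq (f := fun x => \sum_i c i ('D_v G x) * 'D_(e i) f (G x)))=>//.
    by move=> x Sx; have [] := D x v Sx.
  apply: Ck_on_sum => // i; apply: Ck_onM => //.
    exact: (Ck_on_linear_comp (L := c i)).
  apply: (IH (fun x => 'D_(e i) f x)) => [j|]; last exact: Ck_onW HG.
  by have /Ck_onS[_ _] := sf j.+1; apply.
Qed.

Lemma findim_rV k : findim 'rV[R]_k.
Proof.
have H (i : 'I_k) : exists c : {linear 'rV[R]_k -> R}, forall v, c v = v 0 i.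
  have @f : {linear 'rV[R]_k -> R}.
    by exists (fun N : 'rV[R]_k => N 0 i); do 2![eexists]; do ?[constructor];
     rewrite ?mxE// => ? *; rewrite ?mxE//; move=> ?; rewrite !mxE.
  by exists f.
have [c cE] := choice H.
exists k, (fun i => delta_mx 0 i), c; split=> [i|h].
  by rewrite (_ : (c i : _ -> _) = fun v : 'rV[R]_k => v 0 i);
    [exact: coord_continuous|apply/funext => v; exact: cE].
by rewrite {1}[h]row_sum_delta; apply: eq_bigr => i _; rewrite cE.
Qed.

End MeanValue.

(** * Calculus of smooth functions *)

Section SmoothFacts.
Variable R : realType.
Implicit Types (V W : normedModType R).

Lemma smooth_continuous V W (f : V -> W) : smooth_on setT f -> continuous f.
Proof. by move=> sf x; have /Ck_on0 := sf 0%N; apply. Qed.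

Lemma smooth_derivable V W (f : V -> W) x v :
  smooth_on setT f -> derivable f x v.
Proof. by move=> sf; have /Ck_onS[_ d _] := sf 1%N; exact: d. Qed.

Lemma smooth_derive V W (f : V -> W) v :
  smooth_on setT f -> smooth_on setT (fun x => 'D_v f x).
Proof. by move=> sf n; have /Ck_onS[_ _] := sf n.+1; apply. Qed.

Lemma smooth_iterD V W (f : V -> W) vs :
  smooth_on setT f -> smooth_on setT (iterD vs f).
Proof.
elim/last_ind: vs f => // vs v IH f sf; rewrite iterD_rcons.
exact/IH/smooth_derive.
Qed.

Lemma smoothD V W (f g : V -> W) : smooth_on setT f -> smooth_on setT g ->
  smooth_on setT (fun x => f x + g x).
Proof. by move=> sf sg n; apply: Ck_onD => //; exact: openT. Qed.

Lemma smoothZ V W (c : R) (f : V -> W) : smooth_on setT f ->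
  smooth_on setT (fun x => c *: f x).
Proof. by move=> sf n; apply: Ck_onZ => //; exact: openT. Qed.

Lemma smoothM V (f g : V -> R) : smooth_on setT f -> smooth_on setT g ->
  smooth_on setT (fun x => f x * g x).
Proof. by move=> sf sg n; apply: Ck_onM => //; exact: openT. Qed.

Lemma smooth_cst V W (c : W) : smooth_on setT (fun _ : V => c).
Proof. by move=> n; exact: Ck_on_cst. Qed.

Lemma smooth_comp V W (f : W -> R) (G : V -> W) : findim W ->
  smooth_on setT f -> smooth_on setT G -> smooth_on setT (f \o G).
Proof. by move=> fW sf sG n; apply: Ck_on_comp => //; exact: openT. Qed.

Lemma smooth_affine V W (Z : normedModType R) (A L : V -> W) (f : W -> Z) :
  (forall x h v, A (h *: v + x) = h *: L v + A x) -> continuous A ->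
  smooth_on setT f -> smooth_on setT (f \o A).
Proof.
move=> AL cA sf n.
by rewrite -[setT](preimage_setT A); exact: Ck_on_affine AL cA (sf n).
Qed.

Lemma iterD_lin V W (c : R) (f g : V -> W) vs :
  smooth_on setT f -> smooth_on setT g ->
  iterD vs (fun x => c *: f x + g x) = fun x => c *: iterD vs f x + iterD vs g x.
Proof.
elim/last_ind: vs f g => // vs v IH f g sf sg; rewrite !iterD_rcons.
rewrite -(IH (fun x => 'D_v f x) (fun x => 'D_v g x)); last 2 first.
- exact: smooth_derive.
- exact: smooth_derive.
congr (iterD vs _); apply/funext => x.
have df := @smooth_derivable _ _ f x v sf.
have dg := @smooth_derivable _ _ g x v sg.
rewrite -(deriveZ c df) -(deriveD _ dg)//; exact: derivableZ.
Qed.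

Lemma iterD_comm V (f : V -> R) (vs : seq V) (v : V) : smooth_on setT f ->
  iterD vs (fun x => 'D_v f x) = fun x => 'D_v (iterD vs f) x.
Proof.
move=> sf; elim: vs => //= w vs ->; apply/funext => x.
exact/derive_comm/smooth_iterD.
Qed.

Lemma derive_eq0 V W (f : V -> W) (x v : V) : (forall h : R, f (h *: v + x) = 0) ->
  'D_v f x = 0.
Proof.
move=> f0; rewrite /derive (_ : (fun h => _) = fun=> 0).
  exact: lim_cst.
apply/funext => h /=; rewrite f0 -[X in f X]add0r -(scale0r v) f0.
by rewrite subr0 scaler0.
Qed.

End SmoothFacts.

(** * Distributions depending on a parameter *)

Section Param.
Variables (R : realType) (U V : normedModType R) (I : finType) (e : I -> V).
Implicit Types (Phi : U * V -> R) (K : set V).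

Definition vdir (v : V) : U * V := (0, v).
Definition hdir (v : U) : U * V := (v, 0).

Lemma vsec_affine (x : U) : forall y h v,
  (fun y : V => (x, y)) (h *: v + y) = h *: vdir v + (x, y).
Proof.
by move=> y h v; apply: injective_projections; rewrite //= scaler0 add0r.
Qed.

Lemma smooth_vsec Phi (x : U) :
  smooth_on setT Phi -> smooth_on setT (fun y => Phi (x, y)).
Proof.
move=> sP; apply: (smooth_affine (A := fun y : V => (x, y)) (vsec_affine x)) => //.
by move=> y; apply: cvg_pair => //; exact: cvg_cst.
Qed.

Lemma iterD_vsec Phi (x : U) vs :
  iterD vs (fun y => Phi (x, y)) = fun y => iterD (map vdir vs) Phi (x, y).
Proof. exact: (iterD_affine (A := fun y : V => (x, y)) vs Phi (vsec_affine x)). Qed.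

(** One K serves all parameters, so that a single seminorm estimate of a distribution controls all
    the sections. *)
Definition fiber_in K Phi := forall x y, ~ K y -> Phi (x, y) = 0.

(** A vertical derivative looks at neighbouring points of the fibre; closedness of K keeps these
    outside K. *)
Lemma fiber_in_vdir K Phi v : closed K -> fiber_in K Phi ->
  fiber_in K (fun p => 'D_(vdir v) Phi p).
Proof.
move=> cK PK x y Ky.
have E := @derive_affine R V (U * V)%type R (fun y => (x, y)) Phi y v (vdir v)
  (fun h => vsec_affine x y h v).
rewrite -E (near_eq_derive (g := fun=> 0)); first exact: derive_cst.
have oK : open (~` K) by exact: closed_openC.
near=> z; apply: PK; near: z; exact: open_nbhs_nbhs.
Unshelve. all: by end_near. Qed.

Lemma fiber_in_hdir K Phi v : fiber_in K Phi ->
  fiber_in K (fun p => 'D_(hdir v) Phi p).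
Proof.
move=> PK x y Ky; apply: derive_eq0 => h.
have -> : h *: hdir v + (x, y) = (h *: v + x, y).
  by apply: injective_projections; rewrite //= scaler0 add0r.
exact: PK.
Qed.

(** Continuity at each (x0, y) is made uniform in y by covering the compact set K. *)
Lemma compact_section_close K Phi (x0 : U) (d : R) : compact K ->
  continuous Phi -> 0 < d ->
  \forall x \near x0, forall y, K y -> `|Phi (x, y) - Phi (x0, y)| <= d.
Proof.
move=> /compact_near_coveringP cK cP d0.
apply: cK => y Ky.
have d2 : 0 < d / 2 by rewrite divr_gt0.
have [r r0 H] := continuous_dist (cP (x0, y)) d2.
have xd : \forall x \near x0, `|x - x0| < r.
  by apply: filterS (nbhsx_ballx x0 _ r0) => x; rewrite -ball_normE /= distrC.
have yd : \forall y' \near y, `|y' - y| < r.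
  by apply: filterS (nbhsx_ballx y _ r0) => x; rewrite -ball_normE /= distrC.
have Hd x y' : `|x - x0| < r -> `|y' - y| < r ->
    `|Phi (x, y') - Phi (x0, y)| <= d / 2.
  move=> dx dy; apply: H; rewrite prod_normE /=.
  by rewrite gt_max dx dy.
exists ([set y' | `|y' - y| < r], [set x | `|x - x0| < r]); first by split.
move=> [y' x] [/= dy dx]; apply: ler_dist_half (Hd _ _ dx dy) _.
by rewrite distrC; apply: Hd => //; rewrite subrr normr0.
Qed.

(** Induction on n: the innermost derivative of a section is a section of the vertical derivative of
    Phi, which is again smooth with fibres in K, and there are only finitely many directions [e i]
    to treat at once. *)
Lemma section_close K Phi n (x0 : U) (d : R) : compact K -> smooth_on setT Phi ->
  fiber_in K Phi -> 0 < d ->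
  \forall x \near x0, forall (s : seq I) y, (size s <= n)%N ->
    `|iterD (map e s) (fun y => Phi (x, y)) y -
      iterD (map e s) (fun y => Phi (x0, y)) y| <= d.
Proof.
move=> cK sP PK d0; elim: n Phi sP PK => [|n IH] Phi sP PK.
  have := compact_section_close x0 cK (smooth_continuous sP) d0.
  apply: filterS => x H s y; rewrite leqn0 size_eq0 => /eqP ->.
  rewrite /=; have [Ky|Ky] := pselect (K y); first exact: H.
  by rewrite !PK// subrr normr0 ltW.
have kK : closed K by apply: compact_closed => //; exact: norm_hausdorff.
have H0 := compact_section_close x0 cK (smooth_continuous sP) d0.
have H1 : \forall x \near x0, forall i : I, forall (s : seq I) y,
   (size s <= n)%N ->
   `|iterD (map e s) (fun y => 'D_(vdir (e i)) Phi (x, y)) y -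
     iterD (map e s) (fun y => 'D_(vdir (e i)) Phi (x0, y)) y| <= d.
  apply: filter_forall => i.
  apply: (IH (fun p => 'D_(vdir (e i)) Phi p)); first exact: smooth_derive.
  exact: fiber_in_vdir.
apply: filterS2 H0 H1 => x H0 H1 s y.
case/lastP: s => [_|s i].
  rewrite /=; have [Ky|Ky] := pselect (K y); first exact: H0.
  by rewrite !PK// subrr normr0 ltW.
rewrite size_rcons ltnS => sn; have := H1 i s y sn.
by rewrite !(iterD_vsec (fun p => 'D_(vdir (e i)) Phi p)) map_rcons
  !(iterD_vsec Phi) map_rcons !iterD_rcons.
Qed.

(* Real-valued counterparts of [test] and [is_distribution], for derivatives
   along a finite family e of directions of an abstract space. *)
Definition rtest (a : V -> R) := smooth_on setT a /\
  exists2 K : set V, compact K & forall x, ~ K x -> a x = 0.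

Definition rdist (v : (V -> R) -> R) :=
  (forall (c : R) a b, rtest a -> rtest b ->
     v (fun x => c * a x + b x) = c * v a + v b) /\
  (forall K : set V, compact K -> exists (n : nat) (M : R), 0 <= M /\
     forall a (B : R), rtest a -> (forall x, ~ K x -> a x = 0) ->
       (forall (s : seq I) x, (size s <= n)%N -> `|iterD (map e s) a x| <= B) ->
       `|v a| <= M * B).

Lemma rtest_lin (c : R) a b : rtest a -> rtest b ->
  rtest (fun x => c * a x + b x).
Proof.
move=> [sa [K cK Ka]] [sb [L cL Lb]]; split.
  by apply: smoothD => //; exact: (@smoothZ _ _ _ c a sa).
exists (K `|` L); first exact: compactU.
move=> x KLx; rewrite Ka ?Lb ?mulr0 ?addr0// => ?; apply: KLx; [by right|by left].
Qed.

Lemma rtest_vsec K Phi x : compact K -> smooth_on setT Phi -> fiber_in K Phi ->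
  rtest (fun y => Phi (x, y)).
Proof.
by move=> cK sP PK; split; [exact: smooth_vsec|exists K => // y; exact: PK].
Qed.

Lemma rdist_sub (v : (V -> R) -> R) a b : rdist v -> rtest a -> rtest b ->
  v (fun x => a x - b x) = v a - v b.
Proof.
move=> [vl _] ta tb; rewrite -[v a - v b](addrC (- v b)).
rewrite -mulN1r -vl//; congr v; apply/funext => x; by rewrite mulN1r addrC.
Qed.

Lemma param_continuous (v : (V -> R) -> R) K Phi : rdist v -> compact K ->
  smooth_on setT Phi -> fiber_in K Phi ->
  continuous (fun x => v (fun y => Phi (x, y))).
Proof.
move=> dv cK sP PK x0; have [n [M [M0 HM]]] := dv.2 K cK.
apply/cvgrPdist_le => /= d d0.
have d1 : 0 < d / (M + 1) by rewrite divr_gt0// ltr_wpDl.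
apply: filterS (section_close n x0 cK sP PK d1) => x Hx.
rewrite distrC -rdist_sub//; [|exact: rtest_vsec PK|exact: rtest_vsec PK].
apply: (@le_trans _ _ (M * (d / (M + 1)))); last first.
  rewrite mulrCA ger_pMr// ler_pdivrMr ?mul1r ?lerDl// ltr_wpDl//.
have -> : (fun y => Phi (x, y) - Phi (x0, y)) =
    (fun y => (- 1) *: Phi (x0, y) + Phi (x, y)).
  by apply/funext => y; rewrite scaleN1r addrC.
apply: HM.
- by apply: rtest_lin; exact: rtest_vsec PK.
- by move=> y Ky; rewrite !PK// scaler0 addr0.
- move=> s y sn; rewrite iterD_lin; try exact: smooth_vsec.
  by rewrite scaleN1r addrC; exact: Hx.
Qed.

(** The function q is the difference quotient of Phi in the parameter minus its limit Psi. It has to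
    be small together with its y-derivatives up to the order n of v on K: by the mean value theorem
    in the parameter, each of these is the variation of a y-derivative of Psi between x and a nearby
    point, which [section_close] bounds. *)
Lemma param_derive (v : (V -> R) -> R) K Phi (x w : U) : rdist v -> compact K ->
  smooth_on setT Phi -> fiber_in K Phi ->
  is_derive x w (fun x => v (fun y => Phi (x, y)))
    (v (fun y => 'D_(hdir w) Phi (x, y))).
Proof.
move=> dv cK sP PK; have [n [M [M0 HM]]] := dv.2 K cK.
pose Psi p := 'D_(hdir w) Phi p.
have sPsi : smooth_on setT Psi by exact: smooth_derive.
have PsiK : fiber_in K Psi by exact: fiber_in_hdir.
set A := fun x => _; set l := v _.
suff H : (fun h => h^-1 *: ((A \o shift x) (h *: w) - A x)) @ 0^' --> l.
  by split; [apply/cvg_ex; exists l|exact: cvg_lim H].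
apply/cvgrPdist_le => /= d d0.
have d1 : 0 < d / (M + 1) by rewrite divr_gt0// ltr_wpDl.
have /nbhs_ballP[r /= r0 Hr] := section_close n x cK sPsi PsiK d1.
have w1 : 0 < `|w| + 1 by rewrite ltr_wpDl.
have near_h : \forall h \near (0 : R)^', h != 0 /\ `|h| < r / (`|w| + 1).
  have q0 : 0 < r / (`|w| + 1) by rewrite divr_gt0.
  near=> h; split; near: h; [exact: nbhs_dnbhs_neq|exact: dnbhs0_lt].
apply: filterS near_h => h [h0 hr].
have tV x' : rtest (fun y => Phi (x', y)) by exact: rtest_vsec PK.
have tPsi : rtest (fun y => Psi (x, y)) by exact: rtest_vsec PsiK.
pose q y := h^-1 * (Phi (h *: w + x, y) - Phi (x, y)) - Psi (x, y).
have tD : rtest (fun y => Phi (h *: w + x, y) - Phi (x, y)).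
  rewrite (_ : (fun y => _) = fun y => (-1) * Phi (x, y) + Phi (h *: w + x, y)).
    exact: rtest_lin.
  by apply/funext => y; rewrite mulN1r addrC.
have vq : v q = h^-1 *: (A (h *: w + x) - A x) - l.
  have -> : q = fun y => (-1) * Psi (x, y) +
      h^-1 * (Phi (h *: w + x, y) - Phi (x, y)).
    by apply/funext => y; rewrite mulN1r addrC.
  pose z (y : V) : R := 0.
  have tz : rtest z.
    by split; [exact: smooth_cst|exists K => // y].
  have vz : v z = 0.
    have := dv.1 1 z z tz tz; rewrite (_ : (fun x => _) = z); first by lra.
    by apply/funext => y; rewrite /z mulr0 addr0.
  have tD' : rtest (fun y => h^-1 * (Phi (h *: w + x, y) - Phi (x, y))).
    rewrite (_ : (fun y => _) =
      fun y => h^-1 * (Phi (h *: w + x, y) - Phi (x, y)) + z y).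
      exact: rtest_lin.
    by apply/funext => y; rewrite /z addr0.
  rewrite dv.1// (_ : (fun y => h^-1 * _) =
      fun y => h^-1 * (Phi (h *: w + x, y) - Phi (x, y)) + z y); last first.
    by apply/funext => y; rewrite /z addr0.
  by rewrite dv.1// rdist_sub// vz addr0 mulN1r addrC.
rewrite distrC -vq.
apply: (@le_trans _ _ (M * (d / (M + 1)))); last first.
  rewrite mulrCA ger_pMr// ler_pdivrMr ?mul1r ?lerDl// ltr_wpDl//.
have qE : q = fun y => (-1) *: Psi (x, y) +
    (h^-1 *: ((-1) *: Phi (x, y) + Phi (h *: w + x, y))).
  by apply/funext => y; rewrite !scaleN1r addrC [- _ + _]addrC.
have sV x' := tV x'; have sPhi x' : smooth_on setT (fun y => Phi (x', y)).
  by have [] := tV x'.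
apply: HM => [|y Ky|s y sn].
- rewrite (_ : q = fun y => (-1) * Psi (x, y) +
      h^-1 * (Phi (h *: w + x, y) - Phi (x, y))); last first.
    by apply/funext => y; rewrite mulN1r addrC.
  apply: rtest_lin => //; split.
    exact: (@smoothZ _ _ _ h^-1 _ tD.1).
  by exists K => // y Ky; rewrite !PK// subrr mulr0.
- by rewrite /q !PK// PsiK// subrr mulr0 subr0.
- have -> : iterD (map e s) q y =
    h^-1 * (iterD (map e s) (fun y => Phi (h *: w + x, y)) y -
            iterD (map e s) (fun y => Phi (x, y)) y) -
    iterD (map e s) (fun y => Psi (x, y)) y.
    rewrite qE iterD_lin; [|exact: tPsi.1|]; last first.
      exact/smoothZ/smoothD/sPhi/smoothZ/sPhi.
    rewrite scaleN1r addrC; congr (_ - _).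
    pose z (y : V) : R := 0.
    have -> : (fun y => h^-1 *: ((-1) *: Phi (x, y) + Phi (h *: w + x, y))) =
       (fun y => h^-1 *: ((-1) *: Phi (x, y) + Phi (h *: w + x, y)) + z y).
      by apply/funext => y'; rewrite /z addr0.
    rewrite iterD_lin; [|exact/smoothD/sPhi/smoothZ/sPhi|exact: smooth_cst].
    rewrite iterD_lin//.
    have -> : iterD (map e s) z y = 0.
      by elim: (map e s) y => //= v' vs IH y; apply: derive_eq0 => h'.
    by rewrite addr0 scaleN1r [- _ + _]addrC.
  rewrite !iterD_vsec; set vs := map _ _.
  have AE (p : U * V) t : t *: hdir w + p = (t *: w + p.1, p.2).
    by apply: injective_projections; rewrite //= scaler0 add0r.
  have [c ch E] := MVT_dir (x, y) h (fun p => @smooth_derivable _ _ _ _ p (hdir w)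
     (smooth_iterD vs sP)).
  rewrite !AE /= in E; rewrite E mulKf//.
  rewrite -[derive _ _ _]/((fun p => 'D_(hdir w) (iterD vs Phi) p) _).
  (* Symmetry of second derivatives turns the parameter derivative of a y-derivative of Phi into a
     y-derivative of Psi. *)
  rewrite -(iterD_comm vs (hdir w) sP) -/Psi.
  have xc : ball x r (c *: w + x).
    rewrite -ball_normE /= opprD addrCA subrr addr0 normrN normrZ.
    rewrite (le_lt_trans (ler_wpM2r (normr_ge0 _) ch))//.
    rewrite ltr_pdivlMr// in hr; apply: le_lt_trans hr.
    by rewrite ler_wpM2l// lerDl.
  by have := Hr _ xc s y sn; rewrite !iterD_vsec.
Unshelve. all: by end_near. Qed.

Lemma param_smooth (v : (V -> R) -> R) K Phi : rdist v -> compact K ->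
  smooth_on setT Phi -> fiber_in K Phi ->
  smooth_on setT (fun x => v (fun y => Phi (x, y))).
Proof.
move=> dv cK sP PK n; elim: n Phi sP PK => [|n IH] Phi sP PK.
  by apply/Ck_on0 => x _; exact: param_continuous PK x.
have D x w := param_derive x w dv cK sP PK.
apply/Ck_onS; split=> [x _|x w _|w].
- exact: param_continuous PK x.
- by have [] := D x w.
- have -> : (fun x => 'D_w (fun x => v (fun y => Phi (x, y))) x) =
      fun x => v (fun y => 'D_(hdir w) Phi (x, y)).
    by apply/funext => x; have [] := D x w.
  apply: (IH (fun p => 'D_(hdir w) Phi p)); first exact: smooth_derive.
  exact: fiber_in_hdir.
Qed.

Lemma param_iterD (v : (V -> R) -> R) K Phi ws : rdist v -> compact K ->
  smooth_on setT Phi -> fiber_in K Phi ->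
  iterD ws (fun x => v (fun y => Phi (x, y))) =
  fun x => v (fun y => iterD (map hdir ws) Phi (x, y)).
Proof.
move=> dv cK; elim/last_ind: ws Phi => // ws w IH Phi sP PK.
rewrite iterD_rcons map_rcons iterD_rcons.
rewrite -(IH (fun p => 'D_(hdir w) Phi p)); last 2 first.
- exact: smooth_derive.
- exact: fiber_in_hdir.
congr (iterD _ _); apply/funext => x.
by have [] := param_derive x w dv cK sP PK.
Qed.

End Param.

(** * Exchanging a distribution with an integral *)

Section RealIntegral.
Variables (R : realType) (V : normedModType R).
Notation BV := (g_sigma_algebraType (@open V)).
Variable mu : {measure set BV -> \bar R}.
Hypothesis mu_fin : forall K : set V, compact K -> (mu K < +oo)%E.
Implicit Types (f g : V -> R) (K : set V).

Definition rint f : R := Rintegral mu setT (f : BV -> R).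

Lemma measurable_open (A : set V) : open A -> measurable (A : set BV).
Proof. by move=> oA; apply: sub_sigma_algebra. Qed.

Lemma measurable_compact K : compact K -> measurable (K : set BV).
Proof.
move=> cK; have kK : closed K by apply: compact_closed => //; exact: norm_hausdorff.
rewrite -(setCK K); apply: measurableC; apply: measurable_open.
exact: closed_openC.
Qed.

Lemma measurable_continuous f : continuous f ->
  measurable_fun setT (f : BV -> R).
Proof.
move=> /continuousP cf; apply: (measurability _ (measurable_realfun.RGenOpens.measurableE R)).
move=> _ [_ [a [b ->]] <-]; rewrite setTI.
apply: measurable_open; apply: cf; exact: interval_open.
Qed.

Definition ccs f := continuous f /\ exists2 K, compact K & forall x, ~ K x -> f x = 0.

Lemma continuous_compact_bounded f K : continuous f -> compact K ->
  exists2 B : R, 0 <= B & forall x, K x -> `|f x| <= B.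
Proof.
move=> cf cK.
have [B [Br HB]] : bounded_set (f @` K).
  apply: compact_bounded; apply: continuous_compact => //.
  exact: continuous_subspaceT.
exists (`|B| + 1) => [|x Kx]; first by rewrite addr_ge0.
by apply: (HB (`|B| + 1)); [rewrite ltr_pwDr// ler_norm|exists x].
Qed.

Lemma ccs_integrable f : ccs f -> mu.-integrable setT (EFin \o (f : BV -> R)).
Proof.
move=> [cf [K cK fK]].
have mK := measurable_compact cK.
have -> : EFin \o f = (EFin \o f) \_ K.
  apply/funext => x; rewrite /patch; case: ifPn => // /negP; rewrite inE => Kx.
  by rewrite /= fK.
apply/(integrable_mkcond (EFin \o (f : BV -> R)) mK).
apply: measurable_bounded_integrable => //.
- exact: mu_fin.
- exact: measurable_funTS (measurable_continuous cf).
have [B _ HB] := continuous_compact_bounded cf cK.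
exists B; split=> [|M BM x Kx]; first exact: num_real.
exact: le_trans (HB _ Kx) (ltW BM).
Qed.

Lemma ccs_lin (c : R) f g : ccs f -> ccs g -> ccs (fun x => c * f x + g x).
Proof.
move=> [cf [K cK fK]] [cg [L cL gL]]; split.
  by move=> x; apply: cvgD; [apply: cvgMr; exact: cf|exact: cg].
exists (K `|` L); first exact: compactU.
move=> x KLx; rewrite fK ?gL ?mulr0 ?addr0// => ?; apply: KLx; [by right|by left].
Qed.

Lemma rint_lin (c : R) f g : ccs f -> ccs g ->
  rint (fun x => c * f x + g x) = c * rint f + rint g.
Proof.
move=> Hf Hg; have If := ccs_integrable Hf; have Ig := ccs_integrable Hg.
rewrite /rint RintegralD// ?RintegralZl//.
exact: (integrableZl measurableT c If).
Qed.

Lemma rint_restrict f K : (forall x, ~ K x -> f x = 0) ->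
  rint f = Rintegral mu K f.
Proof.
move=> fK; rewrite /rint [RHS]Rintegral_mkcond; apply: eq_Rintegral => x _.
by rewrite /patch; case: ifPn => // /negP; rewrite inE => Kx; exact: fK.
Qed.

Lemma rint_bound f K (B : R) : continuous f -> compact K ->
  (forall x, ~ K x -> f x = 0) -> (forall x, `|f x| <= B) ->
  `|rint f| <= fine (mu K) * B.
Proof.
move=> cf cK fK fB.
have mK := measurable_compact cK.
have Hf : ccs f by split => //; exists K.
have If := ccs_integrable Hf.
have IfK : mu.-integrable K (EFin \o (f : BV -> R)) by exact: integrableS If.
rewrite (rint_restrict fK).
rewrite (le_trans (le_normr_Rintegral mK IfK))// mulrC -Rintegral_cst//.
apply: le_Rintegral => //.
- exact: (integrable_norm).
- apply: measurable_bounded_integrable => //; first exact: mu_fin.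
  exists B; split=> [|M BM x _]; first exact: num_real.
  have B0 : 0 <= B := le_trans (normr_ge0 _) (fB x).
  by rewrite /= ger0_norm// ltW.
Qed.

(* One finite set of nodes and weights serves all functions f; this is what
   makes [exchange] follow from linearity and continuity alone. *)
Lemma quadrature K (P : V -> set V) : compact K ->
  (forall x, K x -> nbhs x (P x)) ->
  exists2 r : seq (R * V), (forall p, p \in r -> K p.2) &
  forall f (e : R), ccs f -> (forall x y, K x -> K y -> P x y -> `|f y - f x| <= e) ->
    `|Rintegral mu K f - \sum_(p <- r) p.1 * f p.2| <= e * fine (mu K).
Proof.
move=> cK PK; have mK := measurable_compact cK.
have := cK; rewrite compact_cover => /(_ V K (fun x => interior (P x))).
case=> [x Kx|x Kx|D DK KD].
- exact: open_interior.
- by exists x => //; exact: PK.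
have {KD} [xs xsK KD] : exists2 xs : seq V, (forall x, x \in xs -> K x) &
    forall y, K y -> exists2 x, x \in xs & (P x)^° y.
  exists (finmap.enum_fset D) => [x xD|y /KD[x xD Py]]; last by exists x.
  by have := DK x xD; rewrite inE.
(* The cover is made disjoint by induction on the list of centres: the part of A inside the interior
   of P x is split off as one cell, with x as node and its measure as weight. *)
suff main : forall A : set BV, measurable A -> A `<=` K ->
    (forall y, A y -> exists2 x, x \in xs & (P x)^° y) ->
  exists2 r : seq (R * V), (forall p, p \in r -> K p.2) &
  forall f (e : R), ccs f -> (forall x y, K x -> K y -> P x y -> `|f y - f x| <= e) ->
    `|Rintegral mu A f - \sum_(p <- r) p.1 * f p.2| <= e * fine (mu A).
  exact: main.
elim: xs xsK {KD D DK} => [|x xs IH] xsK A mA AK AD.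
  exists [::] => // f e cf _; have -> : A = set0.
    by apply/seteqP; split=> // y /AD[].
  by rewrite Rintegral_set0 big_nil subrr normr0 measure0 /= mulr0.
have Kx : K x by apply: xsK; rewrite inE eqxx.
have mP : measurable ((P x)^° : set BV) by apply: measurable_open; exact: open_interior.
pose A1 : set BV := A `&` (P x)^°; pose A2 : set BV := A `\` (P x)^°.
have mA1 : measurable A1 by exact: measurableI.
have mA2 : measurable A2 by exact: measurableD.
have AE : A = A1 `|` A2 by rewrite setUIDK.
have [|y [/AK//]|y|r rK Hr] := IH _ A2 mA2.
- by move=> y yxs; apply: xsK; rewrite inE yxs orbT.
- move=> [Ay Py]; have [x'] := AD y Ay; rewrite inE => /orP[/eqP ->//|xs' ?].
  by exists x'.
exists ((fine (mu A1), x) :: r) => [p|f e cf Hf].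
  by rewrite inE => /orP[/eqP ->//|/rK].
have If := ccs_integrable cf.
have dA : [disjoint A1 & A2].
  by apply/disj_setPS => y [[_ ?] [_ ?]].
have fin (B : set BV) : measurable B -> B `<=` K -> (mu B < +oo)%E.
  by move=> mB BK; apply: le_lt_trans (mu_fin cK); apply: le_measure; rewrite ?inE.
have A1K : A1 `<=` K by move=> y [/AK].
have A2K : A2 `<=` K by move=> y [/AK].
have -> : Rintegral mu A f = Rintegral mu A1 f + Rintegral mu A2 f.
  rewrite {1}AE Rintegral_setU// -AE; exact: integrableS If.
have -> : fine (mu A) = fine (mu A1) + fine (mu A2).
  rewrite {1}AE measureU// ?fineD ?ge0_fin_numE ?fin//.
  by apply/eqP; rewrite -disj_set2E.
rewrite big_cons /= opprD addrACA mulrDr (le_trans (ler_normD _ _))//.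
rewrite lerD//; last exact: Hr.
have Ic c : mu.-integrable A1 (EFin \o (fun _ : BV => c)).
  apply: measurable_bounded_integrable => //; first exact: fin.
  by exists `|c|; split=> [|M cM y _]; [exact: num_real|exact: ltW].
have If1 : mu.-integrable A1 (EFin \o (f : BV -> R)) by exact: integrableS If.
rewrite mulrC -Rintegral_cst// -RintegralB//.
have Ifc : mu.-integrable A1 (EFin \o (fun y : BV => f y - f x)).
  exact: (integrableB mA1 If1 (Ic (f x))).
rewrite (le_trans (le_normr_Rintegral mA1 Ifc))// -Rintegral_cst//.
apply: le_Rintegral => //; first exact: integrable_norm.
move=> y [Ay Py]; apply: Hf => //; first exact: AK.
exact: interior_subset Py.
Qed.

Variables (I : finType) (e : I -> V).

Lemma rtest_ccs f : rtest f -> ccs f.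
Proof. by move=> [/smooth_continuous cf fK]. Qed.

Lemma rdist_rint : rdist e rint.
Proof.
split=> [c a b ta tb|K cK]; first by apply: rint_lin; exact: rtest_ccs.
exists 0%N, (fine (mu K)); split; first exact: fine_ge0.
move=> a B ta Ka HB; apply: rint_bound => //; first by have [] := rtest_ccs ta.
by move=> x; apply: (HB [::]).
Qed.

Lemma rtest0 : rtest (fun _ : V => 0 : R).
Proof. by split; [exact: smooth_cst|exists set0 => //; exact: compact0]. Qed.

Lemma rdist0 v : rdist e v -> v (fun=> 0) = 0.
Proof.
move=> [vl _]; have := vl 1 _ _ rtest0 rtest0.
rewrite (_ : (fun x => _) = fun=> 0); first by lra.
by apply/funext => x; rewrite mulr0 addr0.
Qed.

Lemma rtest_sum (J : Type) (r : seq J) (c : J -> R) (F : J -> V -> R) :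
  (forall j, rtest (F j)) -> rtest (fun x => \sum_(j <- r) c j * F j x).
Proof.
move=> HF; elim: r => [|j r IH].
  rewrite (_ : (fun x => _) = fun=> 0); first exact: rtest0.
  by apply/funext => x; rewrite big_nil.
rewrite (_ : (fun x => _) = fun x => c j * F j x + \sum_(k <- r) c k * F k x).
  exact: rtest_lin.
by apply/funext => x; rewrite big_cons.
Qed.

Lemma rdist_sum v (J : Type) (r : seq J) (c : J -> R) (F : J -> V -> R) :
  rdist e v -> (forall j, rtest (F j)) ->
  v (fun x => \sum_(j <- r) c j * F j x) = \sum_(j <- r) c j * v (F j).
Proof.
move=> dv HF; elim: r => [|j r IH].
  rewrite big_nil (_ : (fun x => _) = fun=> 0); first exact: rdist0.
  by apply/funext => x; rewrite big_nil.
rewrite big_cons -IH -dv.1//; last exact: rtest_sum.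
by congr v; apply/funext => x; rewrite big_cons.
Qed.

Lemma iterD0 (vs : seq V) : iterD vs (fun _ : V => 0 : R) = fun=> 0.
Proof.
elim: vs => //= v' vs ->; apply/funext => y; exact: derive_eq0.
Qed.

Lemma iterD_sum (J : Type) (r : seq J) (c : J -> R) (F : J -> V -> R) vs x :
  (forall j, rtest (F j)) ->
  iterD vs (fun x => \sum_(j <- r) c j * F j x) x =
  \sum_(j <- r) c j * iterD vs (F j) x.
Proof.
move=> HF; elim: r => [|j r IH].
  rewrite big_nil (_ : (fun x => _) = fun=> 0); last first.
    by apply/funext => y; rewrite big_nil.
  by rewrite iterD0.
rewrite big_cons -IH.
rewrite (_ : (fun x => \sum_(j <- _ :: _) _) =
   fun x => c j *: F j x + \sum_(k <- r) c k * F k x); last first.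
  by apply/funext => y; rewrite big_cons.
rewrite iterD_lin//; first by have [] := HF j.
by have [] := rtest_sum r c HF.
Qed.

Lemma smooth_swap (Phi : V * V -> R) : smooth_on setT Phi ->
  smooth_on setT (fun p : V * V => Phi (p.2, p.1)).
Proof.
move=> sP; apply: (smooth_affine (A := fun p : V * V => (p.2, p.1))
  (L := fun p => (p.2, p.1))) => // p.
by apply: cvg_pair; [exact: cvg_snd|exact: cvg_fst].
Qed.

Lemma iterD_swap (Phi : V * V -> R) vs x y :
  iterD (map (@hdir R V V) vs) (fun p : V * V => Phi (p.2, p.1)) (y, x) =
  iterD vs (fun y => Phi (x, y)) y.
Proof.
rewrite (@iterD_affine R (V * V)%type (V * V)%type R (fun p => (p.2, p.1))
  (fun p => (p.2, p.1)) _ Phi)//=.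
by rewrite iterD_vsec -map_comp.
Qed.

(** A Riemann sum S in x approximates J together with its y-derivatives up to the order n of v on K,
    because the cells P control all these derivatives of the sections at once. By linearity v S is
    the Riemann sum of A with the same nodes and weights, so it is close both to v J and to the
    integral of A. *)
Lemma exchange v (Phi : V * V -> R) K : rdist e v -> compact K ->
  smooth_on setT Phi -> (forall x y, ~ K x \/ ~ K y -> Phi (x, y) = 0) ->
  v (fun y => rint (fun x => Phi (x, y))) = rint (fun x => v (fun y => Phi (x, y))).
Proof.
move=> dv cK sP PK.
have PK1 : fiber_in K Phi by move=> x y Ky; apply: PK; right.
(* The parameter lemmas take the first variable as parameter; swapping lets them differentiate the
   integral over x with y as parameter. *)
pose Phi' (p : V * V) := Phi (p.2, p.1).
have sP' : smooth_on setT Phi' by exact: smooth_swap.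
have PK2 : fiber_in K Phi' by move=> x y Ky; apply: PK; left.
have [n [M [M0 HM]]] := dv.2 K cK.
pose J y := rint (fun x => Phi' (y, x)).
have JE vs y : iterD vs J y = rint (fun x => iterD vs (fun y => Phi (x, y)) y).
  rewrite /J (param_iterD vs rdist_rint cK sP' PK2).
  by congr rint; apply/funext => x; rewrite iterD_swap.
have tJ : rtest J.
  split; first exact: param_smooth rdist_rint cK sP' PK2.
  exists K => // y Ky; rewrite /J (_ : (fun x => _) = fun=> 0).
    exact: rdist0 rdist_rint.
  by apply/funext => x; rewrite /Phi' PK//; right.
pose A x := v (fun y => Phi (x, y)).
have cA : ccs A.
  split; first exact: smooth_continuous (param_smooth dv cK sP PK1).
  exists K => // x Kx; rewrite /A (_ : (fun x => _) = fun=> 0); first exact: rdist0 dv.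
  by apply/funext => y; rewrite PK//; left.
have A0 x : ~ K x -> A x = 0.
  move=> Kx; rewrite /A (_ : (fun x => _) = fun=> 0); first exact: rdist0 dv.
  by apply/funext => y; rewrite PK//; left.
rewrite -[LHS]/(v J) -[RHS]/(rint A).
apply/eqP; rewrite -subr_eq0 -normr_le0; apply/ler_addgt0Pl => d d0; rewrite addr0.
set N := fine (mu K); have N0 : 0 <= N by exact: fine_ge0.
(* Both errors come out as M * d' * N: derivatives off by d' * N and then v applied, or A varying by
   M * d' on a cell and then integrated. The added ones keep the division meaningful when M or N is
   0. *)
pose d' : R := d / 2 / ((M + 1) * (N + 1)).
have MN0 : 0 < (M + 1) * (N + 1) by rewrite mulr_gt0// ltr_wpDl.
have d'0 : 0 < d' by rewrite !divr_gt0.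
have d'E : M * d' * N <= d / 2.
  have <- : d' * ((M + 1) * (N + 1)) = d / 2 by rewrite /d' divfK// gt_eqF.
  have -> : d' * ((M + 1) * (N + 1)) = M * d' * N + d' * (M + N + 1) by ring.
  by rewrite lerDl mulr_ge0 ?(ltW d'0)// !addr_ge0.
pose P (x0 : V) := [set x : V | forall (s : seq I) y, (size s <= n)%N ->
  `|iterD (map e s) (fun y => Phi (x, y)) y -
    iterD (map e s) (fun y => Phi (x0, y)) y| <= d'].
have PP x : K x -> nbhs x (P x).
  by move=> _; exact: section_close cK sP PK1 d'0.
have [r rK Hr] := quadrature cK PP.
pose S y := \sum_(p <- r) p.1 * Phi (p.2, y).
have tF (p : R * V) : rtest (fun y => Phi (p.2, y)) by exact: rtest_vsec PK1.
have vS : v S = \sum_(p <- r) p.1 * A p.2 by rewrite /S rdist_sum.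
have tS : rtest S by exact: rtest_sum.
apply: (@ler_dist_half _ _ (v S)).
  rewrite -(rdist_sub dv tJ tS); apply: le_trans d'E; rewrite -mulrA.
  apply: HM.
  - rewrite (_ : (fun x => _) = fun x => (-1) * S x + J x); first exact: rtest_lin.
    by apply/funext => x; rewrite mulN1r addrC.
  - move=> x Kx; rewrite [J x](_ : _ = 0); last first.
      rewrite /J (_ : (fun x => _) = fun=> 0); first exact: rdist0 rdist_rint.
      by apply/funext => y; rewrite /Phi' PK//; right.
    by rewrite /S big1 ?subr0// => p _; rewrite PK ?mulr0//; right.
  - move=> s y sn.
    have -> : (fun x => J x - S x) = (fun x => (-1) *: S x + J x).
      by apply/funext => x; rewrite scaleN1r addrC.
    rewrite iterD_lin; [|exact: tS.1|exact: tJ.1].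
    rewrite scaleN1r addrC JE /S iterD_sum//.
    set G := fun x => iterD (map e s) (fun y => Phi (x, y)) y.
    have G0 x : ~ K x -> G x = 0.
      move=> Kx; rewrite /G (_ : (fun y => _) = fun=> 0).
        by rewrite iterD0.
      by apply/funext => z; rewrite PK//; left.
    rewrite (rint_restrict G0); apply: Hr; last by move=> x x' _ _; apply.
    split; last by exists K.
    rewrite /G => x.
    rewrite (_ : (fun x => _) = (fun x => iterD (map (@vdir R V V) (map e s)) Phi (x, y))).
      apply: (continuous_comp (f := fun x => (x, y))).
        by apply: cvg_pair => //; exact: cvg_cst.
      exact: smooth_continuous (smooth_iterD _ sP) _.
    by apply/funext => z; rewrite iterD_vsec.
rewrite distrC vS (rint_restrict A0); apply: le_trans d'E.
apply: (Hr A (M * d') cA) => x x' Kx Kx' H.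
rewrite -(rdist_sub dv (tF (0, x')) (tF (0, x))).
have -> : (fun y => Phi (x', y) - Phi (x, y)) =
    (fun y => (- 1) *: Phi (x, y) + Phi (x', y)).
  by apply/funext => y; rewrite scaleN1r addrC.
apply: HM.
- by apply: rtest_lin; exact: rtest_vsec PK1.
- by move=> y Ky; rewrite !PK1// scaler0 addr0.
- move=> s y sn; rewrite iterD_lin; try exact: smooth_vsec.
  by rewrite scaleN1r addrC; exact: H.
Qed.

End RealIntegral.

(** * Complex-valued functions and distributions *)

Section ComplexValued.
Variable R : realType.
Implicit Types (V W : normedModType R).

Lemma reD (x y : R[i]) : complex.Re (x + y) = complex.Re x + complex.Re y.
Proof. by case: x => a b; case: y. Qed.
Lemma imD (x y : R[i]) : complex.Im (x + y) = complex.Im x + complex.Im y.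
Proof. by case: x => a b; case: y. Qed.
Lemma reM (x y : R[i]) : complex.Re (x * y) =
  complex.Re x * complex.Re y - complex.Im x * complex.Im y.
Proof. by case: x => a b; case: y. Qed.
Lemma imM (x y : R[i]) : complex.Im (x * y) =
  complex.Re x * complex.Im y + complex.Im x * complex.Re y.
Proof. by case: x => a b; case: y. Qed.
Lemma reN (x : R[i]) : complex.Re (- x) = - complex.Re x.
Proof. by case: x. Qed.
Lemma imN (x : R[i]) : complex.Im (- x) = - complex.Im x.
Proof. by case: x. Qed.
Lemma complexP (x y : R[i]) : complex.Re x = complex.Re y ->
  complex.Im x = complex.Im y -> x = y.
Proof. by case: x => a b; case: y => c d /= -> ->. Qed.

Lemma csmooth_onP V (U : set V) (f : V -> R[i]) :
  csmooth_on U f <-> smooth_on U (cre f) /\ smooth_on U (cim f).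
Proof.
split=> [H|[H1 H2] n]; last by split; [exact: H1|exact: H2].
by split=> n; have [] := H n.
Qed.

Lemma smooth_onB V (U : set V) (f g : V -> R) : open U -> smooth_on U f ->
  smooth_on U g -> smooth_on U (fun x => f x - g x).
Proof.
move=> oU sf sg n.
rewrite (_ : (fun x => _) = fun x => f x + (-1) *: g x).
  by apply: Ck_onD => //; exact: Ck_onZ.
by apply/funext => x; rewrite scaleN1r.
Qed.

Lemma smooth_onM V (U : set V) (f g : V -> R) : open U -> smooth_on U f ->
  smooth_on U g -> smooth_on U (fun x => f x * g x).
Proof. by move=> oU sf sg n; exact: Ck_onM. Qed.

Lemma csmooth_onD V (U : set V) (f g : V -> R[i]) : open U -> csmooth_on U f ->
  csmooth_on U g -> csmooth_on U (fun x => f x + g x).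
Proof.
move=> oU /csmooth_onP[f1 f2] /csmooth_onP[g1 g2]; apply/csmooth_onP; split=> n.
- rewrite (_ : cre _ = fun x => cre f x + cre g x); first exact: Ck_onD.
  by apply/funext => x; exact: reD.
- rewrite (_ : cim _ = fun x => cim f x + cim g x); first exact: Ck_onD.
  by apply/funext => x; exact: imD.
Qed.

Lemma csmooth_onM V (U : set V) (f g : V -> R[i]) : open U -> csmooth_on U f ->
  csmooth_on U g -> csmooth_on U (fun x => f x * g x).
Proof.
move=> oU /csmooth_onP[f1 f2] /csmooth_onP[g1 g2]; apply/csmooth_onP; split.
- rewrite (_ : cre _ = fun x => cre f x * cre g x - cim f x * cim g x).
    by apply: smooth_onB; [exact: oU|exact: smooth_onM|exact: smooth_onM].
  by apply/funext => x; exact: reM.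
- rewrite (_ : cim _ = fun x => cre f x * cim g x + cim f x * cre g x).
    by move=> n; apply: Ck_onD => //; exact: Ck_onM.
  by apply/funext => x; exact: imM.
Qed.

Lemma csmooth_on_cst V (U : set V) (c : R[i]) : csmooth_on U (fun=> c).
Proof. by move=> n; split; exact: Ck_on_cst. Qed.

Lemma csmooth_on_eq V (U : set V) (f g : V -> R[i]) : open U ->
  (forall x, U x -> f x = g x) -> csmooth_on U f -> csmooth_on U g.
Proof.
move=> oU fg sf n; have [f1 f2] := sf n; split.
- by apply: (Ck_on_eq oU _ f1) => x Ux; rewrite /cre fg.
- by apply: (Ck_on_eq oU _ f2) => x Ux; rewrite /cim fg.
Qed.

Lemma csmooth_on_cover V (U : set V) (f : V -> R[i]) :
  (forall x, U x -> exists N, [/\ open N, N x & csmooth_on N f]) ->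
  csmooth_on U f.
Proof.
move=> H n; split; apply: Ck_on_cover => x Ux; have [N [oN Nx sN]] := H x Ux;
  by exists N; split=> //; have [] := sN n.
Qed.

Lemma csmooth_on_sub V (U U' : set V) (f : V -> R[i]) : U' `<=` U ->
  csmooth_on U f -> csmooth_on U' f.
Proof. by move=> UU sf n; have [? ?] := sf n; split; exact: Ck_on_sub UU _. Qed.

Lemma csmooth_comp V W (f : W -> R[i]) (G : V -> W) : findim W ->
  csmooth_on setT f -> smooth_on setT G -> csmooth_on setT (fun x => f (G x)).
Proof.
move=> fW /csmooth_onP[f1 f2] sG; apply/csmooth_onP; split.
- exact: (smooth_comp fW f1 sG).
- exact: (smooth_comp fW f2 sG).
Qed.

Lemma csmooth_affine V W (A L : V -> W) (f : W -> R[i]) :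
  (forall x h v, A (h *: v + x) = h *: L v + A x) -> continuous A ->
  csmooth_on setT f -> csmooth_on setT (fun x => f (A x)).
Proof.
move=> AL cA /csmooth_onP[f1 f2]; apply/csmooth_onP; split.
- exact: (smooth_affine AL cA f1).
- exact: (smooth_affine AL cA f2).
Qed.

Lemma csmooth_fst V W (f : V -> R[i]) : csmooth_on setT f ->
  csmooth_on setT (fun p : V * W => f p.1).
Proof.
by apply: (csmooth_affine (L := fst)) => // x; exact: cvg_fst.
Qed.

Lemma csmooth_snd V W (f : W -> R[i]) : csmooth_on setT f ->
  csmooth_on setT (fun p : V * W => f p.2).
Proof.
by apply: (csmooth_affine (L := snd)) => // x; exact: cvg_snd.
Qed.

Lemma csmooth_vsec V W (f : V * W -> R[i]) (x : V) : csmooth_on setT f ->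
  csmooth_on setT (fun y => f (x, y)).
Proof.
apply: (csmooth_affine (L := @vdir R V W)) => [y h v|y].
  exact: vsec_affine.
by apply: cvg_pair => //; exact: cvg_cst.
Qed.

Lemma csmooth_hsec V W (f : V * W -> R[i]) (y : W) : csmooth_on setT f ->
  csmooth_on setT (fun x => f (x, y)).
Proof.
apply: (csmooth_affine (L := @hdir R V W)) => [x h v|x].
  by apply: injective_projections; rewrite //= scaler0 add0r.
by apply: cvg_pair => //; exact: cvg_cst.
Qed.

End ComplexValued.

(** * Complex distributions, reduced to their real and imaginary parts *)

Section Distributions.
Variables (R : realType) (m : nat).
Notation V := 'rV[R]_m.
Implicit Types (phi psi : V -> R[i]) (u : functional R m) (K : set V).

Definition cvanish K phi := forall x, ~ K x -> phi x = 0.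

Lemma supp_sub K phi : compact K -> cvanish K phi -> supp phi `<=` K.
Proof.
move=> cK pK; have kK : closed K.
  by apply: compact_closed => //; exact: norm_hausdorff.
rewrite ((closure_id K).1 kK); apply: closure_subset => x /=.
by move=> /eqP px; apply: contrapT => /pK.
Qed.

Lemma vanish_supp phi : cvanish (supp phi) phi.
Proof.
move=> x xs; apply: contrapT => /eqP px; apply: xs.
exact: subset_closure.
Qed.

Lemma testP phi : test phi <-> csmooth_on setT phi /\
  exists2 K, compact K & cvanish K phi.
Proof.
split=> [[sp cp]|[sp [K cK pK]]].
  by split=> //; exists (supp phi) => //; exact: vanish_supp.
split=> //; apply: subclosed_compact cK (supp_sub cK pK).
exact: closed_closure.
Qed.

Lemma test_smooth phi : test phi -> csmooth_on setT phi. Proof. by case. Qed.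

Definition ebasis (i : 'I_m) : V := delta_mx 0 i.

(** By complex linearity a distribution is determined by its values on real-valued test functions;
    [dist_re] rebuilds it from these two real functionals. *)
Definition repart u (a : V -> R) : R := complex.Re (u (fun x => (a x)%:C)).
Definition impart u (a : V -> R) : R := complex.Im (u (fun x => (a x)%:C)).

Lemma test_real (a : V -> R) : rtest a -> test (fun x => (a x)%:C).
Proof.
move=> [sa [K cK aK]]; apply/testP; split; last first.
  by exists K => // x Kx; rewrite aK.
apply/csmooth_onP; split; first exact: sa.
exact: smooth_cst.
Qed.

Lemma rtest_re phi : test phi -> rtest (cre phi).
Proof.
move=> /testP[/csmooth_onP[p1 p2] [K cK pK]]; split=> //.
by exists K => // x Kx; rewrite /cre pK.
Qed.

Lemma rtest_im phi : test phi -> rtest (cim phi).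
Proof.
move=> /testP[/csmooth_onP[p1 p2] [K cK pK]]; split=> //.
by exists K => // x Kx; rewrite /cim pK.
Qed.

Lemma test0 : test (fun _ : V => 0 : R[i]).
Proof.
apply/testP; split; first exact: csmooth_on_cst.
by exists set0 => //; exact: compact0.
Qed.

Lemma dist0 u : is_distribution u -> u (fun=> 0) = 0.
Proof.
move=> [ul _]; have := ul 1 _ _ test0 test0.
rewrite (_ : (fun x => _) = fun=> 0); last by apply/funext => x; rewrite mulr0 addr0.
by rewrite mul1r => H; apply: (addrI (u (fun=> 0))); rewrite addr0 -H.
Qed.

Lemma distZ u (c : R[i]) phi : is_distribution u -> test phi ->
  u (fun x => c * phi x) = c * u phi.
Proof.
move=> du tp; have := du.1 c _ _ tp test0; rewrite dist0// addr0 => <-.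
by congr u; apply/funext => x; rewrite addr0.
Qed.

Lemma distD u phi psi : is_distribution u -> test phi -> test psi ->
  u (fun x => phi x + psi x) = u phi + u psi.
Proof.
move=> du tp tq; have := du.1 1 _ _ tp tq; rewrite mul1r => <-.
by congr u; apply/funext => x; rewrite mul1r.
Qed.

Lemma distB u phi psi : is_distribution u -> test phi -> test psi ->
  u (fun x => phi x - psi x) = u phi - u psi.
Proof.
move=> du tp tq; have := du.1 (-1) _ _ tq tp; rewrite mulN1r addrC => <-.
by congr u; apply/funext => x; rewrite mulN1r addrC.
Qed.

Lemma dist_re u phi : is_distribution u -> test phi ->
  complex.Re (u phi) = repart u (cre phi) - impart u (cim phi) /\
  complex.Im (u phi) = impart u (cre phi) + repart u (cim phi).
Proof.
move=> du tp.
have tr := test_real (rtest_re tp); have ti := test_real (rtest_im tp).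
have -> : u phi = 'i * u (fun x => (cim phi x)%:C) + u (fun x => (cre phi x)%:C).
  rewrite -du.1//; congr u; apply/funext => x.
  by rewrite [LHS]complexE addrC.
rewrite reD imD reM imM /repart /impart /= !mul0r !mul1r sub0r add0r.
by split; rewrite addrC.
Qed.

Lemma normc_le (z : R[i]) (B : R) : `|z| <= B%:C ->
  `|complex.Re z| <= B /\ `|complex.Im z| <= B.
Proof.
rewrite normc_def lecR => H.
split; apply: le_trans H; rewrite -sqrtr_sqr ler_wsqrtr//.
  by rewrite lerDl sqr_ge0.
by rewrite lerDr sqr_ge0.
Qed.

Lemma rdist_parts u : is_distribution u ->
  rdist ebasis (repart u) /\ rdist ebasis (impart u).
Proof.
move=> du.
have lin (c : R) a b : rtest a -> rtest b -> u (fun x => (c * a x + b x)%:C) =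
    c%:C * u (fun x => (a x)%:C) + u (fun x => (b x)%:C).
  move=> /test_real ta /test_real tb; rewrite -du.1//; congr u.
  by apply/funext => x; rewrite rmorphD rmorphM.
have bnd K : compact K -> exists (n : nat) (M : R), 0 <= M /\
     forall a (B : R), rtest a -> (forall x, ~ K x -> a x = 0) ->
       (forall (s : seq 'I_m) x, (size s <= n)%N ->
          `|iterD (map ebasis s) a x| <= B) ->
       `|repart u a| <= M * B /\ `|impart u a| <= M * B.
  move=> cK; have [n [M HM]] := du.2 K cK.
  (* The constant of [is_distribution] may be negative, whereas [rdist] asks for a nonnegative one;
     B is nonnegative because it bounds an absolute value. *)
  exists n, (Num.max M 0); split; first by rewrite le_max lexx orbT.
  move=> a B ta aK HB.
  have B0 : 0 <= B by apply: le_trans (HB [::] 0 isT).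
  have MM : M * B <= Num.max M 0 * B by rewrite ler_wpM2r// le_max lexx.
  suff /normc_le[H1 H2] : `|u (fun x => (a x)%:C)| <= (M * B)%:C.
    by split; apply: le_trans MM.
  apply: HM; first exact: test_real.
    by apply: supp_sub => // x Kx; rewrite aK.
  move=> s x sn; split; first exact: HB.
  rewrite /coord_iterD (_ : cim _ = fun=> 0)//.
  by rewrite iterD0 normr0.
split; split=> [c a b ta tb|K cK].
- by rewrite /repart lin// reD reM /= mul0r subr0.
- by have [n [M [M0 H]]] := bnd K cK; exists n, M; split=> // a B ? ? ?;
    have [] := H a B.
- by rewrite /impart lin// imD imM /= mul0r addr0.
- by have [n [M [M0 H]]] := bnd K cK; exists n, M; split=> // a B ? ? ?;
    have [] := H a B.
Qed.

Lemma param_csmooth (U : normedModType R) u K (Phi : U * V -> R[i]) :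
  is_distribution u -> compact K -> csmooth_on setT Phi ->
  (forall x y, ~ K y -> Phi (x, y) = 0) ->
  csmooth_on setT (fun x => u (fun y => Phi (x, y))).
Proof.
move=> du cK sP PK; have [dr di] := rdist_parts du.
have tP x : test (fun y => Phi (x, y)).
  apply/testP; split; first exact: csmooth_vsec.
  by exists K => // y; exact: PK.
have /csmooth_onP[s1 s2] := sP.
have v1 : fiber_in K (cre Phi) by move=> x y Ky; rewrite /cre PK.
have v2 : fiber_in K (cim Phi) by move=> x y Ky; rewrite /cim PK.
apply/csmooth_onP; split.
- rewrite (_ : cre _ = fun x => repart u (fun y => cre Phi (x, y)) -
    impart u (fun y => cim Phi (x, y))).
    apply: smooth_onB; first exact: openT.
      exact: param_smooth dr cK s1 v1.
    exact: param_smooth di cK s2 v2.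
  by apply/funext => x; rewrite /cre (dist_re du (tP x)).1.
- rewrite (_ : cim _ = fun x => impart u (fun y => cre Phi (x, y)) +
    repart u (fun y => cim Phi (x, y))).
    apply: smoothD; first exact: param_smooth di cK s1 v1.
    exact: param_smooth dr cK s2 v2.
  by apply/funext => x; rewrite /cim (dist_re du (tP x)).2.
Qed.

Variable mu : {measure set (borel R m) -> \bar R}.
Hypothesis mu_fin : forall K : set V, compact K -> (mu K < +oo)%E.

Lemma cintE phi : cintegral mu phi = Complex (rint mu (cre phi)) (rint mu (cim phi)).
Proof. by []. Qed.

Lemma normc_le_sum (z : R[i]) : `|z| <= (`|complex.Re z| + `|complex.Im z|)%:C.
Proof.
rewrite normc_def lecR -[leRHS]ger0_norm ?addr_ge0// -sqrtr_sqr ler_wsqrtr//.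
rewrite sqrrD !real_normK ?num_real// lerD2r lerDl.
by rewrite mulrn_wge0// mulr_ge0.
Qed.

Lemma cint_distribution : is_distribution (cintegral mu).
Proof.
split=> [a phi psi tp tq|K cK].
  have rp := rtest_ccs (rtest_re tp); have ip := rtest_ccs (rtest_im tp).
  have rq := rtest_ccs (rtest_re tq); have iq := rtest_ccs (rtest_im tq).
  apply: complexP; rewrite ?reD ?imD ?reM ?imM !cintE /=.
  - have -> : cre (fun x => a * phi x + psi x) = fun x => - complex.Im a * cim phi x +
        (complex.Re a * cre phi x + cre psi x).
      by apply/funext => x; rewrite /cre /cim reD reM; ring.
    rewrite rint_lin//; last exact: ccs_lin.
    by rewrite rint_lin//; ring.
  - have -> : cim (fun x => a * phi x + psi x) = fun x => complex.Im a * cre phi x +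
        (complex.Re a * cim phi x + cim psi x).
      by apply/funext => x; rewrite /cre /cim imD imM; ring.
    rewrite rint_lin//; last exact: ccs_lin.
    by rewrite rint_lin//; ring.
exists 0%N, (fine (mu K) + fine (mu K)) => phi B tp sK HB.
have pK : cvanish K phi by move=> x Kx; apply: vanish_supp => /sK.
apply: le_trans (normc_le_sum _) _; rewrite lecR mulrDl cintE /= lerD//.
- apply: rint_bound => //.
  + by have [] := rtest_ccs (rtest_re tp).
  + by move=> x Kx; rewrite /cre pK.
  + by move=> x; have [] := HB [::] x isT.
- apply: rint_bound => //.
  + by have [] := rtest_ccs (rtest_im tp).
  + by move=> x Kx; rewrite /cim pK.
  + by move=> x; have [] := HB [::] x isT.
Qed.

Lemma csmooth_swap (Phi : V * V -> R[i]) : csmooth_on setT Phi ->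
  csmooth_on setT (fun p : V * V => Phi (p.2, p.1)).
Proof.
move=> /csmooth_onP[s1 s2]; apply/csmooth_onP.
by split; [exact: (smooth_swap s1)|exact: (smooth_swap s2)].
Qed.

Lemma cexchange u K (Phi : V * V -> R[i]) : is_distribution u -> compact K ->
  csmooth_on setT Phi -> (forall x y, ~ K x \/ ~ K y -> Phi (x, y) = 0) ->
  u (fun y => cintegral mu (fun x => Phi (x, y))) =
  cintegral mu (fun x => u (fun y => Phi (x, y))).
Proof.
move=> du cK sP PK; have [dr di] := rdist_parts du.
have /csmooth_onP[s1 s2] := sP.
have tP x : test (fun y => Phi (x, y)).
  apply/testP; split; first exact: csmooth_vsec.
  by exists K => // y Ky; apply: PK; right.
have tJ : test (fun y => cintegral mu (fun x => Phi (x, y))).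
  apply/testP; split.
    apply: (param_csmooth (Phi := fun p => Phi (p.2, p.1)) cint_distribution cK).
      exact: csmooth_swap.
    by move=> x y Ky; apply: PK; left.
  exists K => // y Ky; rewrite (_ : (fun x => _) = fun=> 0).
    exact: dist0 cint_distribution.
  by apply/funext => x; apply: PK; right.
have Phi1K x y : ~ K x \/ ~ K y -> cre Phi (x, y) = 0 by move=> /PK; rewrite /cre => ->.
have Phi2K x y : ~ K x \/ ~ K y -> cim Phi (x, y) = 0 by move=> /PK; rewrite /cim => ->.
have ccsP v : rdist ebasis v -> forall F : V * V -> R, smooth_on setT F ->
    (forall x y, ~ K x \/ ~ K y -> F (x, y) = 0) -> ccs (fun x => v (fun y => F (x, y))).
  move=> dv F sF FK; split.
    apply: smooth_continuous; apply: (param_smooth dv cK sF) => x y Ky.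
    by apply: FK; right.
  exists K => // x Kx; rewrite (_ : (fun y => _) = fun=> 0); first exact: rdist0 dv.
  by apply/funext => y; apply: FK; left.
have [E1 E2] := dist_re du tJ.
have X1 := exchange mu_fin dr cK s1 Phi1K; have X2 := exchange mu_fin dr cK s2 Phi2K.
have X3 := exchange mu_fin di cK s1 Phi1K; have X4 := exchange mu_fin di cK s2 Phi2K.
apply: complexP; rewrite ?E1 ?E2 cintE /=.
- rewrite [X in rint mu X](_ : _ = fun x =>
    (-1) * impart u (fun y => cim Phi (x, y)) + repart u (fun y => cre Phi (x, y))).
    rewrite rint_lin//; [|exact: ccsP|exact: ccsP].
    by rewrite mulN1r [RHS]addrC; congr (_ - _); [exact: X1|exact: X4].
  by apply/funext => x; rewrite /cre (dist_re du (tP x)).1 mulN1r addrC.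
- rewrite [X in rint mu X](_ : _ = fun x =>
    1 * impart u (fun y => cre Phi (x, y)) + repart u (fun y => cim Phi (x, y))).
    rewrite rint_lin//; [|exact: ccsP|exact: ccsP].
    by rewrite mul1r; congr (_ + _); [exact: X3|exact: X2].
  by apply/funext => x; rewrite /cim (dist_re du (tP x)).2 mul1r.
Qed.

End Distributions.

(** * Bump functions and uniqueness of densities *)

Section FlatExp.
Variable R : realType.

(* t = 1 / x turns x ^- n exp (- 1 / x) into t ^ n exp (- t); the family is
   closed under differentiation. *)
Definition flat (n : nat) (x : R) : R :=
  if 0 < x then x^-1 ^+ n * expR (- x^-1) else 0.

Lemma flat_ge0 n x : 0 <= flat n x.
Proof.
rewrite /flat; case: ifPn => // x0.
by rewrite mulr_ge0 ?expR_ge0// exprn_ge0// invr_ge0 ltW.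
Qed.

(** With t = 1 / x, [expR t] is the power n.+1 of [expR (t / n.+1%:R)], hence at least (t / n.+1) ^+
    n.+1. This beats t ^+ n by one factor t, which is where the factor x comes from. *)
Lemma flat_le n x : flat n x <= n.+1%:R ^+ n.+1 * `|x|.
Proof.
rewrite /flat; case: ifPn => x0; last by rewrite mulr_ge0// exprn_ge0.
rewrite gtr0_norm//; set t := x^-1; have t0 : 0 < t by rewrite invr_gt0.
have -> : x = t^-1 by rewrite invrK.
rewrite expRN ler_pdivrMr ?expR_gt0//.
have H : t / n.+1%:R <= expR (t / n.+1%:R).
  by apply: le_trans (expR_ge1Dx _); rewrite lerDr.
have : (t / n.+1%:R) ^+ n.+1 <= expR (t / n.+1%:R) ^+ n.+1.
  by rewrite lerXn2r// nnegrE ?expR_ge0// divr_ge0// ltW.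
rewrite -expRM_natl [_ * (t / _)]mulrC divfK ?pnatr_eq0//.
rewrite expr_div_n ler_pdivrMr ?exprn_gt0//.
rewrite exprS => H2; rewrite -(ler_pM2l t0) (le_trans H2)//.
rewrite mulrC; set E := expR t; set N := _ ^+ _.
by rewrite mulrA mulrCA mulfV ?gt_eqF// mulr1.
Qed.

Lemma flatS n x : x != 0 -> x^-1 * flat n x = flat n.+1 x.
Proof.
by move=> x0; rewrite /flat; case: ifPn; rewrite ?mulr0// exprS mulrA.
Qed.

Lemma flat_derive n (x : R) :
  is_derive x 1 (flat n) (flat n.+2 x - n%:R * flat n.+1 x).
Proof.
have [x0|x0|->] := ltgtP x 0.
- have -> : flat n.+2 x - n%:R * flat n.+1 x = 0.
    by rewrite /flat ltNge (ltW x0)/= mulr0 subr0.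
  apply: (near_eq_is_derive (f := fun=> 0)).
  near=> y; rewrite /flat ltNge (_ : y <= 0)//.
  by apply: ltW; near: y; exact: lt_nbhsl.
- have E : is_derive x 1 (fun y : R => y^-1 ^+ n * expR (- y^-1))
      (flat n.+2 x - n%:R * flat n.+1 x).
    have xn0 : x != 0 by rewrite gt_eqF.
    have dI : is_derive x 1 (fun y : R => y^-1) (- x ^- 2).
      apply: is_derive_eq (is_deriveV (f := id) xn0 (is_derive_id x 1)) _.
      by rewrite scaler1.
    have dN (t : R) : is_derive t 1 (fun t : R => expR (- t)) (- expR (- t)).
      apply: is_derive_eq (is_derive1_comp (is_derive_expR (- t)) (is_deriveNid t 1)) _.
      by rewrite mulrN1.
    have dH (t : R) : is_derive t 1 (fun t : R => t ^+ n * expR (- t))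
        (t ^+ n * - expR (- t) + expR (- t) * (n%:R * t ^+ n.-1)).
      have dX : is_derive t 1 (fun t : R => t ^+ n) (n%:R * t ^+ n.-1).
        split; first exact: exprn_derivable.
        by rewrite exp_derive scaler1.
      exact: (is_deriveM dX (dN t)).
    apply: is_derive_eq (is_derive1_comp (dH x^-1) dI) _.
    rewrite /flat x0 -[x ^- 2]exprVn; move: (x^-1) => i; move: (expR _) => E; case: (n) => [|k] /=.
      by rewrite !mul0r mulr0 addr0 subr0; ring.
    rewrite !exprS; ring.
  apply: near_eq_is_derive E.
  near=> y; rewrite /flat (_ : 0 < y)//.
  by near: y; exact: lt_nbhsr.
have -> : flat n.+2 0 - n%:R * flat n.+1 0 = 0.
  by rewrite /flat ltxx mulr0 subr0.
(* At 0 the difference quotient of [flat n] is [flat n.+1], which [flat_le] bounds by a multiple of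
   the norm of h. *)
have H : (fun h => h^-1 *: ((flat n \o shift 0) (h *: 1) - flat n 0)) @ 0^' --> (0 : R).
  apply/cvgrPdist_le => /= eps eps0.
  have C0 : 0 < n.+2%:R ^+ n.+2 :> R by rewrite exprn_gt0.
  near=> h.
  rewrite sub0r normrN addr0 [_%:A]mulr1 [flat n 0]/flat ltxx subr0.
  rewrite -[_ *: _]/(_ * _) flatS; last by near: h; exact: nbhs_dnbhs_neq.
  rewrite ger0_norm ?flat_ge0// (le_trans (flat_le _ _))//.
  rewrite -ler_pdivlMl// mulrC; near: h; apply: dnbhs0_le.
  by rewrite divr_gt0.
by split; [apply/cvg_ex; exists 0|exact: cvg_lim H].
Unshelve. all: by end_near. Qed.

Lemma flat_smooth n : smooth_on setT (flat n).
Proof.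
move=> k; elim: k n => [|k IH] n.
  apply/Ck_on0 => x _; apply: differentiable_continuous.
  by apply/derivable1_diffP; have [] := flat_derive n x.
have D (x v : R) : is_derive x v (flat n) (v *: (flat n.+2 x - n%:R * flat n.+1 x)).
  have [d E] := flat_derive n x; have df := (derivable1_diffP _ _).1 d.
  split; first exact: diff_derivable.
  by rewrite deriveE// deriv1E// derive1E E.
apply/Ck_onS; split => [x _|x v _|v].
- apply: differentiable_continuous.
  by apply/derivable1_diffP; have [] := flat_derive n x.
- by have [] := D x v.
- have -> : (fun x => 'D_v (flat n) x) =
      fun x => v *: (flat n.+2 x + (- n%:R) *: flat n.+1 x).
    apply/funext => x; have [_ ->] := D x v.
    by rewrite -[(- n%:R) *: _]/(_ * _) mulNr.
  apply: Ck_onZ; first exact: openT.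
  apply: Ck_onD; [exact: openT|exact: IH|].
  by apply: Ck_onZ; [exact: openT|exact: IH].
Qed.

Lemma flat_gt0 n x : 0 < x -> 0 < flat n x.
Proof.
by move=> x0; rewrite /flat x0 mulr_gt0 ?expR_gt0// exprn_gt0// invr_gt0.
Qed.

End FlatExp.

(** * Bump functions in coordinates *)

Section Bump.
Variables (R : realType) (m : nat).
Notation V := 'rV[R]_m.

Lemma smooth_prod (W : normedModType R) (I : Type) (r : seq I) (F : I -> W -> R) :
  (forall i, smooth_on setT (F i)) ->
  smooth_on setT (fun x => \prod_(i <- r) F i x).
Proof.
move=> HF; elim: r => [|i r IH].
  rewrite (_ : (fun x => _) = fun=> 1); first exact: smooth_cst.
  by apply/funext => x; rewrite big_nil.
rewrite (_ : (fun x => _) = fun x => F i x * \prod_(i <- r) F i x).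
  exact: smoothM.
by apply/funext => x; rewrite big_cons.
Qed.

Lemma smooth_coord_comp (f : R -> R) (i : 'I_m) (a c : R) : smooth_on setT f ->
  smooth_on setT (fun x : V => f (a * x 0 i + c)).
Proof.
move=> sf; apply: (smooth_affine (A := fun x : V => a * x 0 i + c)
  (L := fun x : V => a * x 0 i)) sf.
  by move=> x h v; rewrite !mxE -[h *: _]/(h * _); ring.
move=> x; apply: (continuous_comp (f := fun x : V => x 0 i)
  (g := fun t : R => a * t + c)); first exact: coord_continuous.
by apply: cvgD; [apply: cvgMr; exact: cvg_id|exact: cvg_cst].
Qed.

(** The norm of a row vector is the maximum of its coordinates, so a ball is a cube, and a product
    of one-variable bumps built from [flat 0] vanishes outside it. *)
Lemma bump (p : V) (r : R) : 0 < r -> exists b : V -> R,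
  [/\ smooth_on setT b, forall x, 0 <= b x, 0 < b p &
      forall x, r <= `|x - p| -> b x = 0].
Proof.
move=> r0.
pose F (i : 'I_m) (x : V) := flat 0 (1 * x 0 i + (r - p 0 i)) *
  flat 0 ((-1) * x 0 i + (r + p 0 i)).
exists (fun x => \prod_(i < m) F i x); split.
- by apply: smooth_prod => i; apply: smoothM;
    apply: smooth_coord_comp; exact: flat_smooth.
- by move=> x; apply: prodr_ge0 => i _; rewrite mulr_ge0 ?flat_ge0.
- apply: prodr_gt0 => i _; rewrite mulr_gt0// flat_gt0//; lra.
- move=> x; rewrite leNgt => /negP xr; apply/eqP; apply: contrapT => /negP.
  move=> /prodf_neq0 H; apply: xr.
  rewrite /Num.norm /= mx_normrE; apply/bigmax_ltP; split=> // -[j i] _ /=.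
  have := H i isT; rewrite /F mulf_eq0 negb_or => /andP[].
  rewrite /flat; case: ifPn; rewrite ?eqxx// => h1 _.
  case: ifPn; rewrite ?eqxx// => h2 _.
  by rewrite ord1 !mxE ltr_norml; apply/andP; split; lra.
Qed.

End Bump.

(** * A continuous density is determined by its integrals *)

Section RealDensity.
Variables (R : realType) (V : normedModType R).
Notation BV := (g_sigma_algebraType (@open V)).
Variable mu : {measure set BV -> \bar R}.
Hypothesis mu_fin : forall K : set V, compact K -> (mu K < +oo)%E.
Hypothesis mu_open : forall U : set V, open U -> U !=set0 -> (0 < mu U)%E.
Hypothesis V_ball : forall (p : V) r, compact [set x | `|x - p| <= r].
Hypothesis V_bump : forall (p : V) (r : R), 0 < r -> exists b : V -> R,
  [/\ smooth_on setT b, forall x, 0 <= b x, 0 < b p &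
      forall x, r <= `|x - p| -> b x = 0].

Lemma rint_le (f g : V -> R) : ccs f -> ccs g -> (forall x, f x <= g x) ->
  rint mu f <= rint mu g.
Proof.
move=> cf cg fg; apply: le_Rintegral => //.
- exact: ccs_integrable.
- exact: ccs_integrable.
Qed.

Lemma rint_gt0 (f : V -> R) (p : V) : ccs f -> (forall x, 0 <= f x) -> 0 < f p ->
  0 < rint mu f.
Proof.
move=> cf f0 fp; have [cf1 [K cK fK]] := cf.
have fp2 : 0 < f p / 2 by rewrite divr_gt0.
pose U : set V := f @^-1` [set t | f p / 2 < t].
have oU : open U.
  by apply: open_comp => [x _|]; [exact: cf1|exact: open_gt].
have Up : U p by rewrite /U /=; lra.
have UK : U `<=` K.
  by move=> x Ux; apply: contrapT => /fK fx0; move: Ux; rewrite /U /= fx0; lra.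
have mU : measurable (U : set BV) by exact: measurable_open.
have mK := measurable_compact cK.
have muU : (mu U < +oo)%E.
  by apply: le_lt_trans (mu_fin cK); apply: le_measure; rewrite ?inE.
have U0 : 0 < fine (mu U).
  by rewrite fine_gt0// muU andbT; apply: mu_open => //; exists p.
apply: (@lt_le_trans _ _ (Rintegral mu U (fun=> f p / 2))).
  by rewrite Rintegral_cst// mulr_gt0.
rewrite Rintegral_mkcond; apply: le_Rintegral => //.
- have -> : EFin \o (fun _ : BV => f p / 2) \_ U =
      (EFin \o (fun _ : BV => f p / 2)) \_ U.
    by apply/funext => x; rewrite /patch /=; case: ifPn.
  apply/(integrable_mkcond (EFin \o (fun _ : BV => f p / 2)) mU).
  apply: measurable_bounded_integrable => //.
  by exists `|f p / 2|; split=> [|M cM y _]; [exact: num_real|exact: ltW].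
- exact: ccs_integrable.
- move=> x _; rewrite /patch; case: ifPn => [|_]; last exact: f0.
  by rewrite inE => /ltW.
Qed.

(** Nothing is known of q outside U; there the product vanishes on a neighbourhood, because the
    compact set K is closed and contained in U. *)
Lemma ccs_mul_on (U K : set V) (q b : V -> R) : open U -> compact K -> K `<=` U ->
  (forall x, U x -> {for x, continuous q}) -> continuous b ->
  (forall x, ~ K x -> b x = 0) -> ccs (fun x => q x * b x).
Proof.
move=> oU cK KU cq cb bK; split; last by exists K => // x Kx; rewrite bK// mulr0.
move=> x; have [Ux|Ux] := pselect (U x); first by apply: cvgM; [exact: cq|exact: cb].
have oK : open (~` K).
  by apply: closed_openC; apply: compact_closed => //; exact: norm_hausdorff.
have Kx : (~` K) x by move=> /KU.
apply: (near_eq_continuous (f := fun=> 0)); last exact: cst_continuous.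
have : nbhs x (~` K) by exact: open_nbhs_nbhs.
by apply: filterS => y Ky; rewrite bK// mulr0.
Qed.

Lemma ball_bump (U : set V) (p : V) : open U -> U p ->
  exists (b : V -> R) (K : set V), [/\ rtest b, forall x, 0 <= b x, 0 < b p,
   compact K & K `<=` U /\ forall x, ~ K x -> b x = 0].
Proof.
move=> oU Up.
have /nbhs_ballP[r /= r0 rU] : nbhs p U by exact: open_nbhs_nbhs.
have r20 : 0 < r / 2 by rewrite divr_gt0.
have [b [sb b0 bp br]] := V_bump p r20.
have bK x : ~ [set x | `|x - p| <= r / 2] x -> b x = 0.
  by move=> Kx; apply: br; rewrite leNgt; apply/negP => /ltW.
exists b, [set x | `|x - p| <= r / 2]; split=> //.
  by split=> //; exists [set x | `|x - p| <= r / 2].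
split=> // x /= Kx; apply: rU; rewrite -ball_normE /= distrC (le_lt_trans Kx)//.
by rewrite ltr_pdivrMr// ltr_pMr// ltr1n.
Qed.

(** If q z were positive, a nonnegative bump supported where q is at least q z / 2 would have a
    positive integral against q. *)
Lemma density_le0 (U : set V) (q : V -> R) (z : V) : open U -> U z ->
  (forall x, U x -> {for x, continuous q}) ->
  (forall b K, rtest b -> compact K -> K `<=` U -> (forall x, ~ K x -> b x = 0) ->
     rint mu (fun x => q x * b x) = 0) -> q z <= 0.
Proof.
move=> oU Uz cq H; rewrite leNgt; apply/negP => qz.
have qz2 : 0 < q z / 2 by rewrite divr_gt0.
have [d d0 Hd] := continuous_dist (cq z Uz) qz2.
pose U' := U `&` ball z d.
have oU' : open U' by apply: openI => //; exact: ball_open.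
have Uz' : U' z by split => //; exact: ballxx.
have [b [K [tb b0 bz cK [KU bK]]]] := ball_bump oU' Uz'.
have KU1 : K `<=` U by move=> x /KU[].
have cb : continuous b := (rtest_ccs tb).1.
have c1 := ccs_mul_on oU cK KU1 cq cb bK.
have cst (c : R) : ccs (fun x => c * b x).
  apply: (ccs_mul_on (U := setT) (q := fun=> c) openT cK) => // x _.
  exact: cst_continuous.
have : rint mu (fun x => q z / 2 * b x) <= rint mu (fun x => q x * b x).
  apply: rint_le => // x; have [Kx|Kx] := pselect (K x); last by rewrite bK ?mulr0.
  apply: ler_wpM2r => //; have [_ zx] := KU x Kx.
  have := Hd x; rewrite -ball_normE /= distrC in zx => /(_ zx).
  by rewrite ler_norml => /andP[]; lra.
rewrite (H b K)// leNgt => /negP; apply; apply: (rint_gt0 (p := z)) => //.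
  by move=> x; rewrite mulr_ge0// ltW.
exact: mulr_gt0.
Qed.

Lemma density_eq0 (U : set V) (q : V -> R) (z : V) : open U -> U z ->
  (forall x, U x -> {for x, continuous q}) ->
  (forall b K, rtest b -> compact K -> K `<=` U -> (forall x, ~ K x -> b x = 0) ->
     rint mu (fun x => q x * b x) = 0) -> q z = 0.
Proof.
move=> oU Uz cq H; apply/eqP; rewrite eq_le; apply/andP; split.
  exact: (density_le0 oU Uz cq H).
rewrite -oppr_le0; apply: (density_le0 (q := fun x => - q x) oU Uz).
  by move=> x Ux; apply: cvgN; exact: cq.
move=> b K tb cK KU bK.
have c1 := ccs_mul_on oU cK KU cq (rtest_ccs tb).1 bK.
have c0 : ccs (fun _ : V => 0 : R) by apply: rtest_ccs; exact: rtest0.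
rewrite (_ : (fun x => _) = fun x => (-1) * (q x * b x) + 0).
  rewrite rint_lin// (H b K)// mulr0 add0r.
  (* Integration is a functional of order 0, so any family of directions will do; the empty one is
     taken. *)
  exact: rdist0 (rdist_rint mu_fin (fun i : 'I_0 => 0)).
by apply/funext => x; rewrite mulN1r addr0 mulNr.
Qed.

Lemma density_inj (U : set V) (z : V) : open U -> U z -> forall q1 q2 : V -> R,
  (forall x, U x -> {for x, continuous q1}) ->
  (forall x, U x -> {for x, continuous q2}) ->
  (forall b K, rtest b -> compact K -> K `<=` U ->
    (forall x, ~ K x -> b x = 0) ->
    rint mu (fun x => q1 x * b x) = rint mu (fun x => q2 x * b x)) ->
  q1 z = q2 z.
Proof.
move=> oU Uz q1 q2 c1 c2 Hq; apply/eqP; rewrite -subr_eq0; apply/eqP.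
apply: (density_eq0 (q := fun x => q1 x - q2 x) oU Uz).
  by move=> x Ux; apply: cvgB; [exact: c1|exact: c2].
move=> b K tb cK KU bK; have cb : continuous b := (rtest_ccs tb).1.
rewrite (_ : (fun x => _) = fun x => (-1) * (q2 x * b x) + q1 x * b x).
  rewrite rint_lin//; [|exact: ccs_mul_on c2 cb bK|exact: ccs_mul_on c1 cb bK].
  by rewrite (Hq b K)// mulN1r addNr.
by apply/funext => x; rewrite mulN1r mulrBl addrC.
Qed.

End RealDensity.

Lemma closed_cball (R : realType) (V : normedModType R) (p : V) (r : R) :
  closed [set x : V | `|x - p| <= r].
Proof.
rewrite (_ : [set x | _] = (fun x : V => `|x - p|) @^-1` [set t | t <= r])//.
apply: closed_comp => [x _|]; last exact: closed_le.
apply: (continuous_comp (f := fun x : V => x - p)); last exact: norm_continuous.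
by apply: cvgB; [exact: cvg_id|exact: cvg_cst].
Qed.

(** * Uniqueness of complex densities and evaluation at a point *)

Section Density.
Variables (R : realType) (m : nat).
Notation V := 'rV[R]_m.
Variable mu : {measure set (borel R m) -> \bar R}.
Hypothesis mu_fin : forall K : set V, compact K -> (mu K < +oo)%E.
Hypothesis mu_open : forall U : set V, open U -> U !=set0 -> (0 < mu U)%E.

Lemma rV_ball_compact (p : V) (r : R) : compact [set x : V | `|x - p| <= r].
Proof.
apply: bounded_closed_compact.
  exists (`|p| + r); split=> [|M HM x /= Kx]; first exact: num_real.
  apply: le_trans (ltW HM).
  by rewrite -[x in `|x|](subrK p) addrC (le_trans (ler_normD _ _))// lerD.
exact: closed_cball.
Qed.

Lemma density_unique (U : set V) (d1 d2 : V -> R[i]) (z : V) : open U -> U z ->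
  cCk_on 0 U d1 -> cCk_on 0 U d2 ->
  (forall psi, test psi -> supp psi `<=` U ->
     cintegral mu (fun x => d1 x * psi x) = cintegral mu (fun x => d2 x * psi x)) ->
  d1 z = d2 z.
Proof.
move=> oU Uz [/Ck_on0 r1 /Ck_on0 i1] [/Ck_on0 r2 /Ck_on0 i2] H.
(* Real-valued test functions suffice: they separate the real and imaginary parts of the two
   densities. *)
have key (b : V -> R) K : rtest b -> compact K -> K `<=` U ->
    (forall x, ~ K x -> b x = 0) ->
  rint mu (fun x => cre d1 x * b x) = rint mu (fun x => cre d2 x * b x) /\
  rint mu (fun x => cim d1 x * b x) = rint mu (fun x => cim d2 x * b x).
  move=> tb cK KU bK.
  have := H _ (test_real tb); rewrite !cintE.
  have -> : cre (fun x => d1 x * (b x)%:C) = fun x => cre d1 x * b x.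
    by apply/funext => x; rewrite /cre reM /= mulr0 subr0.
  have -> : cre (fun x => d2 x * (b x)%:C) = fun x => cre d2 x * b x.
    by apply/funext => x; rewrite /cre reM /= mulr0 subr0.
  have -> : cim (fun x => d1 x * (b x)%:C) = fun x => cim d1 x * b x.
    by apply/funext => x; rewrite /cim imM /= mulr0 add0r.
  have -> : cim (fun x => d2 x * (b x)%:C) = fun x => cim d2 x * b x.
    by apply/funext => x; rewrite /cim imM /= mulr0 add0r.
  have sb : supp (fun x => (b x)%:C) `<=` U.
    by apply: subset_trans KU; apply: supp_sub => // x Kx; rewrite bK.
  by move=> /(_ sb)[-> ->].
have main := density_inj mu_fin mu_open (@rV_ball_compact) (@bump R m) oU Uz.
apply: complexP.
- by apply: (main (cre d1) (cre d2) r1 r2) => // b K tb cK KU bK; have [] := key b K tb cK KU bK.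
- by apply: (main (cim d1) (cim d2) i1 i2) => // b K tb cK KU bK; have [] := key b K tb cK KU bK.
Qed.

Lemma open_punctured : open (@punctured R m).
Proof.
rewrite /punctured (_ : [set x | _] = ~` [set 0]).
  apply: closed_openC; apply: compact_closed; first exact: norm_hausdorff.
  exact: compact_set1.
by apply/seteqP; split=> x /= /eqP.
Qed.

(** Whichever density [xget] selects, it agrees with d off the origin by uniqueness on the punctured
    space. *)
Lemma eval_at_density u d z : smooth_density mu u d -> z != 0 ->
  eval_at mu z u = d z.
Proof.
move=> ud z0; rewrite /eval_at.
case: xgetP => [d' _ [sd' rd']|/(_ d)//].
have [sd rd] := ud.
apply: (density_unique open_punctured z0 (sd' 0%N) (sd 0%N)) => psi tp sp.
by rewrite -rd// -rd'.
Qed.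

End Density.

(** * Haar measure *)

Section Haar.
Variables (R : realType) (V : normedModType R).
Hypothesis fV : findim V.
Hypothesis V_ball : forall (p : V) r, compact [set x | `|x - p| <= r].
Hypothesis V_bump : forall (p : V) (r : R), 0 < r -> exists b : V -> R,
  [/\ smooth_on setT b, forall x, 0 <= b x, 0 < b p &
      forall x, r <= `|x - p| -> b x = 0].
Variable mul : V -> V -> V.
Hypothesis mulA : associative mul.
Hypothesis mul0x : left_id 0 mul.
Hypothesis mulNx : left_inverse 0 -%R mul.
Hypothesis smul : smooth_on setT (fun p : V * V => mul p.1 p.2).
Notation BV := (g_sigma_algebraType (@open V)).
Variable mu : {measure set BV -> \bar R}.
Hypothesis mu_fin : forall K : set V, compact K -> (mu K < +oo)%E.
Hypothesis mu_left : forall x (A : set BV), measurable A -> mu (mul x @` A) = mu A.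
Hypothesis mu_pos : (0 < mu setT)%E.

Lemma gmulxN x : mul x (- x) = 0.
Proof. by have := mulNx (- x); rewrite opprK. Qed.

Lemma gmulx0 x : mul x 0 = x.
Proof. by rewrite -(mulNx x) mulA gmulxN mul0x. Qed.

Lemma gmulKx x y : mul (- x) (mul x y) = y.
Proof. by rewrite mulA mulNx mul0x. Qed.

Lemma gmulNKx x y : mul x (mul (- x) y) = y.
Proof. by rewrite mulA gmulxN mul0x. Qed.

Lemma gmulxK x y : mul (mul x y) (- y) = x.
Proof. by rewrite -mulA gmulxN gmulx0. Qed.

Lemma gmulxNK x y : mul (mul x (- y)) y = x.
Proof. by rewrite -mulA mulNx gmulx0. Qed.

Lemma gmulN x y : - (mul x y) = mul (- y) (- x).
Proof.
rewrite -[RHS](gmulxK _ (mul x y)) mulA -[in RHS](mulA (- y)).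
by rewrite mulNx gmulx0 mulNx mul0x.
Qed.

Lemma smooth_mul_affine (W : normedModType R) (A L : W -> V * V) :
  (forall x h v, A (h *: v + x) = h *: L v + A x) -> continuous A ->
  smooth_on setT (fun x => mul (A x).1 (A x).2).
Proof.
move=> AL cA.
exact: (smooth_affine (f := fun p : V * V => mul p.1 p.2) AL cA smul).
Qed.

Lemma smooth_mull x : smooth_on setT (mul x).
Proof.
apply: (smooth_mul_affine (A := fun y => (x, y)) (@vsec_affine R V V x)) => y.
by apply: cvg_pair => //; exact: cvg_cst.
Qed.

Lemma smooth_mulr x : smooth_on setT (mul^~ x).
Proof.
apply: (smooth_mul_affine (A := fun y => (y, x)) (L := @hdir R V V)).
  by move=> y h v; apply: injective_projections; rewrite //= scaler0 add0r.
by move=> y; apply: cvg_pair => //; exact: cvg_cst.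
Qed.

Lemma smooth_opp : smooth_on setT (-%R : V -> V).
Proof.
apply: (smooth_affine (A := -%R) (L := -%R) (f := id)) => //.
- by move=> x h v; rewrite opprD scalerN.
- by move=> x; exact: oppr_continuous.
- by move=> n; apply: (Ck_on_linear (L := idfun)) => x; exact: cvg_id.
Qed.

Lemma compact_mul K L : compact K -> compact L ->
  compact ((fun p : V * V => mul p.1 p.2) @` (K `*` L)).
Proof.
move=> cK cL; apply: continuous_compact; last exact: compact_setX.
exact/continuous_subspaceT/smooth_continuous.
Qed.

Lemma compact_opp (K : set V) : compact K -> compact (-%R @` K).
Proof.
move=> cK; apply: continuous_compact => //.
by apply: continuous_subspaceT => x; exact: oppr_continuous.
Qed.

Lemma image_mull x (A : set V) : mul x @` A = mul (- x) @^-1` A.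
Proof.
apply/seteqP; split=> [_ [y Ay <-]|y Ay] /=; first by rewrite gmulKx.
by exists (mul (- x) y) => //; rewrite gmulNKx.
Qed.

Lemma open_mull x (O : set V) : open O -> open (mul x @^-1` O).
Proof.
by move=> oO; apply: open_comp => // y _; exact: smooth_continuous (smooth_mull x) y.
Qed.

(** If O were null, so would be its translates, then every compact set, being covered by finitely
    many of them, and then the whole space as a countable union of balls. *)
Lemma haar_open (O : set V) : open O -> O !=set0 -> (0 < mu O)%E.
Proof.
move=> oO [p Op]; rewrite lt0e measure_ge0 andbT; apply/eqP => O0.
have neg x : mu.-negligible (mul x @^-1` O : set BV).
  have -> : mul x @^-1` O = mul (- x) @` O by rewrite image_mull opprK.
  have mO : measurable (mul (- x) @` O : set BV).
    by rewrite image_mull; apply: measurable_open; exact: open_mull.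
  apply/negligibleP => //; apply: etrans O0; apply: mu_left.
  exact: measurable_open.
have negK K : compact K -> mu.-negligible (K : set BV).
  move=> cK; have := cK; rewrite compact_cover.
  (* The preimage is the translate of O by y * - p, which carries the point p of O to y. *)
  move=> /(_ V K (fun y => mul (- mul y (- p)) @^-1` O)).
  case=> [y Ky|y Ky|D DK KD]; first exact: open_mull.
    exists y => //=; rewrite gmulN opprK -mulA mulNx gmulx0//.
  apply: (@negligibleS _ _ _ mu
    (\big[setU/set0]_(y <- finmap.enum_fset D) (mul (- mul y (- p)) @^-1` O))).
    by move=> y /KD[x xD Oy]; rewrite -bigcup_seq; exists x.
  elim: (finmap.enum_fset D) => [|y r IH].
    by rewrite big_nil; exact: negligible_set0.
  by rewrite big_cons; apply: negligibleU.
have negT : mu.-negligible (setT : set BV).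
  apply: (@negligibleS _ _ _ mu (\bigcup_n [set x : V | `|x - 0| <= n%:R])).
    move=> x _; exists (Num.trunc `|x|).+1 => //=; rewrite subr0 ltW//.
    exact: truncnS_gt.
  by apply: negligible_bigcup => n; apply: negK.
have := mu_pos; rewrite ((negligibleP mu measurableT).1 negT) ltxx//.
Qed.

Lemma measurable_cont_fun (f : V -> V) : continuous f ->
  measurable_fun setT (f : BV -> BV).
Proof.
move=> /continuousP cf; apply: (@measurability _ _ BV BV setT f (@open V) erefl).
move=> _ [A oA <-]; rewrite setTI; apply: measurable_open; exact: cf.
Qed.

Lemma ccs_comp (f : V -> R) (th th' : V -> V) : continuous th -> continuous th' ->
  cancel th th' -> ccs f -> ccs (fun x => f (th x)).
Proof.
move=> ct ct' thK [cf [K cK fK]]; split.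
  by move=> x; apply: (continuous_comp (f := th)); [exact: ct|exact: cf].
exists (th' @` K).
  by apply: continuous_compact => //; exact: continuous_subspaceT.
by move=> x Kx; apply: fK => Ktx; apply: Kx; exists (th x).
Qed.

(** Invariance on Borel sets passes to integrals through the pushforward of mu under the
    translation. *)
Lemma rint_left (f : V -> R) x : ccs f -> rint mu (fun y => f (mul x y)) = rint mu f.
Proof.
move=> cf; have cx := smooth_continuous (smooth_mull x).
have cx' := smooth_continuous (smooth_mull (- x)).
have cfx : ccs (fun y => f (mul x y)) := ccs_comp cx cx' (gmulKx x) cf.
have mx := measurable_cont_fun cx.
rewrite /rint /Rintegral; congr fine.
transitivity (\int[pushforward mu (mul x : BV -> BV)]_(y in setT) (EFin \o f) y)%E.
  rewrite (integral_pushforward mx)//.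
  - exact: (measurable_int mu (ccs_integrable mu_fin cf)).
  - exact: (ccs_integrable mu_fin cfx).
apply: eq_measure_integral => A mA _.
rewrite -[LHS]/(mu (mul x @^-1` A)).
have -> : mul x @^-1` A = mul (- x) @` A by rewrite image_mull opprK.
exact: mu_left.
Qed.

Lemma rtest_comp (a : V -> R) (th th' : V -> V) : smooth_on setT th ->
  continuous th' -> cancel th th' -> rtest a -> rtest (fun x => a (th x)).
Proof.
move=> st ct' thK ta; have [_ H] := ccs_comp (smooth_continuous st) ct' thK (rtest_ccs ta).
by split=> //; apply: (smooth_comp fV ta.1 st).
Qed.

Lemma rtestM (a b : V -> R) : smooth_on setT a -> rtest b -> rtest (fun x => a x * b x).
Proof.
move=> sa [sb [K cK bK]]; split; first exact: smoothM.
by exists K => // x Kx; rewrite bK// mulr0.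
Qed.

Lemma rtest_mull (a : V -> R) x : rtest a -> rtest (fun y => a (mul x y)).
Proof.
apply: (rtest_comp (th' := mul (- x))) => //; first exact: smooth_mull.
  exact: smooth_continuous (smooth_mull _).
exact: gmulKx.
Qed.

Lemma rtest_mulr (a : V -> R) x : rtest a -> rtest (fun y => a (mul y x)).
Proof.
apply: (rtest_comp (th' := mul^~ (- x))) => //; first exact: smooth_mulr.
  exact: smooth_continuous (smooth_mulr _).
by move=> y; exact: gmulxK.
Qed.

Lemma rtest_opp (a : V -> R) : rtest a -> rtest (fun y => a (- y)).
Proof.
apply: (rtest_comp (th' := -%R)) => //; first exact: smooth_opp.
  by move=> x; exact: oppr_continuous.
exact: opprK.
Qed.

(** Over the empty family of directions, [rdist] means order 0: a bound by the supremum on each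
    compact set, which is all that the functionals of this section need. *)
Let e0 (i : 'I_0) : V := 0.

Lemma rintZ (c : R) (f : V -> R) : ccs f ->
  rint mu (fun x => c * f x) = c * rint mu f.
Proof.
move=> cf; have c0 : ccs (fun _ : V => 0 : R) by apply: rtest_ccs; exact: rtest0.
rewrite (_ : (fun x => _) = fun x => c * f x + 0).
  by rewrite rint_lin// (rdist0 (rdist_rint mu_fin e0)) addr0.
by apply/funext => x; rewrite addr0.
Qed.

Lemma rdist_homeo (th th' : V -> V) : continuous th -> continuous th' ->
  cancel th th' -> rdist e0 (fun a => rint mu (fun y => a (th y))).
Proof.
move=> ct ct' thK; split=> [c a b ta tb|K cK].
  have ca := ccs_comp ct ct' thK (rtest_ccs ta).
  have cb := ccs_comp ct ct' thK (rtest_ccs tb).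
  exact: (rint_lin mu_fin c ca cb).
have cK' : compact (th' @` K).
  by apply: continuous_compact => //; exact: continuous_subspaceT.
exists 0%N, (fine (mu (th' @` K))); split; first exact: fine_ge0.
move=> a B ta aK HB; have ca := ccs_comp ct ct' thK (rtest_ccs ta).
apply: (rint_bound mu_fin ca.1 cK') => x; last exact: (HB [::]).
by move=> Kx; apply: aK => Ktx; apply: Kx; exists (th x).
Qed.

Lemma smooth_pair_opp (a : V -> R) : smooth_on setT a ->
  smooth_on setT (fun p : V * V => a (mul p.2 (- p.1))).
Proof.
move=> sa; apply: (smooth_comp (G := fun p : V * V => mul p.2 (- p.1)) fV sa).
apply: (smooth_mul_affine (A := fun p : V * V => (p.2, - p.1))
  (L := fun p : V * V => (p.2, - p.1))).
  by move=> x h v /=; rewrite opprD -scalerN.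
move=> p; apply: cvg_pair; first exact: cvg_snd.
by apply: cvgN; exact: cvg_fst.
Qed.

Lemma smooth_pair_swap (a : V -> R) : smooth_on setT a ->
  smooth_on setT (fun p : V * V => a (mul p.2 p.1)).
Proof.
move=> sa; apply: (smooth_comp (G := fun p : V * V => mul p.2 p.1) fV sa).
apply: (smooth_mul_affine (A := fun p : V * V => (p.2, p.1))
  (L := fun p : V * V => (p.2, p.1))) => // p.
by apply: cvg_pair; [exact: cvg_snd|exact: cvg_fst].
Qed.

Lemma smooth_fst (a : V -> R) : smooth_on setT a ->
  smooth_on setT (fun p : V * V => a p.1).
Proof.
by apply: (smooth_affine (A := fst) (L := fst)) => // p; exact: cvg_fst.
Qed.

Lemma smooth_snd (a : V -> R) : smooth_on setT a ->
  smooth_on setT (fun p : V * V => a p.2).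
Proof.
by apply: (smooth_affine (A := snd) (L := snd)) => // p; exact: cvg_snd.
Qed.

(** * Uniqueness of the left Haar integral *)

Section Uniqueness.
Variables th th' : V -> V.
Hypotheses (ct : continuous th) (ct' : continuous th').
Hypotheses (thK : cancel th th') (thK' : cancel th' th).
Hypothesis th_left : forall x (f : V -> R), rtest f ->
  rint mu (fun y => f (mul x (th y))) = rint mu (fun y => f (th y)).

(* The functional a |-> rint (a \o th) is left invariant; rho is its image under
   inversion. *)
Let rho (a : V -> R) := rint mu (fun y => a (- th y)).

Lemma rdist_rho : rdist e0 rho.
Proof.
apply: (@rdist_homeo (fun y => - th y) (fun y => th' (- y))).
- by move=> x; apply: cvgN; exact: ct.
- move=> x; apply: (continuous_comp (f := -%R)); last exact: ct'.
  exact: oppr_continuous.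
- by move=> x; rewrite opprK.
Qed.

Lemma rho_right x (a : V -> R) : rtest a -> rho (fun y => a (mul y x)) = rho a.
Proof.
move=> ta; rewrite /rho -(th_left (- x) (rtest_opp ta)).
by congr rint; apply/funext => y; rewrite gmulN opprK.
Qed.

(** Both sides are the double integral of f (y x) g y. Left invariance of mu in x gives the left
    side; replacing y by y * - x, which right invariance of rho allows, gives the right side. The
    two orders of integration are related by [exchange]. *)
Lemma haar_convolve (f g : V -> R) : rtest f -> rtest g ->
  rint mu f * rho g = rho (fun y => f y * rint mu (fun x => g (mul y (- x)))).
Proof.
move=> tf tg; have [sf [Kf cKf fK]] := tf; have [sg [Kg cKg gK]] := tg.
(* Whether y is in Kg and y * x in Kf, or y is in Kf and y * - x in Kg, the point x is a product of
   the inverse of a point of Kg and a point of Kf. So L serves both exchanges. *)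
pose L := (fun p : V * V => mul p.1 p.2) @` ((-%R @` Kg) `*` Kf).
have cL : compact L by apply: compact_mul => //; exact: compact_opp.
pose K := L `|` (Kf `|` Kg).
have cK : compact K by apply: compactU => //; exact: compactU.
transitivity (rho (fun y => rint mu (fun x => f (mul y x) * g y))).
  have -> : (fun y => rint mu (fun x => f (mul y x) * g y)) =
      fun y => rint mu f * g y + 0.
    apply/funext => y; rewrite addr0 mulrC -(rint_left y (rtest_ccs tf)).
    rewrite -rintZ; last exact/rtest_ccs/rtest_mull.
    by congr rint; apply/funext => x; rewrite mulrC.
  have := rdist_rho.1 (rint mu f) g (fun=> 0) tg (@rtest0 R V).
  by rewrite (rdist0 rdist_rho) addr0 => ->.
rewrite (@exchange _ _ mu mu_fin _ _ _ (fun p => f (mul p.2 p.1) * g p.2) K rdist_rho)//.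
- transitivity (rint mu (fun x => rho (fun y => f y * g (mul y (- x))))).
    congr rint; apply/funext => x /=.
    have tfx : rtest (fun y => f y * g (mul y (- x))).
      by apply: rtestM => //; exact: rtest_mulr.
    rewrite -(rho_right x tfx); congr rho; apply/funext => y.
    by rewrite gmulxK.
  rewrite -(@exchange _ _ mu mu_fin _ _ _ (fun p => f p.2 * g (mul p.2 (- p.1))) K rdist_rho)//=.
  + congr rho; apply/funext => y; rewrite rintZ//.
    apply: rtest_ccs; apply: (@rtest_opp (fun x => g (mul y x))).
    exact: rtest_mull.
  + by apply: smoothM; [exact: smooth_snd|exact: smooth_pair_opp].
  + move=> x y H /=; have [fy|fy] := eqVneq (f y) 0; first by rewrite fy mul0r.
    have [gy|gy] := eqVneq (g (mul y (- x))) 0; first by rewrite gy mulr0.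
    have Ky : Kf y by apply: contrapT => /fK; apply/eqP.
    have Kxy : Kg (mul y (- x)) by apply: contrapT => /gK; apply/eqP.
    exfalso; case: H; apply; last by right; left.
    left; exists (- mul y (- x), y); first by split=> //=; exists (mul y (- x)).
    by rewrite /= gmulN opprK -mulA mulNx gmulx0.
- by apply: smoothM; [exact: smooth_pair_swap|exact: smooth_snd].
- move=> x y H /=; have [fy|fy] := eqVneq (f (mul y x)) 0; first by rewrite fy mul0r.
  have [gy|gy] := eqVneq (g y) 0; first by rewrite gy mulr0.
  have Kxy : Kf (mul y x) by apply: contrapT => /fK; apply/eqP.
  have Ky : Kg y by apply: contrapT => /gK; apply/eqP.
  exfalso; case: H; apply; last by right; right.
  left; exists (- y, mul y x); first by split=> //=; exists y.
  by rewrite /= gmulKx.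
Qed.

(* By [haar_convolve], y |-> rint (fun x => g (y * - x)) / rho g is the same
   function for every g; evaluate it at y = 0. *)
Lemma haar_cross (a b : V -> R) : rtest a -> rtest b ->
  rint mu a * rint mu (fun y => b (th y)) = rint mu b * rint mu (fun y => a (th y)).
Proof.
(* Composing with inversion makes [G g1 0] the integral of a and [rho g1] the integral of [a \o th];
   likewise for b. *)
move=> ta tb; pose g1 y := a (- y); pose g2 y := b (- y).
have tg1 : rtest g1 by exact: rtest_opp. have tg2 : rtest g2 by exact: rtest_opp.
(* The functions [G g] need not have compact support; eta cuts them off and, being positive at 0,
   preserves the information there. *)
have [eta [seta eta0 etap eta1]] := V_bump 0 ltr01.
pose Ke : set V := [set x | `|x - 0| <= 1].
have cKe : compact Ke by exact: V_ball.
have etaK x : ~ Ke x -> eta x = 0.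
  by move=> Kx; apply: eta1; rewrite leNgt; apply/negP => /ltW.
have teta : rtest eta by split=> //; exists Ke.
pose G g y := rint mu (fun x => g (mul y (- x))).
have sG (g : V -> R) : rtest g -> rtest (fun y => eta y * G g y).
  move=> tg; have [sg [Kg cKg gK]] := tg.
  pose L := (fun p : V * V => mul p.1 p.2) @` ((-%R @` Kg) `*` Ke).
  have cL : compact L by apply: compact_mul => //; exact: compact_opp.
  have -> : (fun y => eta y * G g y) =
      fun y => rint mu (fun x => eta y * g (mul y (- x))).
    apply/funext => y; rewrite rintZ//; apply: rtest_ccs.
    by apply: (@rtest_opp (fun x => g (mul y x))); exact: rtest_mull.
  split.
    apply: (param_smooth (Phi := fun p => eta p.1 * g (mul p.1 (- p.2)))
      (rdist_rint mu_fin e0) cL).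
      apply: smoothM; first exact: smooth_fst.
      exact: (smooth_swap (smooth_pair_opp sg)).
    move=> y x Lx /=; have [fy|fy] := eqVneq (eta y) 0; first by rewrite fy mul0r.
    have [gy|gy] := eqVneq (g (mul y (- x))) 0; first by rewrite gy mulr0.
    have Ky : Ke y by apply: contrapT => /etaK; apply/eqP.
    have Kxy : Kg (mul y (- x)) by apply: contrapT => /gK; apply/eqP.
    exfalso; apply: Lx.
    exists (- mul y (- x), y); first by split=> //=; exists (mul y (- x)).
    by rewrite /= gmulN opprK -mulA mulNx gmulx0.
  exists Ke => // y Ky; rewrite (_ : (fun x => _) = fun=> 0).
    exact: rdist0 (rdist_rint mu_fin e0).
  by apply/funext => x; rewrite etaK// mul0r.
(* By [haar_convolve], H integrates to 0 under rho against every test function. Its localization F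
   is itself available as a factor, whence rho of F squared vanishes, and so does H at 0. *)
pose H y := rho g2 * G g1 y - rho g1 * G g2 y.
pose F y := eta y * H y.
have tF : rtest F.
  rewrite (_ : F = fun y => (- rho g1) * (eta y * G g2 y) +
     (rho g2 * (eta y * G g1 y) + 0)).
    by apply: rtest_lin; [exact: sG|apply: rtest_lin; [exact: sG|exact: rtest0]].
  by apply/funext => y; rewrite /F /H; ring.
have tf : rtest (fun y => eta y * F y) by apply: rtestM.
(* [haar_convolve] with f = eta * F turns the two terms into opposite products of [rint mu f],
   [rho g1] and [rho g2]. *)
have F0 : rho (fun y => F y * F y) = 0.
  have -> : (fun y => F y * F y) = fun y =>
     (- rho g1) * ((eta y * F y) * G g2 y) + (rho g2 * ((eta y * F y) * G g1 y) + 0).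
    by apply/funext => y; rewrite /F /H; ring.
  have tfG g : rtest g -> rtest (fun y => eta y * F y * G g y).
    move=> tg; have -> : (fun y => eta y * F y * G g y) =
        (fun y => F y * (eta y * G g y)) by apply/funext => y; ring.
    by apply: rtestM; [exact: tF.1|exact: sG].
  have t0 := @rtest0 R V.
  rewrite rdist_rho.1; [|exact: tfG|by apply: rtest_lin => //; exact: tfG].
  rewrite rdist_rho.1//; last exact: tfG.
  rewrite (rdist0 rdist_rho) -!haar_convolve//; ring.
have H0 : H 0 = 0.
  have [->//|Hn] := eqVneq (H 0) 0; exfalso.
  have : 0 < rho (fun y => F y * F y).
    apply: (rint_gt0 (p := th' 0) mu_fin haar_open).
    - apply: (@ccs_comp (fun y => F y * F y) (fun y => - th y) (fun y => th' (- y))).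
      + by move=> x; apply: cvgN; exact: ct.
      + move=> x; apply: (continuous_comp (f := -%R)); last exact: ct'.
        exact: oppr_continuous.
      + by move=> x; rewrite opprK.
      + by apply: rtest_ccs; apply: rtestM => //; exact: tF.1.
    - by move=> x; rewrite -expr2 sqr_ge0.
    - by rewrite thK' oppr0 -expr2 exprn_even_gt0//= mulf_neq0// gt_eqF.
  by rewrite F0 ltxx.
move: H0; rewrite /H /G.
have E (c : V -> R) : (fun x => (fun y => c (- y)) (mul 0 (- x))) = c.
  by apply/funext => x; rewrite mul0x opprK.
rewrite !E /rho.
have E2 (c : V -> R) : (fun y => (fun y => c (- y)) (- th y)) = fun y => c (th y).
  by apply/funext => x; rewrite opprK.
rewrite !E2 => /eqP; rewrite subr_eq0 => /eqP E3.
by rewrite mulrC [RHS]mulrC; exact: E3.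
Qed.

Lemma haar_unique : exists2 c : R, 0 < c & forall a, rtest a ->
  rint mu (fun y => a (th y)) = c * rint mu a.
Proof.
have [b [sb b0 bp b1]] := V_bump 0 ltr01.
have tb : rtest b.
  split=> //; exists [set x | `|x - 0| <= 1]; first exact: V_ball.
  by move=> x Kx; apply: b1; rewrite leNgt; apply/negP => /ltW.
have Ib : 0 < rint mu b by apply: (rint_gt0 (p := 0) mu_fin haar_open) => //; exact: rtest_ccs.
have Jb : 0 < rint mu (fun y => b (th y)).
  apply: (rint_gt0 (p := th' 0) mu_fin haar_open); last by rewrite thK'.
    exact: ccs_comp ct ct' thK (rtest_ccs tb).
  by [].
exists (rint mu (fun y => b (th y)) / rint mu b); first by rewrite divr_gt0.
move=> a ta; apply: (mulfI (lt0r_neq0 Ib)).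
by rewrite -haar_cross// mulrA mulrCA divff ?gt_eqF// mulr1 mulrC.
Qed.

End Uniqueness.

(** For an automorphism, x * th y = th (th' x * y), so left invariance of mu makes the integral of
    [a \o th] left invariant as a functional of a, and uniqueness applies. *)
Lemma haar_auto (th th' : V -> V) : smooth_on setT th -> continuous th' ->
  cancel th th' -> cancel th' th -> {morph th : x y / mul x y >-> mul x y} ->
  exists2 c : R, 0 < c & forall a, rtest a ->
  rint mu (fun y => a (th y)) = c * rint mu a.
Proof.
move=> st ct' thK thK' thM; apply: (haar_unique _ ct') => //.
  exact: smooth_continuous.
move=> x f tf; rewrite -(rint_left (th' x) (f := fun y => f (th y))).
  by congr rint; apply/funext => y; rewrite thM thK'.
exact/rtest_ccs/rtest_comp.
Qed.

(** Right translations commute with left ones, so the translated integral is still left invariant.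
    As a function of p, the factor c is the modular function, up to convention. *)
Lemma haar_right_scale p : exists2 c : R, 0 < c & forall a, rtest a ->
  rint mu (fun y => a (mul y p)) = c * rint mu a.
Proof.
apply: (@haar_unique (mul^~ p) (mul^~ (- p))).
- exact: smooth_continuous (smooth_mulr _).
- exact: smooth_continuous (smooth_mulr _).
- by move=> y; exact: gmulxK.
- by move=> y; exact: gmulxNK.
- move=> x f tf; rewrite -(rint_left x (f := fun y => f (mul y p))).
    by congr rint; apply/funext => y; rewrite mulA.
  exact/rtest_ccs/rtest_mulr.
Qed.

(** * Unimodularity from a contracting automorphism *)

Section Contraction.
Variables D D' : V -> V.
Hypotheses (sD : smooth_on setT D) (cD' : continuous D').
Hypotheses (DK : cancel D D') (DK' : cancel D' D).
Hypothesis DM : {morph D : x y / mul x y >-> mul x y}.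
Hypothesis D_contract : forall p, (fun n => iter n D p) @ \oo --> (0 : V).

(* The modular function is D-invariant and continuous at 0, hence trivial. *)
Lemma rint_right p (a : V -> R) : rtest a ->
  rint mu (fun y => a (mul y p)) = rint mu a.
Proof.
have [b [sb b0 bp b1]] := V_bump 0 ltr01.
pose Ke : set V := [set x | `|x - 0| <= 1].
have cKe : compact Ke by exact: V_ball.
have bK x : ~ Ke x -> b x = 0.
  by move=> Kx; apply: b1; rewrite leNgt; apply/negP => /ltW.
have tb : rtest b by split=> //; exists Ke.
have Ib : 0 < rint mu b by apply: (rint_gt0 (p := 0) mu_fin haar_open) => //; exact: rtest_ccs.
pose Delta q := rint mu (fun y => b (mul y q)) / rint mu b.
have DeltaE q c : rtest c -> rint mu (fun y => c (mul y q)) = Delta q * rint mu c.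
  move=> tc; have [k k0 Hk] := haar_right_scale q.
  by rewrite /Delta !Hk// mulfK ?gt_eqF.
(* In b (D y * D q) = (b \o D) (y * q), the factor k by which D scales the integral appears on both
   sides and cancels. *)
have DeltaD q : Delta (D q) = Delta q.
  have [k k0 Hk] := haar_auto sD cD' DK DK' DM.
  have tbD : rtest (fun y => b (D y)) by exact: (rtest_comp sD cD' DK).
  have := Hk _ (rtest_mulr (D q) tb).
  have -> : (fun y => b (mul (D y) (D q))) = fun y => (fun y => b (D y)) (mul y q).
    by apply/funext => y; rewrite DM.
  rewrite (DeltaE q (fun y => b (D y)))// Hk// mulrCA => /(mulfI (lt0r_neq0 k0)) E.
  by rewrite [Delta (D q)]/Delta -E mulfK// gt_eqF.
have DeltaI q n : Delta (iter n D q) = Delta q.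
  by elim: n => //= n IH; rewrite DeltaD.
pose L := (fun p : V * V => mul p.1 p.2) @` (Ke `*` (-%R @` Ke)).
have cL : compact L by apply: compact_mul => //; exact: compact_opp.
(* The factor b q confines the integrand to y in a fixed compact set, so that continuity of
   parameter integrals applies; since b 0 is positive it can be divided out in the limit. *)
pose Psi q := rint mu (fun y => b q * b (mul y q)).
have PsiE q : Psi q = b q * (Delta q * rint mu b).
  by rewrite /Psi rintZ ?DeltaE//; exact/rtest_ccs/rtest_mulr.
have cPsi : continuous Psi.
  apply: (param_continuous (Phi := fun p => b p.1 * b (mul p.2 p.1))
    (rdist_rint mu_fin e0) cL).
    by apply: smoothM; [exact: smooth_fst|exact: smooth_pair_swap].
  move=> q y Ly /=; have [fy|fy] := eqVneq (b q) 0; first by rewrite fy mul0r.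
  have [gy|gy] := eqVneq (b (mul y q)) 0; first by rewrite gy mulr0.
  have Ky : Ke q by apply: contrapT => /bK; apply/eqP.
  have Kxy : Ke (mul y q) by apply: contrapT => /bK; apply/eqP.
  exfalso; apply: Ly; exists (mul y q, - q); last by rewrite /= gmulxK.
  by split=> //=; exists q.
have Delta0 : Delta 0 = 1.
  rewrite /Delta (_ : (fun y => _) = b) ?divff ?gt_eqF//.
  by apply/funext => y; rewrite gmulx0.
have Delta1 q : Delta q = 1.
  have l1 : (fun n => Psi (iter n D q)) @ \oo --> Psi 0.
    by apply: continuous_cvg; [exact: cPsi|exact: D_contract].
  have l2 : (fun n => Psi (iter n D q)) @ \oo --> b 0 * (Delta q * rint mu b).
    rewrite (_ : (fun n => _) = fun n => b (iter n D q) * (Delta q * rint mu b)).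
      apply: cvgMl; apply: continuous_cvg; last exact: D_contract.
      exact: smooth_continuous sb 0.
    by apply/funext => n; rewrite PsiE DeltaI.
  have := cvg_unique (@norm_hausdorff _ _) l2 l1; rewrite PsiE Delta0 => E.
  apply: (mulIf (lt0r_neq0 Ib)); apply: (mulfI (lt0r_neq0 bp)); exact: E.
by move=> ta; rewrite DeltaE// Delta1 mul1r.
Qed.

(** Right invariance makes the integral of a (- y) left invariant as a functional of a, so it is c
    times the integral of a. The symmetric function b x * b (- x), whose integral is positive,
    forces c = 1. *)
Lemma rint_opp (a : V -> R) : rtest a -> rint mu (fun y => a (- y)) = rint mu a.
Proof.
have co : continuous (-%R : V -> V) by move=> x; exact: oppr_continuous.
have left x (f : V -> R) : rtest f ->
    rint mu (fun y => f (mul x (- y))) = rint mu (fun y => f (- y)).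
  move=> tf; rewrite -(rint_right (- x) (rtest_opp tf)).
  by congr rint; apply/funext => y; rewrite gmulN opprK.
have [c c0 Hc] := haar_unique co co (@opprK V) (@opprK V) left.
have [b [sb b0 bp b1]] := V_bump 0 ltr01.
have tb : rtest b.
  split=> //; exists [set x | `|x - 0| <= 1]; first exact: V_ball.
  by move=> x Kx; apply: b1; rewrite leNgt; apply/negP => /ltW.
have tbb : rtest (fun x => b x * b (- x)) by apply: rtestM => //; exact: rtest_opp.
have Ib : 0 < rint mu (fun x => b x * b (- x)).
  apply: (rint_gt0 (p := 0) mu_fin haar_open); first exact: rtest_ccs.
    by move=> x; rewrite mulr_ge0.
  by rewrite oppr0 mulr_gt0.
have := Hc _ tbb; rewrite (_ : (fun y => _) = fun x => b x * b (- x)); last first.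
  by apply/funext => y; rewrite opprK mulrC.
rewrite -[LHS]mul1r => /(mulIf (lt0r_neq0 Ib)) c1 ta.
by rewrite Hc// -c1 mul1r.
Qed.

End Contraction.

End Haar.

Lemma linear_continuous_findim (R : realType) (V W : normedModType R)
    (L : {linear V -> W}) : findim V -> continuous L.
Proof.
move=> [k [e [c [cc ce]]]] x.
have LE y : L y = \sum_i c i y *: L (e i).
  by rewrite {1}[y]ce linear_sum; apply: eq_bigr => i _; rewrite linearZ_LR.
rewrite (_ : (L : V -> W) = fun y => \sum_i c i y *: L (e i)); last exact/funext.
apply: cvg_big => [|i _]; first exact: add_continuous.
by apply: cvgZr_tmp; exact: cc.
Qed.

Lemma sum_norm_continuous (R : realType) (V W : normedModType R) (I : finType)
    (F : I -> V -> W) : (forall i, continuous (F i)) ->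
  continuous (fun x => \sum_i `|F i x|).
Proof.
move=> cF x; apply: cvg_sumr => i.
by apply: (continuous_comp (f := F i)); [exact: cF|exact: norm_continuous].
Qed.

(** * Dilations *)

Section Dilations.
Variables (R : realType) (m : nat) (G : homogeneousGroup R m).
Notation V := 'rV[R]_m.
Notation mul := (hg_mul G).
Notation r := (hg_step G).
Notation S := (\sum_(j < r) hg_layer G j.+1)%VS.

Let pi (i : 'I_r) : V -> V := sumv_pi S i.

Lemma dilE t X : dil G t X = \sum_(i < r) t ^+ i.+1 *: pi i X.
Proof. by []. Qed.

Lemma pi_sum X : \sum_(i < r) pi i X = X.
Proof. by apply: (sumv_pi_sum (erefl S)); rewrite (hg_full G) memvf. Qed.

Lemma pi_uniq (v : 'I_r -> V) i : (forall j, v j \in hg_layer G j.+1) ->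
  pi i (\sum_(j < r) v j) = v i.
Proof.
move=> Hv; have := directv_sum_unique (hg_direct G).
move=> /(_ (fun j => pi j (\sum_(j < r) v j)) v) H.
have := H (fun j _ => memv_sum_pi _ _ _) (fun j _ => Hv j).
by rewrite pi_sum eqxx => /esym/forallP/(_ i)/eqP.
Qed.

Lemma dil_comp s t X : dil G s (dil G t X) = dil G (s * t) X.
Proof.
rewrite !dilE; apply: eq_bigr => i _.
rewrite (pi_uniq (v := fun j => t ^+ j.+1 *: pi j X)).
  by rewrite scalerA exprMn.
by move=> j; apply: memvZ; exact: memv_sum_pi.
Qed.

Lemma dil1 X : dil G 1 X = X.
Proof.
by rewrite dilE -[RHS]pi_sum; apply: eq_bigr => i _; rewrite expr1n scale1r.
Qed.

Lemma dilK t : t != 0 -> cancel (dil G t) (dil G t^-1).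
Proof. by move=> t0 X; rewrite dil_comp mulVf// dil1. Qed.

Lemma dilVK t : t != 0 -> cancel (dil G t^-1) (dil G t).
Proof. by move=> t0 X; rewrite dil_comp mulfV// dil1. Qed.

Lemma dil_linear t : linear (dil G t).
Proof.
move=> a X Y; rewrite !dilE scaler_sumr -big_split; apply: eq_bigr => i _ /=.
by rewrite /pi linearP scalerDr !scalerA (mulrC a).
Qed.

Lemma dil0 t : dil G t 0 = 0.
Proof.
have := dil_linear t (-1) 0 0.
by rewrite scaler0 addr0 scaleN1r addNr.
Qed.

Lemma dil_smooth t : smooth_on setT (dil G t).
Proof.
pose L : {linear V -> V} :=
  HB.pack (dil G t) (GRing.isLinear.Build _ _ _ _ _ (dil_linear t)).
move=> n; apply: (Ck_on_linear (L := L)).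
exact/linear_continuous_findim/findim_rV.
Qed.

Lemma dil_continuous t : continuous (dil G t : V -> V).
Proof. exact: smooth_continuous (dil_smooth t). Qed.

Lemma dilM t : 0 < t -> {morph dil G t : x y / mul x y >-> mul x y}.
Proof. by move=> t0 x y; exact: hg_dil_mul. Qed.

Lemma pi_continuous i : continuous (pi i).
Proof.
pose L : {linear V -> V} := sumv_pi S i.
exact: (linear_continuous_findim (L := L) (findim_rV R m)).
Qed.

(** This is not a homogeneous norm. It serves the linear bound [dil_le], in which every power t ^+
    i.+1 with t at most 1 is estimated by t. *)
Definition layer_norm X : R := \sum_(i < r) `|pi i X|.

Lemma layer_norm_ge0 X : 0 <= layer_norm X.
Proof. by apply: sumr_ge0. Qed.

Lemma layer_norm_continuous : continuous layer_norm.
Proof.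
exact: (sum_norm_continuous pi_continuous).
Qed.

Lemma dil_le t X : 0 <= t <= 1 -> `|dil G t X| <= t * layer_norm X.
Proof.
move=> /andP[t0 t1]; rewrite dilE mulr_sumr.
apply: le_trans (ler_norm_sum _ _ _) _; apply: ler_sum => i _.
rewrite normrZ ler_wpM2r// ger0_norm ?exprn_ge0// exprS ler_piMr//.
exact: exprn_ile1.
Qed.

(** A sequence of parameters is enough to detect a leading term and is what dominated convergence
    handles; as powers of one half, its dilations are also the iterates of a single contraction, the
    form used for unimodularity. *)
Definition dyadic (n : nat) : R := 2^-1 ^+ n.

Lemma dyadic_gt0 n : 0 < dyadic n.
Proof. by rewrite exprn_gt0// invr_gt0. Qed.

Lemma dyadic_le1 n : 0 <= dyadic n <= 1.
Proof.
by rewrite ltW ?dyadic_gt0//= exprn_ile1 ?invr_ge0// invf_le1// ler1n.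
Qed.

Lemma dyadic_cvg0 : dyadic @ \oo --> (0 : R).
Proof. by apply: cvg_expr; rewrite gtr0_norm ?invr_gt0// invf_lt1// ltr1n. Qed.

Lemma dil_dyadic_cvg0 X : (fun n => dil G (dyadic n) X) @ \oo --> (0 : V).
Proof.
apply/cvgr0Pnorm_le => e e0.
have l0 : (fun n => dyadic n * layer_norm X) @ \oo --> (0 : R).
  by rewrite -[X in _ --> X](mul0r (layer_norm X)); apply: cvgMl; exact: dyadic_cvg0.
move/cvgr0Pnorm_le: l0 => /(_ e e0); apply: filterS => n.
rewrite ger0_norm; last by rewrite mulr_ge0 ?layer_norm_ge0// ltW ?dyadic_gt0.
by apply: le_trans; apply: dil_le; exact: dyadic_le1.
Qed.

Lemma iter_dil n X : iter n (dil G 2^-1) X = dil G (dyadic n) X.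
Proof.
by elim: n => [|n IH]; rewrite ?dil1//= IH dil_comp -exprS.
Qed.

End Dilations.

(** * Haar integrals on a homogeneous group *)

Section HaarGroup.
Variables (R : realType) (m : nat) (G : homogeneousGroup R m).
Notation V := 'rV[R]_m.
Notation mul := (hg_mul G).
Variable mu : {measure set (borel R m) -> \bar R}.
Hypothesis mu_haar : is_haar G mu.
Notation I := (cintegral mu).

Let mulA := hg_mulA G.
Let mul0x := hg_mul0x G.
Let mulNx := hg_mulNx G.
Let smul := hg_smooth G.
Let fV := findim_rV R m.

Lemma haar_fin (K : set V) : compact K -> (mu K < +oo)%E.
Proof. by have [_ H _] := mu_haar; exact: H. Qed.

Let mu_left x (A : set (borel R m)) : measurable A -> mu (mul x @` A) = mu A.
Proof. by have [H _ _] := mu_haar; exact: H. Qed.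

Let mu_pos : (0 < mu setT)%E.
Proof. by have [_ _ H] := mu_haar. Qed.

Lemma haar_open_gt0 (U : set V) : open U -> U !=set0 -> (0 < mu U)%E.
Proof.
exact: (haar_open (@rV_ball_compact R m) mulA mul0x mulNx smul mu_left mu_pos).
Qed.

Lemma hg_mulKx x y : mul (- x) (mul x y) = y.
Proof. exact: gmulKx mulA mul0x mulNx x y. Qed.
Lemma hg_mulxK x y : mul (mul x y) (- y) = x.
Proof. exact: gmulxK mulA mul0x mulNx x y. Qed.
Lemma hg_mulxNK x y : mul (mul x (- y)) y = x.
Proof. exact: gmulxNK mulA mul0x mulNx x y. Qed.
Lemma hg_mulN x y : - (mul x y) = mul (- y) (- x).
Proof. exact: gmulN mulA mul0x mulNx x y. Qed.

Lemma cint_left x (phi : V -> R[i]) : test phi ->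
  I (fun y => phi (mul x y)) = I phi.
Proof.
move=> tp; rewrite !cintE; congr Complex.
- exact: (rint_left mulA mul0x mulNx smul haar_fin mu_left x (rtest_ccs (rtest_re tp))).
- exact: (rint_left mulA mul0x mulNx smul haar_fin mu_left x (rtest_ccs (rtest_im tp))).
Qed.

Let half_gt0 : 0 < (2^-1 : R). Proof. by rewrite invr_gt0. Qed.

Let contract p : (fun n => iter n (dil G 2^-1) p) @ \oo --> (0 : V).
Proof.
rewrite (_ : (fun n => _) = fun n => dil G (dyadic R n) p); first exact: dil_dyadic_cvg0.
by apply/funext => n; exact: iter_dil.
Qed.

Lemma cint_right x (phi : V -> R[i]) : test phi ->
  I (fun y => phi (mul y x)) = I phi.
Proof.
have h0 := lt0r_neq0 half_gt0.
have H := rint_right fV (@rV_ball_compact R m) (@bump R m) mulA mul0x mulNx smul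
  haar_fin mu_left mu_pos (dil_smooth G (2^-1 : R))
  (@dil_continuous R m G (2^-1)^-1) (dilK G h0)
  (dilVK G h0) (dilM G half_gt0) contract x.
move=> tp; rewrite !cintE; congr Complex.
- by apply: H; exact: rtest_re.
- by apply: H; exact: rtest_im.
Qed.

Lemma cint_opp (phi : V -> R[i]) : test phi -> I (fun y => phi (- y)) = I phi.
Proof.
have h0 := lt0r_neq0 half_gt0.
have H := rint_opp fV (@rV_ball_compact R m) (@bump R m) mulA mul0x mulNx smul
  haar_fin mu_left mu_pos (dil_smooth G (2^-1 : R))
  (@dil_continuous R m G (2^-1)^-1) (dilK G h0)
  (dilVK G h0) (dilM G half_gt0) contract.
move=> tp; rewrite !cintE; congr Complex.
- by apply: H; exact: rtest_re.
- by apply: H; exact: rtest_im.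
Qed.

Lemma rint_dil (t : R) : 0 < t -> exists2 c : R, 0 < c & forall a, rtest a ->
  rint mu (fun y => a (dil G t y)) = c * rint mu a.
Proof.
move=> t0; have tn0 := lt0r_neq0 t0.
exact: (haar_auto fV (@rV_ball_compact R m) (@bump R m) mulA mul0x mulNx smul
  haar_fin mu_left mu_pos (dil_smooth G t) (@dil_continuous R m G t^-1)
  (dilK G tn0) (dilVK G tn0) (dilM G t0)).
Qed.

End HaarGroup.

(** * Convolutions away from the singularity *)

Section Tests.
Variables (R : realType) (m : nat).
Notation V := 'rV[R]_m.
Implicit Types (phi psi a b : V -> R[i]).

Lemma testM a b : csmooth_on setT a -> test b -> test (fun x => a x * b x).
Proof.
move=> sa /testP[sb [K cK bK]]; apply/testP; split.
  by apply: csmooth_onM => //; exact: openT.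
by exists K => // x Kx; rewrite bK// mulr0.
Qed.

Lemma testZ (c : R[i]) a : test a -> test (fun x => c * a x).
Proof. by apply: testM; exact: csmooth_on_cst. Qed.

Lemma testD a b : test a -> test b -> test (fun x => a x + b x).
Proof.
move=> /testP[sa [K cK aK]] /testP[sb [L cL bL]]; apply/testP; split.
  by apply: csmooth_onD => //; exact: openT.
exists (K `|` L); first exact: compactU.
by move=> x KLx; rewrite aK ?bL ?addr0// => ?; apply: KLx; [right|left].
Qed.

Lemma testB a b : test a -> test b -> test (fun x => a x - b x).
Proof.
move=> ta tb; rewrite (_ : (fun x => _) = fun x => a x + (-1) * b x).
  by apply: testD => //; exact: testZ.
by apply/funext => x; rewrite mulN1r.
Qed.

Lemma test_comp phi (th th' : V -> V) : smooth_on setT th -> continuous th' ->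
  cancel th th' -> test phi -> test (fun x => phi (th x)).
Proof.
move=> st ct' thK /testP[sp [K cK pK]]; apply/testP; split.
  exact: (csmooth_comp (findim_rV R m) sp st).
exists (th' @` K).
  by apply: continuous_compact => //; exact: continuous_subspaceT.
by move=> x Kx; apply: pK => Ktx; apply: Kx; exists (th x).
Qed.

Definition zero_near0 (c : V -> R[i]) := \forall x \near (0 : V), c x = 0.

Lemma zero_near0_supp c X : zero_near0 c ->
  supp (fun x => c x * X x) `<=` @punctured R m.
Proof.
move=> c0 x sx; apply/eqP => x0; rewrite x0 in sx.
have [y [/eqP cy cy0]] := sx _ c0; apply: cy.
by rewrite cy0 mul0r.
Qed.

(** The density d is uncontrolled at 0, but c vanishes on a neighbourhood of 0; elsewhere both
    factors are smooth. *)
Lemma test_mul_density (d c : V -> R[i]) : csmooth_on (@punctured R m) d ->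
  test c -> zero_near0 c -> test (fun x => c x * d x).
Proof.
move=> sd /testP[sc [K cK Kc]] c0; apply/testP; split; last first.
  by exists K => // x Kx; rewrite Kc// mul0r.
apply: csmooth_on_cover => x _; have [->|x0] := eqVneq x 0.
  move: (c0 : nbhs (0 : V) [set y | c y = 0]); rewrite nbhsE => -[U [oU U0] Uc].
  exists U; split=> //; apply: (csmooth_on_eq (f := fun=> 0) oU); last exact: csmooth_on_cst.
  by move=> y /Uc /= ->; rewrite mul0r.
exists (@punctured R m); split; [exact: open_punctured|exact: x0|].
apply: csmooth_onM; [exact: open_punctured| |exact: sd].
exact: csmooth_on_sub sc.
Qed.

Lemma density_mul (mu : {measure set (borel R m) -> \bar R})
    (u : functional R m) (d c X : V -> R[i]) : smooth_density mu u d ->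
  test c -> zero_near0 c -> csmooth_on setT X ->
  u (fun x => c x * X x) = cintegral mu (fun x => c x * d x * X x).
Proof.
move=> [sd rd] tc c0 sX; rewrite rd.
- by congr cintegral; apply/funext => x; rewrite mulrCA mulrA.
- rewrite (_ : (fun x => _) = fun x => X x * c x); first exact: testM.
  by apply/funext => x; rewrite mulrC.
- exact: zero_near0_supp.
Qed.

End Tests.

(** * Convolution of a distribution with a test function *)

Section Convolution.
Variables (R : realType) (m : nat) (G : homogeneousGroup R m).
Notation V := 'rV[R]_m.
Notation mul := (hg_mul G).
Variable mu : {measure set (borel R m) -> \bar R}.
Hypothesis mu_haar : is_haar G mu.
Notation I := (cintegral mu).
Implicit Types (phi psi a b c p q : V -> R[i]) (f g : functional R m).

Let mu_fin := haar_fin mu_haar.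
Let dI := cint_distribution mu_fin.

Lemma csmooth_mul_affine (W : normedModType R) (A L : W -> V * V) phi :
  (forall x h v, A (h *: v + x) = h *: L v + A x) -> continuous A ->
  csmooth_on setT phi -> csmooth_on setT (fun w => phi (mul (A w).1 (A w).2)).
Proof.
move=> AL cA sp.
apply: (csmooth_comp (G := fun w => mul (A w).1 (A w).2) (findim_rV R m) sp).
exact (@smooth_mul_affine R _ mul (hg_smooth G) W A L AL cA).
Qed.

Lemma csmooth_mul phi : csmooth_on setT phi ->
  csmooth_on setT (fun p : V * V => phi (mul p.1 p.2)).
Proof. by apply: (csmooth_mul_affine (A := id) (L := id)) => // x; exact: cvg_id. Qed.

Lemma csmooth_mulxN phi : csmooth_on setT phi ->
  csmooth_on setT (fun p : V * V => phi (mul p.1 (- p.2))).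
Proof.
apply: (csmooth_mul_affine (A := fun p : V * V => (p.1, - p.2))
  (L := fun p : V * V => (p.1, - p.2))).
  by move=> x h v /=; rewrite opprD -scalerN.
move=> x; apply: (@cvg_pair _ _ _ _ (nbhs x.1) (nbhs (- x.2))); first exact: cvg_fst.
by apply: cvgN; exact: cvg_snd.
Qed.

Lemma csmooth_mulNx phi : csmooth_on setT phi ->
  csmooth_on setT (fun p : V * V => phi (mul (- p.2) p.1)).
Proof.
apply: (csmooth_mul_affine (A := fun p : V * V => (- p.2, p.1))
  (L := fun p : V * V => (- p.2, p.1))).
  by move=> x h v /=; rewrite opprD -scalerN.
move=> x; apply: (@cvg_pair _ _ _ _ (nbhs (- x.2)) (nbhs x.1)); last exact: cvg_fst.
by apply: cvgN; exact: cvg_snd.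
Qed.

Lemma csmooth_mull phi x : csmooth_on setT phi ->
  csmooth_on setT (fun y => phi (mul x y)).
Proof. by move=> /csmooth_mul/(csmooth_vsec x). Qed.

(* convr f p b and convl g q a are the functions (p f) * b and a * (q g). *)
Definition convr f p b : V -> R[i] := fun y => f (fun x => p x * b (mul (- x) y)).
Definition convl g q a : V -> R[i] := fun x => g (fun y => q y * a (mul x (- y))).

Lemma convr_smooth f p b : is_distribution f -> test p -> csmooth_on setT b ->
  csmooth_on setT (convr f p b).
Proof.
move=> df /testP[sp [K cK pK]] sb.
apply: (param_csmooth (Phi := fun w : V * V => p w.2 * b (mul (- w.2) w.1)) df cK).
  apply: csmooth_onM; first exact: openT.
    exact: (csmooth_snd _ sp).
  exact: csmooth_mulNx.
by move=> y x Kx /=; rewrite pK// mul0r.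
Qed.

Lemma convl_smooth f p b : is_distribution f -> test p -> csmooth_on setT b ->
  csmooth_on setT (convl f p b).
Proof.
move=> df /testP[sp [K cK pK]] sb.
apply: (param_csmooth (Phi := fun w : V * V => p w.2 * b (mul w.1 (- w.2))) df cK).
  apply: csmooth_onM; first exact: openT.
    exact: (csmooth_snd _ sp).
  exact: csmooth_mulxN.
by move=> y x Kx /=; rewrite pK// mul0r.
Qed.

(** For fixed x, a left translation moves x from psi to b under the integral; then f and the
    integral are exchanged. *)
Lemma conv_fun_right f p b psi : is_distribution f -> test p -> test b -> test psi ->
  f (fun x => p x * I (fun y => b y * psi (mul x y))) =
  I (fun y => convr f p b y * psi y).
Proof.
move=> df tp tb tpsi.
have /testP[sp [K cK pK]] := tp; have /testP[spsi [L cL psiL]] := tpsi.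
have sb := test_smooth tb.
pose Phi (w : V * V) := p w.2 * (b (mul (- w.2) w.1) * psi w.1).
have sPhi : csmooth_on setT Phi.
  apply: csmooth_onM; [exact: openT|exact: (csmooth_snd _ sp)|].
  apply: csmooth_onM; [exact: openT|exact: csmooth_mulNx|exact: (csmooth_fst _ spsi)].
have tF x : test (fun y => b (mul (- x) y) * psi y).
  exact: testM (csmooth_mull (- x) sb) tpsi.
transitivity (f (fun x => I (fun y => Phi (y, x)))).
  congr f; apply/funext => x; rewrite /Phi /= (distZ _ dI (tF x)); congr (_ * _).
  rewrite -(cint_left mu_haar x (tF x)); congr I; apply/funext => y.
  by rewrite hg_mulKx.
rewrite (cexchange mu_fin df (compactU cK cL) sPhi); last first.
  move=> y x [KLy|KLx]; rewrite /Phi /=.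
    by rewrite psiL ?mulr0// => ?; apply: KLy; right.
  by rewrite pK ?mul0r// => ?; apply: KLx; left.
congr I; apply/funext => y.
have tpb : test (fun x => p x * b (mul (- x) y)).
  apply/testP; split.
    apply: csmooth_onM; [exact: openT|exact: sp|].
    exact: (csmooth_vsec y (csmooth_mulNx sb)).
  by exists K => // x Kx; rewrite pK// mul0r.
rewrite mulrC -(distZ (psi y) df tpb).
by congr f; apply/funext => x; rewrite /Phi /=; ring.
Qed.

(** The substitution x * - y for x is made for fixed y, hence inside g: g is pulled out of the
    integral first and pushed back afterwards. It is a right translation, so unimodularity enters
    here. *)
Lemma conv_fun_left g q a psi : is_distribution g -> test q -> test a -> test psi ->
  I (fun x => a x * g (fun y => q y * psi (mul x y))) =
  I (fun x => convl g q a x * psi x).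
Proof.
move=> dg tq ta tpsi.
have /testP[sq [K cK qK]] := tq; have /testP[spsi [L cL psiL]] := tpsi.
have /testP[sa [M cM aM]] := ta.
pose Phi (w : V * V) := a w.1 * (q w.2 * psi (mul w.1 w.2)).
pose Phi' (w : V * V) := a (mul w.1 (- w.2)) * (q w.2 * psi w.1).
have sPhi : csmooth_on setT Phi.
  apply: csmooth_onM; [exact: openT|exact: (csmooth_fst _ sa)|].
  apply: csmooth_onM; [exact: openT|exact: (csmooth_snd _ sq)|exact: csmooth_mul].
have sPhi' : csmooth_on setT Phi'.
  apply: csmooth_onM; [exact: openT|exact: csmooth_mulxN|].
  apply: csmooth_onM; [exact: openT|exact: (csmooth_snd _ sq)|exact: (csmooth_fst _ spsi)].
have tq' (F : V -> R[i]) : csmooth_on setT F -> test (fun y => q y * F y).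
  move=> sF; rewrite (_ : (fun y => _) = fun y => F y * q y); first exact: testM.
  by apply/funext => y; rewrite mulrC.
transitivity (I (fun x => g (fun y => Phi (x, y)))).
  congr I; apply/funext => x.
  by rewrite -(distZ (a x) dg (tq' _ (csmooth_mull x spsi))).
rewrite -(cexchange mu_fin dg (compactU cM cK) sPhi); last first.
  move=> x y [KLx|KLy]; rewrite /Phi /=.
    by rewrite aM ?mul0r// => ?; apply: KLx; left.
  by rewrite qK ?mul0r ?mulr0// => ?; apply: KLy; right.
transitivity (g (fun y => I (fun x => Phi' (x, y)))).
  congr g; apply/funext => y.
  have tF : test (fun x => Phi' (x, y)).
    apply/testP; split; first exact: (csmooth_hsec y sPhi').
    by exists L => // x Lx; rewrite /Phi' /= psiL// !mulr0.
  rewrite -(cint_right mu_haar y tF); congr I; apply/funext => x.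
  by rewrite /Phi' /= hg_mulxK.
rewrite (cexchange mu_fin dg (compactU cL cK) sPhi'); last first.
  move=> x y [KLx|KLy]; rewrite /Phi' /=.
    by rewrite psiL ?mulr0// => ?; apply: KLx; left.
  by rewrite qK ?mul0r ?mulr0// => ?; apply: KLy; right.
congr I; apply/funext => x.
rewrite mulrC -(distZ (psi x) dg (tq' _ (csmooth_vsec x (csmooth_mulxN sa)))).
by congr g; apply/funext => y; rewrite /Phi' /=; ring.
Qed.

End Convolution.

(** * The commutator of two cut-off symbols near a central point *)

Section Commutator.
Variables (R : realType) (m : nat) (G : homogeneousGroup R m).
Notation V := 'rV[R]_m.
Notation mul := (hg_mul G).
Variable mu : {measure set (borel R m) -> \bar R}.
Hypothesis mu_haar : is_haar G mu.
Notation I := (cintegral mu).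
Notation near_conv f p g q := (conv G (fmul p f) (fmul q g)).
Implicit Types (phi psi a b c p q e : V -> R[i]) (f g : functional R m).

Let mu_fin := haar_fin mu_haar.
Let dI := cint_distribution mu_fin.

Lemma test_mulr p (X : V -> R[i]) : test p -> csmooth_on setT X ->
  test (fun x => p x * X x).
Proof.
move=> tp sX; rewrite (_ : (fun x => _) = fun x => X x * p x); first exact: testM.
by apply/funext => x; rewrite mulrC.
Qed.

Lemma inner_smooth g q psi : is_distribution g -> test q -> test psi ->
  csmooth_on setT (fun x => fmul q g (fun y => psi (mul x y))).
Proof.
move=> dg /testP[sq [K cK qK]] tpsi.
apply: (param_csmooth (Phi := fun w : V * V => q w.2 * psi (mul w.1 w.2)) dg cK).
  apply: csmooth_onM; first exact: openT.
    exact: (csmooth_snd _ sq).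
  exact: (csmooth_mul G (test_smooth tpsi)).
by move=> y x Kx /=; rewrite qK// mul0r.
Qed.

Lemma fmulB q g : is_distribution g -> test q ->
  forall psi1 psi2, csmooth_on setT psi1 -> csmooth_on setT psi2 ->
  fmul q g (fun x => psi1 x - psi2 x) = fmul q g psi1 - fmul q g psi2.
Proof.
move=> dg tq psi1 psi2 s1 s2; rewrite /fmul -(distB dg (test_mulr tq s1) (test_mulr tq s2)).
by congr g; apply/funext => x; rewrite mulrBr.
Qed.

Lemma conv_right_density f g dg p c psi : is_distribution f -> test p ->
  smooth_density mu g dg -> test c -> zero_near0 c -> test psi ->
  near_conv f p g c psi = I (fun y => convr G f p (fun y => c y * dg y) y * psi y).
Proof.
move=> df tp sdg tc c0 tpsi.
rewrite -(conv_fun_right mu_haar df tp (test_mul_density sdg.1 tc c0) tpsi).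
congr f; apply/funext => x; congr (_ * _); rewrite /fmul.
rewrite (density_mul sdg tc c0)//.
exact: (csmooth_mull G x (test_smooth tpsi)).
Qed.

Lemma conv_left_density f g df q c psi : smooth_density mu f df ->
  test c -> zero_near0 c -> is_distribution g -> test q -> test psi ->
  near_conv f c g q psi = I (fun x => convl G g q (fun x => c x * df x) x * psi x).
Proof.
move=> sdf tc c0 dg tq tpsi.
rewrite -(conv_fun_left mu_haar dg tq (test_mul_density sdf.1 tc c0) tpsi).
exact: (density_mul sdf tc c0 (inner_smooth dg tq tpsi)).
Qed.

Lemma conv_subl f g p1 p2 q psi : is_distribution f -> is_distribution g ->
  test p1 -> test p2 -> test q -> test psi ->
  near_conv f (fun x => p1 x - p2 x) g q psi =
  near_conv f p1 g q psi - near_conv f p2 g q psi.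
Proof.
move=> df dg t1 t2 tq tpsi; have si := inner_smooth dg tq tpsi.
set X := fun x => _ in si.
transitivity (f (fun x => p1 x * X x - p2 x * X x)).
  by congr f; apply/funext => x; rewrite mulrBl.
by apply: distB => //; exact: test_mulr.
Qed.

Lemma conv_subr f g p q1 q2 psi : is_distribution f -> is_distribution g ->
  test p -> test q1 -> test q2 -> test psi ->
  near_conv f p g (fun x => q1 x - q2 x) psi =
  near_conv f p g q1 psi - near_conv f p g q2 psi.
Proof.
move=> df dg tp t1 t2 tpsi.
have s1 := inner_smooth dg t1 tpsi; have s2 := inner_smooth dg t2 tpsi.
rewrite /conv -(fmulB df tp s1 s2); congr fmul; apply/funext => x.
have sx := csmooth_mull G x (test_smooth tpsi).
set X := fun x => _ in sx.
transitivity (g (fun y => q1 y * X y - q2 y * X y)).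
  by congr g; apply/funext => y; rewrite mulrBl.
exact: (distB dg (test_mulr t1 sx) (test_mulr t2 sx)).
Qed.

(** Composing phi with a large dilation shrinks its support into a ball of radius d around 0. By
    continuity of the product at (0, 0), d can be such that products of two points of this ball have
    norm at most half that of w, and these miss the ball of that radius around w. *)
Lemma cutoff_shrink phi w : cutoff phi -> w != 0 ->
  exists chi (U : set V), [/\ cutoff chi, open U, U w &
    forall x y, chi x != 0 -> chi y != 0 -> ~ U (mul x y)].
Proof.
move=> [tphi phi1] w0; have w2 : 0 < `|w| / 2 by rewrite divr_gt0 ?normr_gt0.
have cm : continuous (fun p : V * V => mul p.1 p.2) := smooth_continuous (hg_smooth G).
have [d d0 Hd] := continuous_dist (cm (0, 0)) w2.
have /testP[_ [K cK phiK]] := tphi.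
have [M M0 HM] := continuous_compact_bounded (@layer_norm_continuous R m G) cK.
have [n nM] : exists n, dyadic R n * M < d.
  have l0 : (fun n => dyadic R n * M) @ \oo --> (0 : R).
    by rewrite -[X in _ --> X](mul0r M); apply: cvgMl; exact: dyadic_cvg0.
  have [N _ HN] := (cvgr0Pnorm_lt _).1 l0 d d0; exists N.
  by apply: le_lt_trans (ler_norm _) (HN N _) => /=.
have t0 : dyadic R n != 0 by rewrite gt_eqF// dyadic_gt0.
pose chi x := phi (dil G (dyadic R n)^-1 x).
have small x : chi x != 0 -> `|x| < d.
  move=> cx; have Kx : K (dil G (dyadic R n)^-1 x).
    by apply: contrapT => /phiK; apply/eqP.
  apply: le_lt_trans nM; rewrite -[in leLHS](dilVK G t0 x).
  apply: le_trans (dil_le _ _ (dyadic_le1 R n)) _.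
  rewrite ler_wpM2l ?(ltW (dyadic_gt0 _ _))//.
  exact: le_trans (ler_norm _) (HM _ Kx).
exists chi, (ball w (`|w| / 2)); split.
- split.
    apply: (test_comp (th' := dil G (dyadic R n))) => //.
    + exact: dil_smooth.
    + exact: dil_continuous.
    + exact: dilVK.
  have c0 := @dil_continuous R m G (dyadic R n)^-1 0.
  by move: c0; rewrite /continuous_at dil0 => /(_ [set y | phi y = 1] phi1).
- exact: ball_open.
- exact: ballxx.
- move=> x y /small xd /small yd; rewrite -ball_normE /= => wxy.
  have := Hd (x, y); rewrite subr0 hg_mul0x subr0 /= => H.
  have /H h : `|(x, y) : V * V| < d by rewrite prod_normE /= gt_max xd.
  have : `|w| <= `|w - mul x y| + `|mul x y|.
    by rewrite -[X in `|X| <= _](subrK (mul x y)) ler_normD.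
  by lra.
Qed.

(** The change from phi to e is made in the second factor and then in the first: phi f * phi g - e f
    * e g = phi f * (phi - e) g + (phi - e) f * e g. In each term one factor is a test function,
    because phi - e vanishes near the singularity. *)
Lemma conv_change f g df dg phi e psi :
  is_distribution f -> smooth_density mu f df ->
  is_distribution g -> smooth_density mu g dg ->
  test phi -> test e -> zero_near0 (fun x => phi x - e x) -> test psi ->
  near_conv f phi g phi psi - near_conv f e g e psi =
  I (fun x => (convr G f phi (fun y => (phi y - e y) * dg y) x +
               convl G g e (fun y => (phi y - e y) * df y) x) * psi x).
Proof.
move=> Df sdf Dg sdg tphi te c0 tpsi; have tc := testB tphi te.
have sa := test_smooth (test_mul_density sdf.1 tc c0).
have sb := test_smooth (test_mul_density sdg.1 tc c0).
have s1 := convr_smooth G Df tphi sb; have s2 := convl_smooth G Dg te sa.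
transitivity (near_conv f phi g (fun x => phi x - e x) psi +
              near_conv f (fun x => phi x - e x) g e psi).
  rewrite (conv_subr Df Dg tphi tphi te tpsi) (conv_subl Df Dg tphi te te tpsi).
  by rewrite addrA subrK.
rewrite (conv_right_density Df tphi sdg tc c0 tpsi).
rewrite (conv_left_density sdf tc c0 Dg te tpsi).
rewrite -(distD dI (testM s1 tpsi) (testM s2 tpsi)).
by congr I; apply/funext => x; rewrite mulrDl.
Qed.

Lemma twist_central a b w : central G w -> test a -> test b ->
  I (fun x => a x * b (mul (- x) w)) = I (fun x => b x * a (mul (- x) w)).
Proof.
move=> cw ta tb.
have tF : test (fun x => a x * b (mul (- x) w)).
  apply: test_mulr => //; exact: (csmooth_vsec w (csmooth_mulNx G (test_smooth tb))).
have tF' : test (fun y => (fun x => a x * b (mul (- x) w)) (mul w y)).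
  apply: (test_comp (th := mul w) (th' := mul (- w))) tF => //.
  - exact: smooth_mull (hg_smooth G) w.
  - exact: smooth_continuous (smooth_mull (hg_smooth G) (- w)).
  - exact: hg_mulKx.
rewrite -(cint_left mu_haar w tF) -(cint_opp mu_haar tF'); congr I.
apply/funext => y; rewrite hg_mulN opprK hg_mulxNK mulrC; congr (_ * a _).
exact: cw.
Qed.

(** For central w the points - x * w and w * - x coincide, so both terms pair f with the same smooth
    function of x. Only the factor phi - e is left, and as it vanishes near 0 it turns f into its
    density. *)
Lemma convr_sub_convl f df phi e b w : is_distribution f -> smooth_density mu f df ->
  test phi -> test e -> zero_near0 (fun x => phi x - e x) -> test b -> central G w ->
  convr G f phi b w - convl G f e b w =
  I (fun x => (phi x - e x) * df x * b (mul (- x) w)).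
Proof.
move=> Df sdf tphi te c0 tb cw.
have sX := csmooth_vsec w (csmooth_mulNx G (test_smooth tb)).
rewrite -(density_mul sdf (testB tphi te) c0 sX) /=.
rewrite /convr /convl; under [X in _ - f X]eq_fun do rewrite cw.
rewrite -(distB Df (test_mulr tphi sX) (test_mulr te sX)).
by congr f; apply/funext => x; rewrite mulrBl.
Qed.

Lemma conv_supp0 f g (chi e psi : V -> R[i]) (U : set V) : is_distribution f -> is_distribution g ->
  (forall x y, chi x != 0 -> chi y != 0 -> ~ U (mul x y)) ->
  (forall x, chi x = 0 -> e x = 0) -> supp psi `<=` U ->
  near_conv f e g e psi = 0.
Proof.
move=> Df Dg HU che sp; rewrite -[RHS](dist0 Df); congr f; apply/funext => x.
have [cx|cx] := eqVneq (chi x) 0; first by rewrite che// mul0r.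
rewrite /fmul (_ : (fun y => _) = fun=> 0) ?dist0 ?mulr0//.
apply/funext => y; have [cy|cy] := eqVneq (chi y) 0; first by rewrite che// mul0r.
have -> : psi (mul x y) = 0; last by rewrite mulr0.
by apply: vanish_supp => /sp; exact: HU.
Qed.

(** E records the passage from phi1 to phi2 in the first convolution and does not depend on w. S1
    and S2 record the passage from phi2 to a cutoff e adapted to w, in the two orders of
    convolution, after which both convolutions vanish near w. At w itself S1 and S2 agree. *)
Lemma commutator_density f g df dg phi1 phi2 :
  is_distribution f -> smooth_density mu f df ->
  is_distribution g -> smooth_density mu g dg -> cutoff phi1 -> cutoff phi2 ->
  exists2 E : V -> R[i], csmooth_on setT E & forall w, w != 0 -> central G w ->
    exists (Q : V -> R[i]) (U : set V), [/\ csmooth_on setT Q, Q w = E w, open U, U w &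
      forall psi, test psi -> supp psi `<=` U ->
        near_conv f phi1 g phi1 psi - near_conv g phi2 f phi2 psi =
        I (fun x => Q x * psi x)].
Proof.
move=> Df sdf Dg sdg [t1 c1] [t2 c2].
have c12 : zero_near0 (fun x => phi1 x - phi2 x).
  by apply: filterS2 c1 c2 => x -> ->; rewrite subrr.
have t12 := testB t1 t2.
pose E := fun x => convr G f phi1 (fun y => (phi1 y - phi2 y) * dg y) x +
               convl G g phi2 (fun y => (phi1 y - phi2 y) * df y) x.
have sE : csmooth_on setT E.
  apply: csmooth_onD; first exact: openT.
    exact: convr_smooth Df t1 (test_smooth (test_mul_density sdg.1 t12 c12)).
  exact: convl_smooth Dg t2 (test_smooth (test_mul_density sdf.1 t12 c12)).
exists E => // w w0 cw.
have [chi [U [[tchi chi1] oU Uw HU]]] := cutoff_shrink (conj t2 c2) w0.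
(* Near 0, where chi is 1, e agrees with phi2; and e vanishes wherever chi does, so products of
   points where e is nonzero avoid U. *)
pose e x := chi x * phi2 x.
have te : test e := testM (test_smooth tchi) t2.
have c0 : zero_near0 (fun x => phi2 x - e x).
  by apply: filterS chi1 => x; rewrite /e => ->; rewrite mul1r subrr.
have tc := testB t2 te.
pose a := fun y => (phi2 y - e y) * df y; pose b := fun y => (phi2 y - e y) * dg y.
have ta : test a := test_mul_density sdf.1 tc c0.
have tb : test b := test_mul_density sdg.1 tc c0.
pose S1 := fun x => convr G f phi2 b x + convl G g e a x.
pose S2 := fun x => convr G g phi2 a x + convl G f e b x.
have sS1 : csmooth_on setT S1.
  apply: csmooth_onD; first exact: openT.
    exact: convr_smooth Df t2 (test_smooth tb).
  exact: convl_smooth Dg te (test_smooth ta).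
have sS2 : csmooth_on setT S2.
  apply: csmooth_onD; first exact: openT.
    exact: convr_smooth Dg t2 (test_smooth ta).
  exact: convl_smooth Df te (test_smooth tb).
exists (fun x => E x + (S1 x + (-1) * S2 x)), U; split.
- apply: csmooth_onD; [exact: openT|exact: sE|].
  apply: csmooth_onD; [exact: openT|exact: sS1|].
  by apply: csmooth_onM; [exact: openT|exact: csmooth_on_cst|exact: sS2].
- have H1 := convr_sub_convl Df sdf t2 te c0 tb cw.
  have H2 := convr_sub_convl Dg sdg t2 te c0 ta cw.
  rewrite -[RHS]addr0; congr (_ + _).
  (* The four terms are regrouped by distribution instead of by order of convolution: the pair in f,
     then the pair in g. *)
  transitivity ((convr G f phi2 b w - convl G f e b w) -
                (convr G g phi2 a w - convl G g e a w)).
    by rewrite /S1 /S2; ring.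
  by rewrite H1 H2 (twist_central cw ta tb) subrr.
- exact: oU.
- exact: Uw.
- move=> psi tpsi sp.
  have che x : chi x = 0 -> e x = 0 by rewrite /e => ->; rewrite mul0r.
  have Z1 := conv_supp0 Df Dg HU che sp; have Z2 := conv_supp0 Dg Df HU che sp.
  have X1 : near_conv f phi1 g phi1 psi - near_conv f phi2 g phi2 psi =
      I (fun x => E x * psi x) := conv_change Df sdf Dg sdg t1 t2 c12 tpsi.
  have X2 : near_conv f phi2 g phi2 psi - near_conv f e g e psi =
      I (fun x => S1 x * psi x) := conv_change Df sdf Dg sdg t2 te c0 tpsi.
  have X3 : near_conv g phi2 f phi2 psi - near_conv g e f e psi =
      I (fun x => S2 x * psi x) := conv_change Dg sdg Df sdf t2 te c0 tpsi.
  rewrite Z1 subr0 in X2; rewrite Z2 subr0 in X3.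
  have tE := testM sE tpsi; have tS1 := testM sS1 tpsi; have tS2 := testM sS2 tpsi.
  transitivity (I (fun x => E x * psi x) +
      (I (fun x => S1 x * psi x) - I (fun x => S2 x * psi x))).
    by rewrite -X1 -X2 -X3 addrA subrK.
  rewrite -(distB dI tS1 tS2) -(distD dI tE (testB tS1 tS2)); congr I.
  apply/funext => x; set E1 := E x; set T1 := S1 x; set T2 := S2 x.
  clearbody E1 T1 T2; ring.
Qed.

End Commutator.

(** * Homogeneous densities and expansions *)

Lemma rint_cvg0 (R : realType) (V : normedModType R)
    (mu : {measure set (g_sigma_algebraType (@open V)) -> \bar R})
    (mu_fin : forall K : set V, compact K -> (mu K < +oo)%E)
    (f : nat -> V -> R) (K : set V) (B : R) : compact K ->
  (forall n, continuous (f n)) -> (forall n x, ~ K x -> f n x = 0) ->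
  (forall n x, `|f n x| <= B) -> (forall x, (fun n => f n x) @ \oo --> (0 : R)) ->
  (fun n => rint mu (f n)) @ \oo --> (0 : R).
Proof.
move=> cK cf fK fB f0; have mK := measurable_compact cK.
have icst : mu.-integrable K (EFin \o (fun _ : V => B)).
  apply: measurable_bounded_integrable => //; first exact: mu_fin.
  by exists `|B|; split=> [|M cM y _]; [exact: num_real|exact: ltW].
have [|||||_ _ H] := @dominated_convergence _ (g_sigma_algebraType (@open V)) R mu K mK
  (fun n => EFin \o (f n)) (cst 0%E) (EFin \o (fun _ : V => B)).
- move=> n; apply/measurable_realfun.measurable_EFinP.
  exact: measurable_funTS (measurable_continuous (cf n)).
- exact: measurable_cst.
- by apply: aeW => x _; apply: cvg_EFin; [exact: nearW|exact: f0].
- exact: icst.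
- by apply: aeW => x n _; rewrite lee_fin.
rewrite integral0 in H; have H' := @fine_cvg R nat \oo _ _ _ H.
rewrite (_ : (fun n => _) = fun n => fine (\int[mu]_(x in K) (EFin \o f n) x)%E).
  exact: H'.
by apply/funext => n; rewrite (rint_restrict mu (fK n)).
Qed.

Lemma continuous_at_comp (R : realType) (V W : normedModType R) (h : V -> W)
    (g : W -> R) (y : V) : {for y, continuous h} -> {for h y, continuous g} ->
  {for y, continuous (fun x => g (h x))}.
Proof. by move=> ch cg; exact: (continuous_comp ch cg). Qed.

(** * Behaviour of densities under dilations *)

Section Scaling.
Variables (R : realType) (m : nat) (G : homogeneousGroup R m).
Notation V := 'rV[R]_m.
Variable mu : {measure set (borel R m) -> \bar R}.
Hypothesis mu_haar : is_haar G mu.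
Notation I := (cintegral mu).
Implicit Types (phi psi : V -> R[i]).

Let mu_fin := haar_fin mu_haar.
Let mu_open := haar_open_gt0 mu_haar.
Let dI := cint_distribution mu_fin.

Lemma dil_neq0 t x : t != 0 -> x != 0 -> dil G t x != 0.
Proof.
by move=> t0; apply: contra_neq => h; rewrite -(dilK G t0 x) h dil0.
Qed.

Lemma cint_dil t c phi : (forall a, rtest a ->
    rint mu (fun y => a (dil G t y)) = c * rint mu a) -> test phi ->
  I (fun y => phi (dil G t y)) = c%:C * I phi.
Proof.
move=> H tp; apply: complexP; rewrite ?reM ?imM !cintE /= mul0r ?subr0 ?addr0.
- exact: H (rtest_re tp).
- exact: H (rtest_im tp).
Qed.

(** For one bump b, c n is the ratio of the integrals of the dilated bump and of b. The dilated
    bumps live in one ball, have a common bound and tend to 0 pointwise. *)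
Lemma haar_scale (z : V) : z != 0 -> exists c : nat -> R, [/\ forall n, 0 < c n,
  forall n a, rtest a -> rint mu (fun y => a (dil G (dyadic R n)^-1 y)) = c n * rint mu a &
  c @ \oo --> (0 : R)].
Proof.
move=> z0.
have sp n : 0 < (dyadic R n)^-1 by rewrite invr_gt0 dyadic_gt0.
have sn n : dyadic R n != 0 := lt0r_neq0 (dyadic_gt0 R n).
have ex n : exists c : R, 0 < c /\ forall a, rtest a ->
    rint mu (fun y => a (dil G (dyadic R n)^-1 y)) = c * rint mu a.
  by have [c c0 Hc] := rint_dil mu_haar (sp n); exists c.
have [c Hc] := choice ex.
exists c; split; [by move=> n; have [] := Hc n|by move=> n; have [] := Hc n|].
(* The support of b avoids 0, so that the dilated bumps tend to 0 at every point, the origin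
   included. *)
have [b [K [tb b0 bz cK [KU bK]]]] := ball_bump (@rV_ball_compact R m) (@bump R m)
  (open_punctured (R := R) (m := m)) z0.
have Ib : 0 < rint mu b by apply: (rint_gt0 (p := z) mu_fin mu_open) => //; exact: rtest_ccs.
have [M M0 HM] := continuous_compact_bounded (@layer_norm_continuous R m G) cK.
have [B B0 HB] := continuous_compact_bounded (rtest_ccs tb).1 cK.
have bs n x : b (dil G (dyadic R n)^-1 x) != 0 -> `|x| <= dyadic R n * M.
  move=> bx; have Kx : K (dil G (dyadic R n)^-1 x).
    by apply: contrapT => /bK; apply/eqP.
  rewrite -[in leLHS](dilVK G (sn n) x).
  apply: le_trans (dil_le _ _ (dyadic_le1 R n)) _.
  rewrite ler_wpM2l ?(ltW (dyadic_gt0 _ _))//.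
  exact: le_trans (ler_norm _) (HM _ Kx).
have l0 : (fun n => rint mu (fun x => b (dil G (dyadic R n)^-1 x))) @ \oo --> (0 : R).
  apply: (rint_cvg0 (K := [set x : V | `|x - 0| <= M]) (B := B) mu_fin).
  - exact: rV_ball_compact.
  - move=> n x; apply: (continuous_comp (f := dil G (dyadic R n)^-1)).
      exact: dil_continuous.
    exact: (rtest_ccs tb).1.
  - move=> n x /= xM; apply/eqP; apply: contrapT => /negP/bs h; apply: xM.
    rewrite subr0 (le_trans h)// ler_piMl//.
    by have /andP[] := dyadic_le1 R n.
  - move=> n x; have [Kx|Kx] := pselect (K (dil G (dyadic R n)^-1 x)).
      exact: HB.
    by rewrite bK// normr0.
  - move=> x; have [->|x0] := eqVneq x 0.
      rewrite (_ : (fun n => _) = fun=> 0); first exact: cvg_cst.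
      by apply/funext => n; rewrite dil0 bK// => /KU; rewrite /punctured /= eqxx.
    apply/cvgrPdist_lt => d d0.
    have l1 : (fun n => dyadic R n * M) @ \oo --> (0 : R).
      by rewrite -[X in _ --> X](mul0r M); apply: cvgMl; exact: dyadic_cvg0.
    have xp : 0 < `|x| by rewrite normr_gt0.
    apply: filterS ((cvgr0Pnorm_lt _).1 l1 _ xp) => n nx.
    rewrite sub0r normrN (_ : b _ = 0) ?normr0//.
    apply/eqP; apply: contrapT => /negP/bs h.
    by have := lt_le_trans (le_lt_trans (ler_norm _) nx) h; rewrite ltxx.
have E n : c n = rint mu (fun x => b (dil G (dyadic R n)^-1 x)) / rint mu b.
  by have [_ ->] := Hc n; rewrite ?mulfK// gt_eqF.
rewrite (funext E : c = _) -[X in _ --> X](mul0r (rint mu b)^-1).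
exact: cvgMl.
Qed.

Lemma supp_zero_near0 psi : supp psi `<=` @punctured R m -> zero_near0 psi.
Proof.
move=> sp; have : nbhs (0 : V) (~` supp psi).
  apply: open_nbhs_nbhs; split; first by apply: closed_openC; exact: closed_closure.
  by move=> /sp; rewrite /punctured /= eqxx.
by apply: filterS => x; exact: vanish_supp.
Qed.

(** Tested against psi, the hypothesis on u becomes an identity between integrals once the dilation
    is moved from psi to e, which costs the factor c. Uniqueness of continuous densities on the
    punctured space makes it pointwise. *)
Lemma homogeneous_density (u : functional R m) (e p : V -> R[i]) (t a c : R) x :
  is_distribution u ->
  smooth_density mu u e -> csmooth_on setT p -> 0 < t -> 0 < c ->
  (forall b, rtest b -> rint mu (fun y => b (dil G t y)) = c * rint mu b) ->
  (forall phi, test phi -> u (fun x => phi (dil G t x)) =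
     a%:C * (u phi - (ln t)%:C * I (fun x => p x * phi x))) ->
  x != 0 -> c%:C * e (dil G t^-1 x) = a%:C * (e x - (ln t)%:C * p x).
Proof.
move=> du [se re] sp t0 c0 Hc Hu x0; have tn0 := lt0r_neq0 t0.
have cn0 : c%:C != 0 by rewrite (inj_eq (@complexI R)) gt_eqF.
have tin0 : t^-1 != 0 by rewrite invr_neq0.
pose d2 x := (c%:C^-1 * a%:C) * (e x + (- (ln t)%:C) * p x).
suff -> : e (dil G t^-1 x) = d2 x.
  by rewrite /d2 mulrA mulrA divff// mul1r mulNr.
apply: (density_unique mu_fin mu_open (@open_punctured R m)
  (x0 : @punctured R m x) (d1 := fun y => e (dil G t^-1 y))).
- have [/Ck_on0 e1 /Ck_on0 e2] := se 0%N.
  split; apply/Ck_on0 => y y0; have ty := dil_neq0 tin0 y0.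
  + exact: continuous_at_comp (@dil_continuous R m G t^-1 y) (e1 _ ty).
  + exact: continuous_at_comp (@dil_continuous R m G t^-1 y) (e2 _ ty).
- suff : csmooth_on (@punctured R m) d2 by move=> /(_ 0%N).
  have oP := @open_punctured R m.
  apply: csmooth_onM; [exact: oP|exact: csmooth_on_cst|].
  apply: csmooth_onD; [exact: oP|exact: se|].
  apply: csmooth_onM; [exact: oP|exact: csmooth_on_cst|].
  exact: csmooth_on_sub sp.
- move=> psi tpsi sps; have z0 := supp_zero_near0 sps.
  pose psit y := psi (dil G t y).
  have tpsit : test psit.
    apply: (test_comp (th' := dil G t^-1)) tpsi => //.
    + exact: dil_smooth.
    + exact: dil_continuous.
    + exact: dilK.
  have z1 : zero_near0 psit.
    have := @dil_continuous R m G t 0; rewrite /continuous_at dil0.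
    by move=> /(_ [set y | psi y = 0] z0).
  have tb : test (fun y => psit y * e y) := test_mul_density se tpsit z1.
  have tF : test (fun y => e (dil G t^-1 y) * psi y).
    rewrite (_ : (fun y => _) = fun y => (fun y => psit y * e y) (dil G t^-1 y)).
      apply: (test_comp (th' := dil G t)) tb => //.
      + exact: dil_smooth.
      + exact: dil_continuous.
      + exact: dilVK.
    by apply/funext => y; rewrite /psit dilVK// mulrC.
  have te : test (fun y => psi y * e y) := test_mul_density se tpsi z0.
  apply: (mulfI cn0); rewrite -(cint_dil Hc tF).
  transitivity (u psit).
    rewrite re//.
      by congr I; apply/funext => y; rewrite /psit dilK.
    have := zero_near0_supp (X := fun=> 1) z1.
    by under eq_fun do rewrite mulr1.
  rewrite Hu// re//; have tpp : test (fun y => p y * psi y) := testM sp tpsi.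
  have te' : test (fun y => e y * psi y) by under eq_fun do rewrite mulrC.
  transitivity (a%:C * I (fun y => e y * psi y + (- (ln t)%:C) * (p y * psi y))).
    by rewrite (distD dI te' (testZ _ tpp)) (distZ _ dI tpp) mulNr.
  rewrite -(distZ _ dI (testD te' (testZ _ tpp))).
  rewrite -(distZ c%:C dI); last first.
    rewrite (_ : (fun x => _) = fun y => (c%:C^-1 * a%:C) *
        (e y * psi y + (- (ln t)%:C) * (p y * psi y))).
      exact: testZ (testD te' (testZ _ tpp)).
    by apply/funext => y; rewrite /d2; ring.
  congr I; apply/funext => y; rewrite /d2 !mulrA divff// mul1r; ring.
Qed.

End Scaling.

(** * Limits along the dyadic sequence *)

Section Limit.
Variable R : realType.

(** A geometric majorant for n / 2 ^ n, which is what the dyadic parameter times its logarithm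
    amounts to. The constants make the induction exact: half of the bound at n plus half of (3 / 4)
    ^+ n is the bound at n.+1. *)
Lemma natr_dyadic_le (n : nat) : n%:R * dyadic R n <= 2 * (3 / 4) ^+ n.
Proof.
elim: n => [|n IH]; first by rewrite mul0r expr0 mulr1.
have t0 := dyadic_gt0 R n.
have tS : dyadic R n.+1 = dyadic R n / 2 by rewrite /dyadic exprSr.
have le : dyadic R n <= (3 / 4) ^+ n by apply: lerXn2r; rewrite ?nnegrE; lra.
by rewrite tS exprS -natr1; lra.
Qed.

Lemma dyadic_ln_cvg0 : (fun n => dyadic R n * ln (dyadic R n)^-1) @ \oo --> (0 : R).
Proof.
have -> : (fun n => dyadic R n * ln (dyadic R n)^-1) = fun n => ln 2 * (n%:R * dyadic R n).
  apply/funext => n; rewrite /dyadic -exprVn invrK lnXn ?ltr0n//.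
  by move: (2^-1 ^+ n) (ln 2) => x y; rewrite -(mulr_natl y); ring.
rewrite -[X in _ --> X](mulr0 (ln 2)); apply: cvgMr.
apply: (@squeeze_cvgr _ _ _ _ (fun=> 0) (fun n => 2 * (3 / 4) ^+ n)).
- by apply: nearW => n; rewrite mulr_ge0 ?natr_dyadic_le// ltW// dyadic_gt0.
- exact: cvg_cst.
- rewrite -[X in _ --> X](mulr0 2); apply: cvgMr; apply: cvg_expr.
  by rewrite ger0_norm; lra.
Qed.

(** The left side tends to 0 because c does and B converges. Every term of the sum carries a
    positive power of the dyadic parameter, which beats the logarithm. The constant A is then the
    limit of a null sequence. *)
Lemma scaling_limit (A l : R) (a b : nat -> R) (J : nat) (c B : nat -> R) :
  c @ \oo --> (0 : R) -> B @ \oo --> l ->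
  (\forall n \near \oo, c n * B n =
     A + \sum_(j < J) dyadic R n ^+ j.+1 * (a j - ln (dyadic R n)^-1 * b j)) -> A = 0.
Proof.
move=> c0 Bl H.
have s0 j : (fun n => dyadic R n ^+ j.+1 * (a j - ln (dyadic R n)^-1 * b j)) @ \oo --> (0 : R).
  have -> : (fun n => dyadic R n ^+ j.+1 * (a j - ln (dyadic R n)^-1 * b j)) =
      fun n => dyadic R n ^+ j * (a j * dyadic R n - b j * (dyadic R n * ln (dyadic R n)^-1)).
    by apply/funext => n; rewrite exprS; ring.
  rewrite -[X in _ --> X](mulr0 (0 ^+ j)); apply: cvgM.
    elim: j => [|j IH]; first exact: cvg_cst.
    rewrite (_ : (fun n => _) = fun n => dyadic R n * dyadic R n ^+ j).
      by rewrite exprS; apply: cvgM IH; exact: dyadic_cvg0.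
    by apply/funext => n; rewrite exprS.
  rewrite -[X in _ --> X](subr0 0) -{1}(mulr0 (a j)) -[X in _ - X](mulr0 (b j)).
  by apply: cvgB; apply: cvgMr; [exact: dyadic_cvg0|exact: dyadic_ln_cvg0].
have S0 : (fun n => \sum_(j < J) dyadic R n ^+ j.+1 * (a j - ln (dyadic R n)^-1 * b j))
    @ \oo --> (0 : R).
  rewrite -[X in _ --> X](_ : \sum_(j < J) (0 : R) = 0); last by rewrite big1.
  by apply: cvg_sumr => j; exact: s0.
have D0 : (fun n => c n * B n - \sum_(j < J) dyadic R n ^+ j.+1 *
    (a j - ln (dyadic R n)^-1 * b j)) @ \oo --> (0 : R).
  rewrite -[X in _ --> X](_ : 0 * l - 0 = 0); last by rewrite mul0r subr0.
  exact: (cvgB (cvgM c0 Bl) S0).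
apply/eqP; apply: contrapT => /negP A0; have Ap : 0 < `|A| by rewrite normr_gt0.
have [n [/= h1 h2]] := filter_ex (filterI H ((cvgr0Pnorm_lt _).1 D0 _ Ap)).
by move: h2; rewrite h1 addrK ltxx.
Qed.

End Limit.

(** * Densities of distributions and of expansions *)

Section Representation.
Variables (R : realType) (m : nat).
Notation V := 'rV[R]_m.
Variable mu : {measure set (borel R m) -> \bar R}.
Hypothesis mu_fin : forall K : set V, compact K -> (mu K < +oo)%E.
Hypothesis mu_open : forall U : set V, open U -> U !=set0 -> (0 < mu U)%E.
Notation I := (cintegral mu).
Implicit Types (phi psi d : V -> R[i]) (u v : functional R m) (U : set V).

Lemma cCk_onD n U d1 d2 : open U -> cCk_on n U d1 -> cCk_on n U d2 ->
  cCk_on n U (fun x => d1 x + d2 x).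
Proof.
move=> oU [r1 i1] [r2 i2]; split.
- rewrite (_ : cre _ = fun x => cre d1 x + cre d2 x); first exact: (Ck_onD oU r1 r2).
  by apply/funext => x; exact: reD.
- rewrite (_ : cim _ = fun x => cim d1 x + cim d2 x); first exact: (Ck_onD oU i1 i2).
  by apply/funext => x; exact: imD.
Qed.

Lemma cCk_onN n U d : open U -> cCk_on n U d -> cCk_on n U (fun x => - d x).
Proof.
move=> oU [r1 i1]; split.
- rewrite (_ : cre _ = fun x => (-1) *: cre d x); first exact: (Ck_onZ (-1) oU r1).
  by apply/funext => x; rewrite scaleN1r; exact: reN.
- rewrite (_ : cim _ = fun x => (-1) *: cim d x); first exact: (Ck_onZ (-1) oU i1).
  by apply/funext => x; rewrite scaleN1r; exact: imN.
Qed.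

Lemma cCk_on_sub n U U' d : U' `<=` U -> cCk_on n U d -> cCk_on n U' d.
Proof. by move=> UU [r i]; split; [exact: (Ck_on_sub UU r)|exact: (Ck_on_sub UU i)]. Qed.

Definition cccs phi := ccs (cre phi) /\ ccs (cim phi).

Lemma density_ccs U d psi : open U -> cCk_on 0 U d -> test psi ->
  supp psi `<=` U -> cccs (fun x => d x * psi x).
Proof.
move=> oU [/Ck_on0 r /Ck_on0 i] tp sU; have cK : compact (supp psi) := tp.2.
have cr := (rtest_ccs (rtest_re tp)).1; have ci := (rtest_ccs (rtest_im tp)).1.
have rK x : ~ supp psi x -> cre psi x = 0 by move=> /vanish_supp; rewrite /cre => ->.
have iK x : ~ supp psi x -> cim psi x = 0 by move=> /vanish_supp; rewrite /cim => ->.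
split.
- rewrite (_ : cre _ = fun x => (-1) * (cim d x * cim psi x) + cre d x * cre psi x).
    by apply: ccs_lin; [exact: (ccs_mul_on oU cK sU i ci iK)|exact: (ccs_mul_on oU cK sU r cr rK)].
  by apply/funext => x; rewrite /cre reM mulN1r addrC.
- rewrite (_ : cim _ = fun x => 1 * (cre d x * cim psi x) + cim d x * cre psi x).
    by apply: ccs_lin; [exact: (ccs_mul_on oU cK sU r ci iK)|exact: (ccs_mul_on oU cK sU i cr rK)].
  by apply/funext => x; rewrite /cim imM mul1r.
Qed.

Lemma cintD phi psi : cccs phi -> cccs psi -> I (fun x => phi x + psi x) = I phi + I psi.
Proof.
move=> [r1 i1] [r2 i2]; apply: complexP; rewrite ?reD ?imD !cintE /=.
- rewrite (_ : cre _ = fun x => 1 * cre phi x + cre psi x); last first.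
    by apply/funext => x; rewrite mul1r; exact: reD.
  by rewrite rint_lin// mul1r.
- rewrite (_ : cim _ = fun x => 1 * cim phi x + cim psi x); last first.
    by apply/funext => x; rewrite mul1r; exact: imD.
  by rewrite rint_lin// mul1r.
Qed.

Lemma cintB phi psi : cccs phi -> cccs psi -> I (fun x => phi x - psi x) = I phi - I psi.
Proof.
move=> [r1 i1] [r2 i2]; apply: complexP; rewrite ?reD ?imD ?reN ?imN !cintE /=.
- rewrite (_ : cre _ = fun x => (-1) * cre psi x + cre phi x); last first.
    by apply/funext => x; rewrite mulN1r addrC /cre reD reN.
  by rewrite rint_lin// mulN1r addrC.
- rewrite (_ : cim _ = fun x => (-1) * cim psi x + cim phi x); last first.
    by apply/funext => x; rewrite mulN1r addrC /cim imD imN.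
  by rewrite rint_lin// mulN1r addrC.
Qed.

Lemma represents_on_sub U U' u d : U' `<=` U -> represents mu U u d ->
  represents mu U' u d.
Proof. by move=> UU H phi tp sp; apply: H => //; exact: subset_trans UU. Qed.

Lemma representsD U u v d d' : open U -> cCk_on 0 U d -> cCk_on 0 U d' ->
  represents mu U u d -> represents mu U v d' ->
  represents mu U (fun psi => u psi + v psi) (fun x => d x + d' x).
Proof.
move=> oU cd cd' H H' psi tp sp; rewrite (H _ tp sp) (H' _ tp sp).
rewrite -(cintD (density_ccs oU cd tp sp) (density_ccs oU cd' tp sp)).
by congr I; apply/funext => x; rewrite mulrDl.
Qed.

Lemma representsB U u v d d' : open U -> cCk_on 0 U d -> cCk_on 0 U d' ->
  represents mu U u d -> represents mu U v d' ->
  represents mu U (fun psi => u psi - v psi) (fun x => d x - d' x).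
Proof.
move=> oU cd cd' H H' psi tp sp; rewrite (H _ tp sp) (H' _ tp sp).
rewrite -(cintB (density_ccs oU cd tp sp) (density_ccs oU cd' tp sp)).
by congr I; apply/funext => x; rewrite mulrBl.
Qed.

Lemma represents_sum U (u : nat -> functional R m) (d : nat -> V -> R[i]) J : open U ->
  (forall j, cCk_on 0 U (d j)) -> (forall j, represents mu U (u j) (d j)) ->
  cCk_on 0 U (fun x => \sum_(j < J) d j x) /\
  represents mu U (fun psi => \sum_(j < J) u j psi) (fun x => \sum_(j < J) d j x).
Proof.
move=> oU cd H; elim: J => [|J [IH1 IH2]].
  have -> : (fun x => \sum_(j < 0) d j x) = fun=> 0.
    by apply/funext => x; rewrite big_ord0.
  split; first exact: (csmooth_on_cst U 0 0%N).
  move=> psi _ _; rewrite big_ord0 -[LHS](dist0 (cint_distribution mu_fin)).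
  by congr I; apply/funext => x; rewrite mul0r.
have -> : (fun x => \sum_(j < J.+1) d j x) = fun x => \sum_(j < J) d j x + d J x.
  by apply/funext => x; rewrite big_ord_recr.
split; first exact: (cCk_onD oU IH1 (cd J)).
have -> : (fun psi => \sum_(j < J.+1) u j psi) =
    fun psi => \sum_(j < J) u j psi + u J psi.
  by apply/funext => x; rewrite big_ord_recr.
exact: (representsD oU IH1 (cd J) IH2 (H J)).
Qed.

Lemma represents_unique U u d1 d2 z : open U -> U z -> cCk_on 0 U d1 -> cCk_on 0 U d2 ->
  represents mu U u d1 -> represents mu U u d2 -> d1 z = d2 z.
Proof.
move=> oU Uz c1 c2 r1 r2; apply: (density_unique mu_fin mu_open oU Uz c1 c2).
by move=> psi tp sp; rewrite -r1// -r2.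
Qed.

(** A continuous remainder is enough for a limit at 0, hence the order N = 0. On an open W avoiding
    the origin every term of the expansion is a function, so k gets a density there; U and r are
    fixed before W, which lets W follow an orbit into 0. *)
Lemma expansion_density k (k_ : nat -> functional R m) (e : nat -> V -> R[i]) :
  expansion mu k k_ -> (forall j, smooth_density mu (k_ j) (e j)) ->
  exists J0 : nat, forall J, (J0 <= J)%N -> exists (U : set V) (r : V -> R[i]),
    [/\ open U, U 0, cCk_on 0 U r & forall W, open W -> W `<=` U ->
        W `<=` @punctured R m ->
      cCk_on 0 W (fun x => r x + \sum_(j < J) e j x) /\
      represents mu W k (fun x => r x + \sum_(j < J) e j x)].
Proof.
move=> H se; have [J0 HJ] := H 0%N; exists J0 => J /HJ[U [r [oU U0 cr rr]]].
exists U, r; split=> // W oW WU WP.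
have ce j : cCk_on 0 W (e j) := cCk_on_sub WP ((se j).1 0%N).
have re j : represents mu W (k_ j) (e j) := represents_on_sub WP (se j).2.
have [cs rs] := represents_sum J oW ce re.
have cr' := cCk_on_sub WU cr.
split; first exact: (cCk_onD oW cr' cs).
rewrite (_ : k = fun psi => (k psi - \sum_(j < J) k_ j psi) + \sum_(j < J) k_ j psi).
  exact: (representsD oW cr' cs (represents_on_sub WU rr) rs).
by apply/funext => psi; rewrite subrK.
Qed.

End Representation.

Lemma cvg_seq_comp (R : realType) (V : normedModType R) (w : nat -> V) (g : V -> R)
    (x : V) : w @ \oo --> x -> {for x, continuous g} ->
  (fun n => g (w n)) @ \oo --> g x.
Proof. by move=> wx cg; exact: (cvg_comp _ _ wx cg). Qed.

(** * Comparison of principal parts *)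

Section PrincipalPart.
Variables (R : realType) (m : nat) (G : homogeneousGroup R m).
Notation V := 'rV[R]_m.
Variable mu : {measure set (borel R m) -> \bar R}.
Hypothesis mu_haar : is_haar G mu.
Notation I := (cintegral mu).

Let mu_fin := haar_fin mu_haar.
Let mu_open := haar_open_gt0 mu_haar.
Let dI := cint_distribution mu_fin.

(** The degree is - Q + j, so the exponent - Q - (- Q + j) is - j and the homogeneous dimension
    drops out. *)
Definition log_homogeneous_with (u : functional R m) (p : V -> R[i]) (j : nat) :=
  forall (t : R) phi, 0 < t -> test phi -> u (fun x => phi (dil G t x)) =
    (t ^ (- j%:Z))%:C * (u phi - (ln t)%:C * I (fun x => p x * phi x)).

(** The leading term joins the others as the case j = 0 with zero logarithmic coefficient, and the
    densities and coefficients of all terms are chosen at once. *)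
Lemma principal_terms k h : principal_part G mu k h ->
  exists (k_ : nat -> functional R m) (e p : nat -> V -> R[i]),
  [/\ k_ 0%N = h, expansion mu k k_, (forall x, p 0%N x = 0) &
    forall j, [/\ is_distribution (k_ j), smooth_density mu (k_ j) (e j),
      csmooth_on setT (p j) & log_homogeneous_with (k_ j) (p j) j]].
Proof.
move=> [k_ [k0 [dh rh hh] Hk ek]].
have Hj j : exists ep : (V -> R[i]) * (V -> R[i]),
  [/\ is_distribution (k_ j), smooth_density mu (k_ j) ep.1,
      csmooth_on setT ep.2, log_homogeneous_with (k_ j) ep.2 j &
      (j = 0)%N -> forall x, ep.2 x = 0].
  case: j => [|j].
    have [d Hd] := rh; exists (d, fun=> 0); rewrite k0; split=> //.
      exact: csmooth_on_cst.
    move=> t phi t0 tphi; have := hh t phi t0 tphi.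
    rewrite subrr oppr0 => ->; congr (_ * _).
    rewrite (_ : (fun x => _) = fun=> 0) ?(dist0 dI) ?mulr0 ?subr0//.
    by apply/funext => x; rewrite mul0r.
  have [dk [d Hd] [p [sp _ Hp]]] := Hk j.+1 isT.
  exists (d, p); split=> // t phi t0 tphi; have := Hp t phi t0 tphi.
  by rewrite opprD opprK addrA addNr add0r.
have [ep Hep] := choice Hj.
exists k_, (fun j => (ep j).1), (fun j => (ep j).2); split=> //.
  by have [_ _ _ _ H] := Hep 0%N; exact: H.
by move=> j; have [? ? ? ? _] := Hep j.
Qed.

Lemma central_dil t z : 0 < t -> central G z -> central G (dil G t z).
Proof.
move=> t0 cz x; have tn0 := lt0r_neq0 t0.
by rewrite -(dilVK G tn0 x) -!dilM// cz.
Qed.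

(** Homogeneity is applied with t = 2 ^ n, the inverse of the dyadic parameter, so that e is
    evaluated on the orbit of z and t ^ (- j) becomes a power of [dyadic R n]. *)
Lemma scaled_term (u : functional R m) (e p : V -> R[i]) j n (c : R) z :
  is_distribution u -> smooth_density mu u e -> csmooth_on setT p ->
  log_homogeneous_with u p j -> 0 < c ->
  (forall a, rtest a ->
     rint mu (fun y => a (dil G (dyadic R n)^-1 y)) = c * rint mu a) -> z != 0 ->
  c%:C * e (dil G (dyadic R n) z) =
  (dyadic R n ^+ j)%:C * (e z - (ln (dyadic R n)^-1)%:C * p z).
Proof.
move=> du se sp Hu c0 Hc z0.
have t0 : 0 < (dyadic R n)^-1 by rewrite invr_gt0 dyadic_gt0.
have := homogeneous_density mu_haar du se sp t0 c0 Hc (fun phi => Hu _ phi t0) z0.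
by rewrite invrK exprz_inv opprK.
Qed.

(** At the points w n of the orbit, the density of k1 - k2 read off the two expansions equals E.
    Multiplication by c n undoes the scaling: the leading difference becomes constant, the higher
    terms decay, and B n, made of E and the two remainders, converges. *)
Lemma principal_parts_eq k1 k2 h1 h2 (E : V -> R[i]) z : z != 0 -> central G z ->
  principal_part G mu k1 h1 -> principal_part G mu k2 h2 -> csmooth_on setT E ->
  (forall w, w != 0 -> central G w ->
    exists (Q : V -> R[i]) (U : set V), [/\ csmooth_on setT Q, Q w = E w, open U, U w &
      represents mu U (fun psi => k1 psi - k2 psi) Q]) ->
  eval_at mu z h1 = eval_at mu z h2.
Proof.
move=> z0 cz /principal_terms[k1_ [e1 [p1 [k10 ex1 p10 t1]]]].
move=> /principal_terms[k2_ [e2 [p2 [k20 ex2 p20 t2]]]] sE HE.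
have se1 j : smooth_density mu (k1_ j) (e1 j) by have [] := t1 j.
have se2 j : smooth_density mu (k2_ j) (e2 j) by have [] := t2 j.
rewrite -k10 -k20 (eval_at_density mu_fin mu_open (se1 0%N) z0).
rewrite (eval_at_density mu_fin mu_open (se2 0%N) z0).
have [J1 HJ1] := expansion_density mu_fin ex1 se1.
have [J2 HJ2] := expansion_density mu_fin ex2 se2.
(* Both expansions are cut at the same number J.+1 of terms, so that J of them remain once the
   leading one is split off. *)
pose J := maxn J1 J2.
have [U1 [r1 [oU1 U10 cr1 HW1]]] := HJ1 J.+1 (leqW (leq_maxl J1 J2)).
have [U2 [r2 [oU2 U20 cr2 HW2]]] := HJ2 J.+1 (leqW (leq_maxr J1 J2)).
have [c [c0 Hc cl]] := haar_scale mu_haar z0.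
pose w n := dil G (dyadic R n) z.
have w_cvg : w @ \oo --> (0 : V) := dil_dyadic_cvg0 G z.
have w0 n : w n != 0 := dil_neq0 G (lt0r_neq0 (dyadic_gt0 R n)) z0.
have cw n : central G (w n) := central_dil (dyadic_gt0 R n) cz.
pose B n := E (w n) - (r1 (w n) - r2 (w n)).
have key : \forall n \near \oo, (c n)%:C * B n = (e1 0%N z - e2 0%N z) +
   \sum_(j < J) (dyadic R n ^+ j.+1)%:C * ((e1 j.+1 z - e2 j.+1 z) -
      (ln (dyadic R n)^-1)%:C * (p1 j.+1 z - p2 j.+1 z)).
  have n1 : nbhs (0 : V) (U1 `&` U2).
    by apply: open_nbhs_nbhs; split; [exact: openI|split].
  have ev : \forall n \near \oo, (U1 `&` U2) (w n) := w_cvg _ n1.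
  apply: filterS ev => n [Uw1 Uw2].
  have [Q [U [sQ QE oU Uw HQ]]] := HE (w n) (w0 n) (cw n).
  pose W := (U `&` (U1 `&` U2)) `&` @punctured R m.
  have oW : open W.
    apply: openI; last exact: open_punctured.
    by apply: openI => //; exact: openI.
  have WU1 : W `<=` U1 by move=> x [[_ []]].
  have WU2 : W `<=` U2 by move=> x [[_ []]].
  have WU : W `<=` U by move=> x [[]].
  have WP : W `<=` @punctured R m by move=> x [].
  have Ww : W (w n) by split; [split|exact: w0].
  have [cW1 rW1] := HW1 W oW WU1 WP; have [cW2 rW2] := HW2 W oW WU2 WP.
  have cQ : cCk_on 0 W Q := cCk_on_sub (@subsetT _ W) (sQ 0%N).
  have := represents_unique mu_fin mu_open oW Ww cQ
    (cCk_onD oW cW1 (cCk_onN oW cW2)) (represents_on_sub WU HQ)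
    (representsB mu_fin oW cW1 cW2 rW1 rW2).
  rewrite QE => QEw.
  have -> : B n = \sum_(j < J.+1) (e1 j (w n) - e2 j (w n)).
    by rewrite /B QEw sumrB; ring.
  have T1 j := let: And4 d s p h := t1 j in scaled_term d s p h (c0 n) (Hc n) z0.
  have T2 j := let: And4 d s p h := t2 j in scaled_term d s p h (c0 n) (Hc n) z0.
  rewrite mulr_sumr big_ord_recl /=; congr (_ + _).
    by rewrite mulrBr T1 T2 p10 p20 expr0 !mulr0 !subr0 !mul1r.
  by apply: eq_bigr => j _; rewrite mulrBr T1 T2 -mulrBr; congr (_ * _); ring.
(* [scaling_limit] is about real numbers; rho stands for the real or the imaginary part, of which
   only real linearity and continuity are used. *)
have part (rho : R[i] -> R) : (forall x y, rho (x + y) = rho x + rho y) ->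
    (forall (a : R) x, rho (a%:C * x) = a * rho x) ->
    (forall f : V -> R[i], cre f @ (0 : V) --> cre f 0 ->
       cim f @ (0 : V) --> cim f 0 -> (fun x => rho (f x)) @ (0 : V) --> rho (f 0)) ->
  rho (e1 0%N z - e2 0%N z) = 0.
  move=> rD rZ rC.
  have rN x : rho (- x) = - rho x.
    by have := rZ (-1) x; rewrite rmorphN1 !mulN1r.
  have rho0 : rho 0 = 0 by have := rZ 0 0; rewrite mulr0 mul0r.
  have c1 (r : V -> R[i]) U : open U -> U 0 -> cCk_on 0 U r ->
      (fun n => rho (r (w n))) @ \oo --> rho (r 0).
    move=> oU U0 [/Ck_on0 a1 /Ck_on0 a2].
    by apply: (cvg_seq_comp (g := fun x => rho (r x)) w_cvg); apply: rC; [exact: a1|exact: a2].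
  apply: (@scaling_limit R _ (rho (E 0) - (rho (r1 0) - rho (r2 0)))
    (fun j => rho (e1 j.+1 z - e2 j.+1 z)) (fun j => rho (p1 j.+1 z - p2 j.+1 z)) J c
    (fun n => rho (E (w n)) - (rho (r1 (w n)) - rho (r2 (w n))))).
  - exact: cl.
  - apply: cvgB; first exact: (c1 E setT openT Logic.I (sE 0%N)).
    by apply: cvgB; [exact: c1 cr1|exact: c1 cr2].
  - apply: filterS key => n; rewrite -!rN -!rD -!rN -!rD -rZ => ->.
    rewrite rD; congr (_ + _); rewrite (big_morph rho rD rho0).
    by apply: eq_bigr => j _; rewrite rZ rD rN rZ.
apply/eqP; rewrite -subr_eq0; apply/eqP; apply: complexP.
- apply: (part (@complex.Re R)) => [x y|a x|f //].
    exact: reD.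
  by rewrite reM mul0r subr0.
- apply: (part (@complex.Im R)) => [x y|a x|f //].
    exact: imD.
  by rewrite imM mul0r addr0.
Qed.

End PrincipalPart.

Lemma smooth_density_lin (R : realType) (m : nat)
    (mu : {measure set (borel R m) -> \bar R})
    (mu_fin : forall K : set 'rV[R]_m, compact K -> (mu K < +oo)%E)
    (a : R[i]) (f g : functional R m) df dg :
  smooth_density mu f df -> smooth_density mu g dg ->
  smooth_density mu (fun phi => a * f phi + g phi) (fun x => a * df x + dg x).
Proof.
move=> [sf rf] [sg rg]; have oP := @open_punctured R m; split.
  apply: csmooth_onD; [exact: oP| |exact: sg].
  by apply: csmooth_onM; [exact: oP|exact: csmooth_on_cst|exact: sf].
move=> psi tp sp; rewrite rf// rg//; have z0 := supp_zero_near0 sp.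
have T (d : 'rV[R]_m -> R[i]) : csmooth_on (@punctured R m) d ->
    test (fun x => d x * psi x).
  move=> sd; rewrite (_ : (fun x => _) = fun x => psi x * d x).
    exact: test_mul_density.
  by apply/funext => x; rewrite mulrC.
rewrite -((cint_distribution mu_fin).1 a _ _ (T _ sf) (T _ sg)).
by congr cintegral; apply/funext => x; rewrite mulrDl mulrA.
Qed.

Theorem proposition2p4 (R : realType) (m : nat) (G : homogeneousGroup R m)
    (mu : {measure set (borel R m) -> \bar R}) (mu_haar : is_haar G mu)
    (z : 'rV[R]_m) (z_neq0 : z != 0) (z_central : central G z) :
  (forall (a : complex R) (f g : functional R m),
     symbol G mu f -> symbol G mu g ->
     eval_at mu z (fun phi => a * f phi + g phi) =
     a * eval_at mu z f + eval_at mu z g) /\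
  (forall f g fg gf : functional R m,
     symbol G mu f -> symbol G mu g ->
     is_symbol_mul G mu f g fg -> is_symbol_mul G mu g f gf ->
     eval_at mu z fg = eval_at mu z gf).
Proof.
have mu_fin := haar_fin mu_haar; have mu_open := haar_open_gt0 mu_haar.
split=> [a f g [_ [df sf] _] [_ [dg sg] _]|f g fg gf].
  rewrite (eval_at_density mu_fin mu_open sf z_neq0).
  rewrite (eval_at_density mu_fin mu_open sg z_neq0).
  exact: (eval_at_density mu_fin mu_open (smooth_density_lin mu_fin a sf sg) z_neq0).
move=> [Df [df sf] _] [Dg [dg sg] _] [phi1 [c1 pp1]] [phi2 [c2 pp2]].
(* The two products come with unrelated cutoffs phi1 and phi2; their difference is absorbed in E. *)
have [E sE HE] := commutator_density mu_haar Df sf Dg sg c1 c2.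
exact: (principal_parts_eq mu_haar z_neq0 z_central pp1 pp2 sE HE).
Qed.
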